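(* Let $N\ge2$, let $\Omega\subset\mathbb{R}^N$ be a bounded domain with smooth boundary, let $1<p_1,p_2<N$, and let the exponents satisfy $$-1<\alpha_1,\beta_2<0,\qquad -1<\beta_1<p_1-1,\qquad -1<\alpha_2<p_2-1.$$ For $\Lambda>0$ put $$\underline{u}_\Lambda=\Lambda^{-1}(\Lambda-\hat\phi_{1,p_1}),\quad\underline{v}_\Lambda=\Lambda^{-1}(\Lambda-\hat\phi_{1,p_2}),\quad\overline{u}_\Lambda=\Lambda(\Lambda-y_1),\quad\overline{v}_\Lambda=\Lambda(\Lambda-y_2).$$ Then, if $\Lambda>0$ is big enough, the problem $$(\mathrm P)\quad\begin{cases}-\Delta_{p_1}u+|u|^{p_1-2}u=u^{\alpha_1}+v^{\beta_1}&\text{in }\Omega,\\ -\Delta_{p_2}v+|v|^{p_2-2}v=u^{\alpha_2}+v^{\beta_2}&\text{in }\Omega,\\ u,v>0&\text{in }\Omega,\\ \frac{\partial u}{\partial\eta}=\frac{\partial v}{\partial\eta}=0&\text{on }\partial\Omega\end{cases}$$ admits a solution $(u,v)\in int\,\mathcal{C}_+^{1,\tau}(\overline\Omega)\times int\,\mathcal{C}_+^{1,\tau}(\overline\Omega)$, for some $\tau\in(0,1)$, within $[\underline{u}_\Lambda,\overline{u}_\Lambda]\times[\underline{v}_\Lambda,\overline{v}_\Lambda]$. This solution is unique (within this rectangle) provided $\alpha_2,\beta_1\in(-1,0)$ and $$\max\Big\{\frac{-\gamma_1\alpha_i}{p_1-1},\frac{-\gamma_2\beta_i}{p_2-1}\Big\}<p_i-1,\quad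 i=1,2,\qquad\text{where }\gamma_i=\max\{-\alpha_i,-\beta_i\}.$$
   Context: $\eta$ is the unit outer normal to $\partial\Omega$; $\Delta_p w=\mathrm{div}(|\nabla w|^{p-2}\nabla w)$. $int\,\mathcal{C}_+^{1,\tau}(\overline\Omega)=\{w\in\mathcal{C}^{1,\tau}(\overline\Omega):w(x)>0\ \forall x\in\overline\Omega\}$; $int\,\mathcal{C}_+^{1}(\overline\Omega)$ is the analogous set in $\mathcal{C}^1(\overline\Omega)$. $(u,v)\in[\underline u,\overline u]\times[\underline v,\overline v]$ means $\underline u\le u\le\overline u$ and $\underline v\le v\le\overline v$ in $\Omega$. A solution of $(\mathrm P)$ is a pair $(u,v)\in W^{1,p_1}(\Omega)\times W^{1,p_2}(\Omega)$ with $u,v>0$ in $\Omega$ and, for all $(\varphi,\psi)\in W^{1,p_1}(\Omega)\times W^{1,p_2}(\Omega)$, $$\int_\Omega|\nabla u|^{p_1-2}\nabla u\cdot\nabla\varphi\,dx+\int_\Omega|u|^{p_1-2}u\varphi\,dx=\int_\Omega(u^{\alpha_1}+v^{\beta_1})\varphi\,dx,$$ $$\int_\Omega|\nabla v|^{p_2-2}\nabla v\cdot\nabla\psi\,dx+\int_\Omega|v|^{p_2-2}v\psi\,dx=\int_\Omega(u^{\alpha_2}+v^{\beta_2})\psi\,dx.$$ For $i=1,2$, $\hat\phi_{1,p_i}\in int\,\mathcal{C}_+^1(\overline\Omega)$ is a (fixed) positive eigenfunction corresponding to the first eigenvalue $\hat\lambda_{1,p_i}>0$ of the Neumann problem $$-\Delta_{p_i}\hat\phi+|\hat\phi|^{p_i-2}\hat\phi=\hat\lambda_{1,p_i}|\hat\phi|^{p_i-2}\hat\phi\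 \text{in }\Omega,\qquad\frac{\partial\hat\phi}{\partial\eta}=0\ \text{on }\partial\Omega,$$ and $y_i\in\mathcal{C}^{1,\tau}(\overline\Omega)$ is the unique solution of the Dirichlet problem $$-\Delta_{p_i}y_i+|y_i|^{p_i-2}y_i=1\ \text{in }\Omega,\qquad y_i=0\ \text{on }\partial\Omega.$$ Throughout, $\Lambda$ is taken at least so large that $\Lambda>\max_{i=1,2}\big\{2\big(1+3(3^{p_i-1}-2^{p_i-1})^{-1/(p_i-1)}+\|\hat\phi_{1,p_i}\|_\infty+\|y_i\|_\infty\big)\big\}$. *)

(* Defs.v *)
From HB Require Import structures.
From mathcomp Require Import all_boot all_order all_algebra.
From mathcomp Require Import all_classical all_reals all_analysis.

Set Implicit Arguments.
Unset Strict Implicit.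
Unset Printing Implicit Defensive.

Import Order.TTheory GRing.Theory Num.Theory.
Import numFieldNormedType.Exports.

Local Open Scope classical_set_scope.
Local Open Scope ring_scope.

(** The product (= Borel) sigma-algebra on R^n, generated by the coordinates. *)
Definition rV_display : measure_display. Proof. exact: default_measure_display. Qed.

Section measurable_rV.
Context (R : realType) (n : nat).

Let coord (i : 'I_n) (x : 'rV[R]_n) : measurableTypeR R := x ord0 i.

Let rV_set0 : g_sigma_preimage coord set0.
Proof. exact: sigma_algebra0. Qed.

Let rV_setC A : g_sigma_preimage coord A -> g_sigma_preimage coord (~` A).
Proof. exact: sigma_algebraC. Qed.

Let rV_bigcup (F : _^nat) : (forall i, g_sigma_preimage coord (F i)) ->
  g_sigma_preimage coord (\bigcup_i (F i)).
Proof. exact: sigma_algebra_bigcup. Qed.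

HB.instance Definition _ := @isMeasurable.Build rV_display
  'rV[R]_n (g_sigma_preimage coord) rV_set0 rV_setC rV_bigcup.

Lemma measurable_coord (i : 'I_n) :
  measurable_fun [set: 'rV[R]_n] (fun x => x ord0 i : measurableTypeR R).
Proof.
move=> _ Y mY; rewrite setTI; apply: sub_sigma_algebra.
rewrite -bigcup_seq/=; exists i; first by rewrite /= mem_index_enum.
by exists Y => //; rewrite setTI.
Qed.

Lemma measurable_fun_rV d (T : measurableType d) (f : T -> 'rV[R]_n) :
  (forall i, measurable_fun setT (fun t => f t ord0 i : measurableTypeR R)) ->
  measurable_fun setT f.
Proof.
move=> mf.
apply: (@measurability _ _ _ _ _ f
  (\big[setU/set0]_(i < n) preimage_set_system setT (coord i) measurable)) => //.
move=> _ [C + <-]; rewrite -bigcup_seq => -[i _ [B mB <-]] /=.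
by rewrite setTI; exact: mf.
Qed.

End measurable_rV.

Section lebesgue_rV.
Context (R : realType).

Definition cons_rV n (z : measurableTypeR R * 'rV[R]_n) : 'rV[R]_n.+1 :=
  \row_i oapp (fun j => z.2 ord0 j) z.1 (unlift ord0 i).

Definition uncons_rV n (x : 'rV[R]_n.+1) : measurableTypeR R * 'rV[R]_n :=
  (x ord0 ord0, \row_j x ord0 (lift ord0 j)).

Lemma cons_rVK n : cancel (@cons_rV n) (@uncons_rV n).
Proof.
move=> [a v]; rewrite /uncons_rV/= !mxE unlift_none/=; congr (_, _).
by apply/rowP => j; rewrite !mxE liftK.
Qed.

Lemma uncons_rVK n : cancel (@uncons_rV n) (@cons_rV n).
Proof.
move=> x; apply/rowP => i; rewrite !mxE.
by case: unliftP => [j ->|->]//=; rewrite mxE.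
Qed.

Lemma measurable_cons_rV n : measurable_fun setT (@cons_rV n).
Proof.
apply: measurable_fun_rV => i; under eq_fun do rewrite mxE.
case: unliftP => [j _|_] /=; last exact: measurable_fst.
exact: (measurableT_comp (measurable_coord j) measurable_snd).
Qed.

Lemma measurable_uncons_rV n : measurable_fun setT (@uncons_rV n).
Proof.
apply: measurable_fun_pair; first exact: measurable_coord.
apply: measurable_fun_rV => i; under eq_fun do rewrite /= mxE.
exact: measurable_coord.
Qed.

Definition cons_measure n
    (mu : {sigma_finite_measure set 'rV[R]_n -> \bar R}) :=
  pushforward (product_measure1 (@lebesgue_measure R) mu) (@cons_rV n).

Section cons_measure.
Variables (n : nat) (mu : {sigma_finite_measure set 'rV[R]_n -> \bar R}).

Let cm0 : cons_measure mu set0 = 0%E.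
Proof. by rewrite /cons_measure /pushforward preimage_set0 measure0. Qed.

Let cm_ge0 A : (0 <= cons_measure mu A)%E.
Proof. by rewrite /cons_measure /pushforward; exact: measure_ge0. Qed.

Let cm_sigma : semi_sigma_additive (cons_measure mu).
Proof.
have mc := @measurable_cons_rV n.
move=> F mF tF mUF; rewrite /cons_measure /pushforward preimage_bigcup.
apply: measure_semi_sigma_additive.
- by move=> k; rewrite -[X in measurable X]setTI; exact: mc.
- apply/trivIsetP => /= i j _ _ ij; rewrite -preimage_setI.
  by move/trivIsetP : tF => /(_ _ _ _ _ ij) ->//; rewrite preimage_set0.
- by rewrite -preimage_bigcup -[X in measurable X]setTI; exact: mc.
Qed.

HB.instance Definition _ :=
  isMeasure.Build _ _ _ (cons_measure mu) cm0 cm_ge0 cm_sigma.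

Let cm_sigma_finite : sigma_finite setT (cons_measure mu).
Proof.
have /sigma_finiteP[F [TF ndF Foo]] := sigma_finiteT (@lebesgue_measure R).
have /sigma_finiteP[G [TG ndG Goo]] := sigma_finiteT mu.
exists (fun k => @uncons_rV n @^-1` (F k `*` G k)).
  rewrite -preimage_bigcup (_ : \bigcup_k _ = setT) ?preimage_setT//.
  rewrite -setXTT TF TG; apply/seteqP; split => -[x y].
    by move=> [k _ [/= ? ?]]; split; exists k.
  move=> [/= [k _ Fkx] [l _ Gly]]; exists (maxn k l) => //; split => /=.
    by move: x Fkx; exact/subsetPset/ndF/leq_maxl.
  by move: y Gly; exact/subsetPset/ndG/leq_maxr.
move=> k; have [mF Fk] := Foo k; have [mG Gk] := Goo k.
have mFG : measurable (F k `*` G k) by exact: measurableX.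
split.
  by rewrite -[X in measurable X]setTI; exact: measurable_uncons_rV.
rewrite /cons_measure /pushforward -comp_preimage.
rewrite (_ : _ \o _ = id); last by apply/funext => z; exact: cons_rVK.
rewrite [ltLHS](_ : _ = product_measure1 (@lebesgue_measure R) mu (F k `*` G k))//.
by rewrite product_measure1E// lte_mul_pinfty// ge0_fin_numE.
Qed.

HB.instance Definition _ :=
  @Measure_isSigmaFinite.Build _ _ _ (cons_measure mu) cm_sigma_finite.

End cons_measure.

Let dirac0_sigma_finite : sigma_finite setT (@dirac _ 'rV[R]_0 0 R).
Proof.
exists (fun=> setT); first by rewrite bigcup_const.
by move=> _; split => //; rewrite diracT ltry.
Qed.

HB.instance Definition _ :=
  @Measure_isSigmaFinite.Build _ _ _ (@dirac _ 'rV[R]_0 0 R) dirac0_sigma_finite.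

(** Iterated product of [lebesgue_measure], on the Borel sets of R^n. *)
Fixpoint lebesgue_rV n : {sigma_finite_measure set 'rV[R]_n -> \bar R} :=
  match n with
  | 0 => @dirac _ 'rV[R]_0 0 R
  | n'.+1 => cons_measure (lebesgue_rV n')
  end.

Lemma lebesgue_rV_box n (A : 'I_n -> set (measurableTypeR R)) :
  (forall i, measurable (A i)) ->
  lebesgue_rV n [set x | forall i, A i (x ord0 i)] =
  (\prod_(i < n) lebesgue_measure (A i))%E.
Proof.
elim: n A => [|n IH] A mA.
  by rewrite big_ord0 /= diracE mem_set// => -[].
pose B := [set x : 'rV[R]_n | forall i, A (lift ord0 i) (x ord0 i)].
have mB : measurable B.
  rewrite (_ : B = \bigcap_(i in [set: 'I_n])
      ((fun x : 'rV[R]_n => x ord0 i) @^-1` A (lift ord0 i))).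
    apply: fin_bigcap_measurable => // i _.
    rewrite -[X in measurable X]setTI.
    exact: (measurable_coord i measurableT (mA (lift ord0 i))).
  by apply/seteqP; split => [x Ax i _|x Ax i]; [exact: Ax|exact: Ax i I].
rewrite big_ord_recl -IH//= -/B -product_measure1E// /cons_measure /pushforward.
congr (product_measure1 _ _ _); apply/seteqP; split => -[a v] /=.
  move=> H; split; first by move: (H ord0); rewrite mxE unlift_none.
  by move=> i; move: (H (lift ord0 i)); rewrite mxE liftK.
by move=> [Aa Av] i; rewrite mxE; case: unliftP => [j ->|->]//=.
Qed.

End lebesgue_rV.

Section vectors.
Context {R : realType} {N : nat}.
Implicit Types x y : 'rV[R]_N.

Definition dotv x y : R := \sum_(i < N) x ord0 i * y ord0 i.

(** The library norm [`|x|] on ['rV_N] is the sup norm. *)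
Definition enorm x : R := Num.sqrt (dotv x x).

Definition basis_vec (i : 'I_N) : 'rV[R]_N := delta_mx ord0 i.

Definition partial (i : 'I_N) (f : 'rV[R]_N -> R) : 'rV[R]_N -> R :=
  fun x => 'D_(basis_vec i) f x.

Definition gradv (f : 'rV[R]_N -> R) : 'rV[R]_N -> 'rV[R]_N :=
  fun x => \row_i partial i f x.

Fixpoint Ck (k : nat) (f : 'rV[R]_N -> R) : Prop :=
  continuous f /\
  match k with
  | 0 => True
  | k'.+1 => forall i : 'I_N,
      (forall x, derivable f x (basis_vec i)) /\ Ck k' (partial i f)
  end.

Definition smooth (f : 'rV[R]_N -> R) : Prop := forall k, Ck k f.

End vectors.

Section domains.
Context {R : realType} {N : nat}.
Implicit Types (Omega : set 'rV[R]_N) (w : 'rV[R]_N -> R).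

Definition boundary Omega : set 'rV[R]_N := closure Omega `\` interior Omega.

(** Local defining functions: near a boundary point, [Omega] is [rho < 0] with
    [rho] smooth and [grad rho <> 0]. *)
Definition smooth_boundary Omega : Prop :=
  forall x0, boundary Omega x0 ->
    exists rho : 'rV[R]_N -> R,
      [/\ smooth rho, gradv rho x0 != 0
        & \forall x \near x0, Omega x <-> rho x < 0].

Definition smooth_bounded_domain Omega : Prop :=
  [/\ open Omega, Omega !=set0, connected Omega, bounded_set Omega
    & smooth_boundary Omega].

(** [w] is C^1 in [Omega] and [w], [grad w] extend continuously to the closure,
    [G] being the extension of [grad w]. *)
Definition C1_closure_with Omega w (G : 'rV[R]_N -> 'rV[R]_N) : Prop :=
  [/\ {within closure Omega, continuous w},
      {within closure Omega, continuous G}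
    & forall x, Omega x -> forall i,
        is_derive x (basis_vec i) w (G x ord0 i)].

Definition C1_closure Omega w : Prop := exists G, C1_closure_with Omega w G.

Definition C1holder_closure Omega (tau : R) w : Prop :=
  exists G, C1_closure_with Omega w G /\
    exists C : R, forall x y, closure Omega x -> closure Omega y ->
      enorm (G x - G y) <= C * enorm (x - y) `^ tau.

Definition int_C1_plus Omega w : Prop :=
  C1_closure Omega w /\ forall x, closure Omega x -> 0 < w x.

Definition int_C1holder_plus Omega (tau : R) w : Prop :=
  C1holder_closure Omega tau w /\ forall x, closure Omega x -> 0 < w x.

(** Equal to the L^infty norm for [w] continuous on the closure of [Omega]. *)
Definition supnorm Omega w : R := sup [set `|w x| | x in Omega].

Definition test_function Omega (phi : 'rV[R]_N -> R) : Prop :=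
  [/\ smooth phi, compact (closure [set x | phi x != 0])
    & closure [set x | phi x != 0] `<=` Omega].

End domains.

Section sobolev.
Context {R : realType} {N : nat}.
Implicit Types (Omega : set 'rV[R]_N) (p : R).
Implicit Types (u w f phi : 'rV[R]_N -> R) (Du Dphi : 'rV[R]_N -> 'rV[R]_N).

Local Notation dx := (lebesgue_rV R N).

Definition Lp Omega p u : Prop :=
  measurable_fun Omega u /\
  dx.-integrable Omega (EFin \o (fun x => `|u x| `^ p)).

Definition weak_gradient Omega u Du : Prop :=
  forall phi, test_function Omega phi -> forall i : 'I_N,
    \int[dx]_(x in Omega) (u x * partial i phi x) =
    - \int[dx]_(x in Omega) (Du x ord0 i * phi x).

(** [u] belongs to W^{1,p}(Omega) and [Du] is its weak gradient, which is unique
    up to a null set; functions are representatives of their a.e. classes, and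
    only their values in [Omega] matter. *)
Definition W1p Omega p u Du : Prop :=
  [/\ Lp Omega p u, forall i : 'I_N, Lp Omega p (fun x => Du x ord0 i)
    & weak_gradient Omega u Du].

(** The closure of the test functions in W^{1,p}(Omega). *)
Definition W1p0 Omega p u Du : Prop :=
  W1p Omega p u Du /\
  forall eps : R, 0 < eps -> exists2 f, test_function Omega f &
    \int[dx]_(x in Omega) (`|u x - f x| `^ p) +
    \int[dx]_(x in Omega) (enorm (Du x - gradv f x) `^ p) < eps.

(** The pairing of [- Delta_p u + |u|^(p-2) u] with [phi]. *)
Definition p_form Omega p u Du phi Dphi : R :=
  \int[dx]_(x in Omega) (enorm (Du x) `^ (p - 2) * dotv (Du x) (Dphi x)) +
  \int[dx]_(x in Omega) (`|u x| `^ (p - 2) * u x * phi x).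

(** Weak solutions in W^{1,p}(Omega) of [- Delta_p u + |u|^(p-2) u = f] with
    zero Neumann condition. The integrability clause says that the right-hand
    side makes sense: [\int] is a total operator, and [f] need not be bounded. *)
Definition neumann_solution Omega p f u : Prop :=
  exists Du, W1p Omega p u Du /\
    forall phi Dphi, W1p Omega p phi Dphi ->
      dx.-integrable Omega (EFin \o (fun x => f x * phi x)) /\
      p_form Omega p u Du phi Dphi = \int[dx]_(x in Omega) (f x * phi x).

(** Same equation with zero Dirichlet condition, for [u] continuous up to the
    boundary. *)
Definition dirichlet_solution Omega p f u : Prop :=
  (forall x, boundary Omega x -> u x = 0) /\
  exists Du, W1p0 Omega p u Du /\
    forall phi Dphi, W1p0 Omega p phi Dphi ->
      dx.-integrable Omega (EFin \o (fun x => f x * phi x)) /\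
      p_form Omega p u Du phi Dphi = \int[dx]_(x in Omega) (f x * phi x).

Definition neumann_eigenfunction Omega p (lam : R) w : Prop :=
  ~ {ae dx, forall x, Omega x -> w x = 0} /\
  neumann_solution Omega p (fun x => lam * (`|w x| `^ (p - 2) * w x)) w.

Definition neumann_eigenvalue Omega p (lam : R) : Prop :=
  exists w, neumann_eigenfunction Omega p lam w.

Definition first_neumann_eigenvalue Omega p (lam : R) : Prop :=
  neumann_eigenvalue Omega p lam /\
  forall mu, neumann_eigenvalue Omega p mu -> lam <= mu.

Definition in_order_interval Omega (lo up w : 'rV[R]_N -> R) : Prop :=
  {ae dx, forall x, Omega x -> lo x <= w x <= up x}.

Definition ae_equal_on Omega u w : Prop :=
  {ae dx, forall x, Omega x -> u x = w x}.

Definition system_solution Omega (p1 p2 a1 a2 b1 b2 : R) u v : Prop :=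
  [/\ {ae dx, forall x, Omega x -> 0 < u x /\ 0 < v x},
      neumann_solution Omega p1 (fun x => u x `^ a1 + v x `^ b1) u
    & neumann_solution Omega p2 (fun x => u x `^ a2 + v x `^ b2) v].

Definition sub_fun (Lambda : R) (phi : 'rV[R]_N -> R) : 'rV[R]_N -> R :=
  fun x => Lambda^-1 * (Lambda - phi x).

Definition super_fun (Lambda : R) (y : 'rV[R]_N -> R) : 'rV[R]_N -> R :=
  fun x => Lambda * (Lambda - y x).

Definition in_rectangle Omega (Lambda : R)
    (phi1 phi2 y1 y2 u v : 'rV[R]_N -> R) : Prop :=
  in_order_interval Omega (sub_fun Lambda phi1) (super_fun Lambda y1) u /\
  in_order_interval Omega (sub_fun Lambda phi2) (super_fun Lambda y2) v.

Definition Lambda_bound Omega p (phi y : 'rV[R]_N -> R) : R :=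
  2 * (1 + 3 * (3 `^ (p - 1) - 2 `^ (p - 1)) `^ (- (p - 1)^-1)
       + supnorm Omega phi + supnorm Omega y).

End sobolev.

(* Main.v *)
Require Import Defs.
From HB Require Import structures.
From mathcomp Require Import all_boot all_order all_algebra.
From mathcomp Require Import all_classical all_reals all_analysis.
From mathcomp Require Import measurable_realfun lra ring.

Set Implicit Arguments.
Unset Strict Implicit.
Unset Printing Implicit Defensive.

Import Order.TTheory GRing.Theory Num.Theory.
Import numFieldNormedType.Exports.

Local Open Scope classical_set_scope.
Local Open Scope ring_scope.

(** Existence comes from constant solutions. Constants [c] and [d] solve the
    two Neumann problems as soon as
      c^(p1-1) = c^a1 + d^b1   and   d^(p2-1) = c^a2 + d^b2.
    The second equation determines [d] as a continuous function of [c], and the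
    intermediate value theorem then solves the first one: at [c = 1] its left
    side is too small, and for large [c] the bounds [b1 < p1 - 1] and
    [a2 < p2 - 1] make it dominate ([constant_solution]). Both constants are at
    least 1, hence above the lower barriers, which are at most 1 because the
    eigenfunctions are positive; the upper barriers are at least [Lambda], hence
    above [c] and [d] once [Lambda >= c + d + 2] ([barrier_bounds]).

    Uniqueness is a comparison with these constants. If [v] lies between
    [d e^-t] and [d e^t], the first equation forces [u] to lie between [c e^-s]
    and [c e^s] with [s = - b1 t / (p1 - 1)] ([comparison_step]); the second
    equation leads back to [v] with [t] replaced by [q t], where
    [q = a2 b1 / ((p1 - 1) (p2 - 1))]. The exponent condition gives [q < 1], and
    the iteration pins [v] to [d] and [u] to [c] ([bounded_solution_constant]).

    The comparison step is a weak maximum principle in which the test functions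
    are the powers [w^n] of [w = u] or [w = M - u]. The gradient term of the
    equation against such a test function has a sign, and for [n] large the
    remaining integral only sees the set where [w] is close to its supremum
    ([ae_lt_of_power_tests]).

    That [w^n] is an admissible test function is the Leibniz rule for bounded
    functions with a weak gradient ([product_rule]). It is proved with
    difference quotients in one coordinate direction [e]. Integrating the
    definition of the weak derivative [V] of [f] against translated test
    functions and using [fundamental_lemma] gives, almost everywhere,
      f (x + h e) - f x = h * (average of V on the segment from x to x + h e)
    ([diff_identity]). This bounds the [L^1] distance of [f] to its translates,
    which is what is needed to pass to the limit in the difference quotient of a
    product ([translation_continuity]). The fundamental lemma itself relies on
    smooth functions, built from [exp (- 1 / t)], that tend to the indicator of
    an open box. *)

(** * Open boxes and Borel sets *)
Section boxes.
Context {R : realType} {n : nat}.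
Implicit Types (a b : 'I_n -> R) (U : set 'rV[R]_n).

Definition obox a b : set 'rV[R]_n :=
  [set x | forall i, a i < x ord0 i < b i].

Definition cbox a b : set 'rV[R]_n :=
  [set x | forall i, a i <= x ord0 i <= b i].

Lemma cbox_compact a b : compact (cbox a b).
Proof.
rewrite (_ : cbox a b = [set v | forall i, `[a i, b i]%classic (v ord0 i)]).
  by apply: (@rV_compact _ _ (fun i => `[a i, b i]%classic)) => i; exact: segment_compact.
by apply/seteqP; split => x /= H i; move: (H i); rewrite /= in_itv.
Qed.

(** Rational endpoints keep the family of boxes countable; the closed box is
    controlled as well, so that a function supported in it is a test function on
    [U]. *)
Lemma open_rat_boxes U x : open U -> U x ->
  exists q : {ffun 'I_n -> rat * rat},
    obox (fun i => ratr (q i).1) (fun i => ratr (q i).2) x /\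
    cbox (fun i => ratr (q i).1) (fun i => ratr (q i).2) `<=` U.
Proof.
move=> oU Ux.
have : nbhs x U by exact: open_nbhs_nbhs.
rewrite -nbhs_ballE => -[r /= r0 xrU].
have H i : exists q : rat * rat, (x ord0 i - r < ratr q.1 < x ord0 i) &&
    (x ord0 i < ratr q.2 < x ord0 i + r).
  have /rat_in_itvoo[q1] : x ord0 i - r < x ord0 i by rewrite ltrBlDr ltrDl.
  have /rat_in_itvoo[q2] : x ord0 i < x ord0 i + r by rewrite ltrDl.
  by rewrite !in_itv/= => h2 h1; exists (q1, q2); rewrite h1 h2.
have [q qP] := choice H.
exists [ffun i => q i]; split.
  by move=> i; rewrite ffunE; have /andP[/andP[_ ->] /andP[-> _]] := qP i.
move=> y Hy; apply: xrU; split => // i j; rewrite (ord1 i) /ball/=.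
have /andP[/andP[h1 h2] /andP[h3 h4]] := qP j.
have := Hy j; rewrite !ffunE => /andP[h5 h6].
by rewrite ltr_norml; apply/andP; split; lra.
Qed.

Lemma open_bigcup_obox U : open U -> exists P : set {ffun 'I_n -> rat * rat},
  U = \bigcup_(q in P) obox (fun i => ratr (q i).1) (fun i => ratr (q i).2) /\
  forall q, P q -> cbox (fun i => ratr (q i).1) (fun i => ratr (q i).2) `<=` U.
Proof.
move=> oU; exists [set q : {ffun 'I_n -> rat * rat} |
  cbox (fun i => ratr (q i).1) (fun i => ratr (q i).2) `<=` U]; split => //.
apply/seteqP; split => [x Ux|x [q /= qU qx]].
  by have [q [q1 q2]] := open_rat_boxes oU Ux; exists q.
by apply: qU => i; have /andP[/ltW -> /ltW ->] := qx i.
Qed.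

Lemma obox_setI a b a' b' : obox a b `&` obox a' b' =
  obox (fun i => Num.max (a i) (a' i)) (fun i => Num.min (b i) (b' i)).
Proof.
apply/seteqP; split => x /=.
  by move=> [h1 h2] i; rewrite gt_max lt_min; move: (h1 i) (h2 i) => /andP[-> ->] /andP[-> ->].
by move=> h; split => i; move: (h i); rewrite gt_max lt_min =>
  /andP[/andP[? ?] /andP[? ?]]; apply/andP.
Qed.

Lemma measurable_obox a b : measurable (obox a b).
Proof.
rewrite (_ : obox a b = \bigcap_(i in [set: 'I_n])
   ((fun x : 'rV[R]_n => x ord0 i) @^-1` `]a i, b i[%classic)).
  apply: fin_bigcap_measurable => // i _.
  rewrite -[X in measurable X]setTI.
  exact: (measurable_coord i measurableT (measurable_itv _)).
by apply/seteqP; split => [x h i _|x h i]; have := h i; rewrite /= in_itv//=; exact.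
Qed.

Definition oboxes : set (set 'rV[R]_n) := [set A | exists a b, A = obox a b].

Lemma open_sigma_oboxes U : open U -> <<s oboxes >> U.
Proof.
move=> oU; have [P [-> _]] := open_bigcup_obox oU.
rewrite bigcup_mkcond.
apply: (@countable_bigcupT_measurable _ (g_sigma_algebraType oboxes)) => //.
move=> q; case: ifPn => _; last exact: measurable0.
by apply: sub_sigma_algebra; do 2 eexists.
Qed.

(** Boxes are stable under intersection, so that measures on [R^n] can be
    compared on boxes only. *)
Lemma rV_measurableE : @measurable _ 'rV[R]_n = <<s oboxes >>.
Proof.
apply/seteqP; split; last first.
  apply: smallest_sub; first exact: sigma_algebra_measurable.
  by move=> _ [a [b ->]]; exact: measurable_obox.
apply: smallest_sub; first exact: smallest_sigma_algebra.
move=> A; rewrite -bigcup_seq/= => -[i _ [B mB <-]].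
have : measurable_fun [set: g_sigma_algebraType oboxes]
    (fun x : g_sigma_algebraType oboxes => (x : 'rV[R]_n) ord0 i : measurableTypeR R).
  apply: (measurability _ (RGenOInfty.measurableE R)) => //.
  move=> _ [_ [x ->] <-]; rewrite setTI.
  apply: open_sigma_oboxes.
  by apply: open_comp; [move=> + _; exact: coord_continuous|exact: interval_open].
by move=> /(_ measurableT _ mB); rewrite setTI.
Qed.

Lemma open_measurable_rV U : open U -> measurable U.
Proof. by move=> oU; rewrite rV_measurableE; exact: open_sigma_oboxes. Qed.

Lemma continuous_measurable_rV (f : 'rV[R]_n -> R) :
  continuous f -> measurable_fun setT (f : 'rV[R]_n -> measurableTypeR R).
Proof.
move=> cf; apply: (measurability _ (RGenOInfty.measurableE R)) => //.
move=> _ [_ [x ->] <-]; rewrite setTI; apply: open_measurable_rV.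
by apply: open_comp => //; exact: interval_open.
Qed.

End boxes.

Lemma coord_le_norm {R : realType} n (x : 'rV[R]_n) i : `|x ord0 i| <= `|x|.
Proof.
have /mapP[j Hj ->] : `|x ord0 i| \in [seq `|x v.1 v.2| | v : 'I_1 * 'I_n].
  by apply/mapP; exists (ord0, i) => //=; rewrite mem_enum.
by rewrite [leRHS]/Num.norm /= mx_normrE; apply/bigmax_geP; right => /=; exists j.
Qed.

(** * Translation invariance of the Lebesgue measure *)
Section translation.
Context {R : realType} {n : nat}.

Lemma lebesgue_rV_obox (a b : 'I_n -> R) : (lebesgue_rV R n (obox a b) =
  \prod_(i < n) lebesgue_measure `]a i, b i[%classic)%E.
Proof.
by rewrite -lebesgue_rV_box.
Qed.

Lemma lebesgue_rV_obox_lty (a b : 'I_n -> R) : (lebesgue_rV R n (obox a b) < +oo)%E.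
Proof.
rewrite lebesgue_rV_obox; elim/big_rec : _ => [|i x _ xoo]; first exact: ltry.
by rewrite lte_mul_pinfty// lebesgue_measure_itv/=; case: ifPn.
Qed.

Lemma bigcup_obox : \bigcup_k obox (fun=> - k%:R) (fun=> k%:R) = [set: 'rV[R]_n].
Proof.
apply/seteqP; split => // x _.
pose M := `|x|.
exists (Num.truncn M).+1 => //= i.
have xi : `|x ord0 i| <= M by exact: coord_le_norm.
rewrite -ltr_norml; apply: le_lt_trans xi _.
exact: truncnS_gt.
Qed.

Definition translate (z x : 'rV[R]_n) : 'rV[R]_n := x + z.

Lemma measurable_translate (z : 'rV[R]_n) : measurable_fun setT (translate z).
Proof.
rewrite /translate; apply: measurable_fun_rV => i; under eq_fun do rewrite mxE.
apply: measurable_funD => //; exact: measurable_coord.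
Qed.

HB.instance Definition _ (z : 'rV[R]_n) :=
  isMeasurableFun.Build _ _ _ _ (translate z) (measurable_translate z).

Lemma preimage_translate_obox z (a b : 'I_n -> R) :
  translate z @^-1` obox a b = obox (fun i => a i - z ord0 i) (fun i => b i - z ord0 i).
Proof.
by apply/seteqP; split => x h i; have := h i; rewrite /= !mxE ltrBlDr ltrBrDr.
Qed.

(** Translates of boxes are boxes with the same side lengths, and the measure is
    determined by its values on boxes. *)
Lemma lebesgue_rV_translate (z : 'rV[R]_n) (A : set 'rV[R]_n) : measurable A ->
  lebesgue_rV R n (translate z @^-1` A) = lebesgue_rV R n A.
Proof.
move=> mA.
apply: (measure_unique oboxes (fun k => obox (fun=> - k%:R) (fun=> k%:R)) _ _ _ _
  (pushforward (lebesgue_rV R n) (translate z)) (lebesgue_rV R n)) => //.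
- exact: rV_measurableE.
- by move=> _ _ [a [b ->]] [a' [b' ->]]; rewrite obox_setI; do 2 eexists.
- by move=> i; do 2 eexists.
- exact: bigcup_obox.
- move=> _ [a [b ->]]; transitivity (lebesgue_rV R n (translate z @^-1` obox a b)) => //.
  rewrite preimage_translate_obox; apply: etrans (lebesgue_rV_obox _ _) _.
  apply: etrans (esym (lebesgue_rV_obox _ _)); apply: eq_bigr => i _.
  rewrite !lebesgue_measure_itv/= !lte_fin ltrD2r; case: ifPn => // _.
  by rewrite -!EFinB; congr EFin; ring.
- move=> k; rewrite [X in (X < _)%E](_ : _ =
    lebesgue_rV R n (translate z @^-1` obox (fun=> - k%:R) (fun=> k%:R))) //.
  by rewrite preimage_translate_obox; exact: lebesgue_rV_obox_lty.
Qed.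

Lemma ge0_integral_translate (z : 'rV[R]_n) (f : 'rV[R]_n -> \bar R) :
  measurable_fun setT f -> (forall x, 0 <= f x)%E ->
  (\int[lebesgue_rV R n]_x f (x + z)%R = \int[lebesgue_rV R n]_x f x)%E.
Proof.
move=> mf f0.
have := @ge0_integral_pushforward _ _ _ _ _ _ (measurable_translate z) (lebesgue_rV R n)
  setT f measurableT mf (fun x _ => f0 x).
rewrite preimage_setT => <-.
by apply: eq_measure_integral => A mA _; exact: lebesgue_rV_translate.
Qed.

Lemma integrable_translate (z : 'rV[R]_n) (f : 'rV[R]_n -> \bar R) :
  (lebesgue_rV R n).-integrable setT f ->
  (lebesgue_rV R n).-integrable setT (fun x => f (x + z)).
Proof.
move=> /integrableP[mf foo]; apply/integrableP; split.
  exact: (measurableT_comp mf (measurable_translate z)).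
rewrite (ge0_integral_translate z (f := fun x => `|f x|%E))//.
exact: measurableT_comp.
Qed.

Lemma integral_translate (z : 'rV[R]_n) (f : 'rV[R]_n -> \bar R) :
  (lebesgue_rV R n).-integrable setT f ->
  (\int[lebesgue_rV R n]_x f (x + z)%R = \int[lebesgue_rV R n]_x f x)%E.
Proof.
move=> fi; have fzi := integrable_translate z fi.
have := @integral_pushforward _ _ _ _ _ _ (measurable_translate z) (lebesgue_rV R n)
  setT f (measurable_int _ fi).
rewrite preimage_setT => /(_ fzi measurableT) <-.
by apply: eq_measure_integral => A mA _; exact: lebesgue_rV_translate.
Qed.

Lemma Rintegral_translate (z : 'rV[R]_n) (f : 'rV[R]_n -> R) :
  (lebesgue_rV R n).-integrable setT (EFin \o f) ->
  \int[lebesgue_rV R n]_x f (x + z) = \int[lebesgue_rV R n]_x f x.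
Proof. by move=> fi; rewrite /Rintegral (integral_translate z fi). Qed.

End translation.

(** * Smooth cut-off functions *)
Section flat_exp.
Context {R : realType}.
Implicit Types (t : R) (n : nat).

(** [t^-n exp (- 1 / t)] on the positive half-line, extended by 0. For [n = 0] this
    is the classical smooth function that is flat at 0; including the powers of
    [1 / t] gives a family whose linear span is stable under differentiation, so
    that smoothness is an induction. *)
Definition flat_exp n t : R := if 0 < t then t^-1 ^+ n * expR (- t^-1) else 0.

Lemma flat_exp_ge0 n t : 0 <= flat_exp n t.
Proof.
rewrite /flat_exp; case: ifPn => // t0.
by rewrite mulr_ge0 ?expR_ge0// exprn_ge0// invr_ge0 ltW.
Qed.

(** The exponential dominates [y^(n+1) / (n+1)!] at [y = 1 / t]. The linear bound
    makes every member of the family tend to 0 at the origin. *)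
Lemma flat_exp_le n t : flat_exp n t <= n.+1`!%:R * `|t|.
Proof.
rewrite /flat_exp; case: ifPn => t0; last by rewrite mulr_ge0.
have y0 : 0 < t^-1 by rewrite invr_gt0.
rewrite gtr0_norm// expRN ler_pdivrMr ?expR_gt0//.
have := expR_ge1Dxn n (ltW y0) => H.
have f0 : (0 : R) < n.+1`!%:R by rewrite ltr0n fact_gt0.
have H1 : t^-1 ^+ n.+1 <= n.+1`!%:R * expR t^-1.
  rewrite mulrC -ler_pdivrMr//; apply: le_trans H.
  by rewrite lerDr.
rewrite mulrAC -ler_pdivrMr// (le_trans _ H1)//.
by rewrite exprSr.
Qed.

(** At the origin the difference quotient of the function of index [n] is the
    function of index [n + 1], which tends to 0 by [flat_exp_le]. *)
Lemma is_derive_flat_exp n t :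
  is_derive t (1 : R) (flat_exp n) (flat_exp n.+2 t - n%:R * flat_exp n.+1 t).
Proof.
have [t0|t0|t0] := ltgtP t 0.
- rewrite {2 3}/flat_exp ltNge (ltW t0)/= mulr0 subr0.
  have H0 : is_derive t (1 : R) (cst (0 : R)) 0 by exact: is_derive_cst.
  apply: near_eq_is_derive H0.
  near=> s; rewrite /flat_exp /= ltNge ltW//=.
  by near: s; exact: lt_nbhsl.
- rewrite {2 3}/flat_exp t0.
  suff : is_derive t (1 : R) (fun s : R => s^-1 ^+ n * expR (- s^-1))
     (t^-1 ^+ n.+2 * expR (- t^-1) - n%:R * (t^-1 ^+ n.+1 * expR (- t^-1))).
    apply: near_eq_is_derive.
    near=> s; rewrite /flat_exp /= ifT//; near: s; exact: lt_nbhsr.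
  have dV : is_derive t (1:R) (fun s : R => s^-1) (- t ^- 2).
    have := @is_deriveV R id t 1 1; rewrite /= scaler1; apply => //.
    by rewrite gt_eqF.
  have dX := @is_deriveX R R _ n t 1 _ dV.
  have dN := @is_deriveN R R R _ t 1 _ dV.
  have dE := @is_derive1_comp R expR (- (fun s => s^-1)) t _ _ (is_derive_expR _) dN.
  rewrite [X in is_derive _ _ X](_ : _ =
    (fun s : R => s^-1) ^+ n * (expR \o - (fun s => s^-1))); last first.
    by apply/funext => s; rewrite /= /GRing.mul /= !fctE.
  apply: is_derive_eq (is_deriveM dX dE) _.
  rewrite /= !fctE /GRing.scale /=.
  case: n {dX} => [|n].
    by rewrite !expr0 -exprVn; ring.
  by rewrite -exprVn /= !exprS expr0; ring.
- rewrite t0 {2 3}/flat_exp ltxx mulr0 subr0.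
  have E : (fun h : R => h^-1 *: (flat_exp n (h *: 1 + 0) - flat_exp n 0)) = flat_exp n.+1.
    apply/funext => h; rewrite addr0 /GRing.scale/= mulr1 {2}/flat_exp ltxx subr0 /flat_exp.
    by case: ifPn => _; rewrite ?mulr0// mulrA exprS.
  have C : flat_exp n.+1 h @[h --> 0^'] --> 0.
    apply: (@squeeze_cvgr _ _ _ _ (cst 0) (fun h : R => n.+2`!%:R * `|h|)).
    - by near=> h; rewrite flat_exp_ge0 flat_exp_le.
    - exact: cvg_cst.
    - rewrite -[X in _ --> X](mulr0 (n.+2`!%:R)) -[in X in _ --> X](normr0 R).
      by apply: cvgMr; apply: cvg_norm; apply: cvg_within_filter; exact: cvg_id.
  apply: DeriveDef.
    by rewrite /derivable E; apply/cvg_ex; exists 0.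
  by rewrite /derive E; apply/cvg_lim.
Unshelve. all: by end_near. Qed.

End flat_exp.

Section Ck_theory.
Context {R : realType} {N : nat}.
Implicit Types (f g : 'rV[R]_N -> R) (k : nat) (i : 'I_N).

Lemma Ck_continuous k f : Ck k f -> continuous f.
Proof. by case: k => [|k] []. Qed.

Lemma Ck_pred k f : Ck k.+1 f -> Ck k f.
Proof.
elim: k f => [f [cf _]|k IH f [cf Hf]]; first by split.
by split => // i; have [df /IH] := Hf i.
Qed.

Lemma Ck_cst k (c : R) : Ck k (cst c : 'rV[R]_N -> R).
Proof.
elim: k c => [c|k IH c]; first by split => //; exact: cst_continuous.
split; first exact: cst_continuous.
move=> i; split; first by move=> x; exact: derivable_cst.
rewrite (_ : partial i _ = cst 0) //.
by apply/funext => x; rewrite /partial derive_cst.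
Qed.

Lemma Ck_add k f g : Ck k f -> Ck k g -> Ck k (fun x => f x + g x).
Proof.
elim: k f g => [f g [cf _] [cg _]|k IH f g [cf Hf] [cg Hg]].
  by split => // x; exact: (cvgD (cf x) (cg x)).
split; first by move=> x; exact: (cvgD (cf x) (cg x)).
move=> i; have [df Pf] := Hf i; have [dg Pg] := Hg i; split.
  by move=> x; apply: derivableD; [exact: df|exact: dg].
rewrite (_ : partial i _ = fun x => partial i f x + partial i g x); first exact: IH.
apply/funext => x; rewrite /partial; apply: (@deriveD _ _ _ f g).
  exact: df.
exact: dg.
Qed.

Lemma Ck_mul k f g : Ck k f -> Ck k g -> Ck k (fun x => f x * g x).
Proof.
elim: k f g => [f g [cf _] [cg _]|k IH f g [cf Hf] [cg Hg]].
  by split => // x; exact: (cvgM (cf x) (cg x)).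
split; first by move=> x; exact: (cvgM (cf x) (cg x)).
move=> i; have [df Pf] := Hf i; have [dg Pg] := Hg i; split.
  by move=> x; apply: derivableM; [exact: df|exact: dg].
rewrite (_ : partial i _ = fun x => f x * partial i g x + g x * partial i f x).
  by apply: Ck_add; apply: IH => //; apply: Ck_pred; split.
apply/funext => x; rewrite /partial; apply: (@deriveM _ _ f g).
  exact: df.
exact: dg.
Qed.

Lemma Ck_prod k (I : Type) (r : seq I) (F : I -> 'rV[R]_N -> R) :
  (forall j, Ck k (F j)) -> Ck k (fun x => \prod_(j <- r) F j x).
Proof.
move=> CF; elim: r => [|j r IH].
  by under eq_fun do rewrite big_nil; exact: Ck_cst.
by under eq_fun do rewrite big_cons; exact: Ck_mul.
Qed.

Lemma Ck_exp k f m : Ck k f -> Ck k (fun x => f x ^+ m).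
Proof.
move=> Cf; elim: m => [|m IH].
  by under eq_fun do rewrite expr0; exact: Ck_cst.
by under eq_fun do rewrite exprS; exact: Ck_mul.
Qed.

Lemma derivable_translate f z v x : derivable f (x + z) v ->
  derivable (fun y => f (y + z)) x v.
Proof.
by rewrite /derivable; under [in X in _ -> X]eq_fun do rewrite /= -addrA.
Qed.

Lemma partial_translate f z i : partial i (fun y => f (y + z)) = fun y => partial i f (y + z).
Proof.
apply/funext => y; rewrite /partial /derive.
by under eq_fun do rewrite /= -addrA.
Qed.

Lemma Ck_translate k f z : Ck k f -> Ck k (fun x => f (x + z)).
Proof.
have cz : continuous (fun x : 'rV[R]_N => x + z).
  by move=> x; exact: (cvgD cvg_id (cvg_cst z)).
elim: k f => [f [cf _]|k IH f [cf Hf]].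
  by split => // x; exact: (continuous_comp (cz x) (cf _)).
split; first by move=> x; exact: (continuous_comp (cz x) (cf _)).
move=> i; have [df Pf] := Hf i; split; last by rewrite partial_translate; exact: IH.
by move=> x; apply: derivable_translate; exact: df.
Qed.

(** Directional derivatives are derivatives of one real variable, which makes the
    one-dimensional chain rule available. *)
Lemma is_derive_line f (v x : 'rV[R]_N) (d : R) :
  is_derive (0 : R) (1 : R) (fun h : R => f (h *: v + x)) d -> is_derive x v f d.
Proof.
have E : (fun h : R => h^-1 *:
    (((fun h : R => f (h *: v + x)) \o shift 0) (h *: 1) - f (0 *: v + x)))
  = (fun h => h^-1 *: ((f \o shift x) (h *: v) - f x)).
  by apply/funext => h; rewrite /= addr0 scale0r add0r /GRing.scale/= mulr1.
move=> [H1 H2]; apply: DeriveDef.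
  by move: H1; rewrite /derivable E.
by move: H2; rewrite /derive E.
Qed.

Lemma is_derive_flat_exp_coord m (s a : R) i j (x : 'rV[R]_N) :
  is_derive x (basis_vec j) (fun x => flat_exp m (s * x ord0 i + a))
   ((s * (i == j)%:R) * (flat_exp m.+2 (s * x ord0 i + a) - m%:R * flat_exp m.+1 (s * x ord0 i + a))).
Proof.
apply: is_derive_line.
pose l (h : R) := (s * (i == j)%:R) * h + (s * x ord0 i + a).
rewrite (_ : (fun h : R => _) = flat_exp m \o l); last first.
  apply/funext => h; rewrite /l /= !mxE /=; congr flat_exp; ring.
have dl : is_derive (0 : R) (1 : R) l (s * (i == j)%:R).
  apply: (is_derive_eq (is_deriveD (is_deriveZ (s * (i == j)%:R) (is_derive_id (0 : R) (1 : R)))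
    (is_derive_cst (s * x ord0 i + a) (0 : R) (1 : R)))).
  by rewrite /GRing.scale /= addr0 mulr1.
apply: (is_derive_eq (@is_derive1_comp R (flat_exp m) l 0 _ _ (is_derive_flat_exp m (l 0)) dl)).
by rewrite /l mulr0 add0r mulrC.
Qed.

Lemma Ck_flat_exp_coord k m (s a : R) i : Ck k (fun x => flat_exp m (s * x ord0 i + a)).
Proof.
have C p : continuous (fun x : 'rV[R]_N => flat_exp p (s * x ord0 i + a)).
  move=> x; apply: (@continuous_comp _ _ _ (fun x : 'rV[R]_N => s * x ord0 i + a) (flat_exp p)).
    exact: (cvgD (cvgM (cvg_cst s) (@coord_continuous _ _ _ ord0 i x)) (cvg_cst a)).
  apply: differentiable_continuous; apply/derivable1_diffP.
  by have [] := is_derive_flat_exp p (s * x ord0 i + a).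
elim: k m => [|k IH] m; first by split.
split => // j; split; first by move=> x; have [] := is_derive_flat_exp_coord m s a i j x.
rewrite (_ : partial j _ = fun x => (s * (i == j)%:R) *
  (flat_exp m.+2 (s * x ord0 i + a) + (- m%:R) * flat_exp m.+1 (s * x ord0 i + a))).
  apply: Ck_mul; first exact: Ck_cst.
  apply: Ck_add; first exact: IH.
  by apply: Ck_mul; [exact: Ck_cst|exact: IH].
apply/funext => x; rewrite /partial mulNr.
by have [_ ->] := is_derive_flat_exp_coord m s a i j x.
Qed.

(** The signs [1] and [- 1] and the additions put both factors in the affine form
    of [Ck_flat_exp_coord]. *)
Definition bump (a b : 'I_N -> R) (x : 'rV[R]_N) : R :=
  \prod_i (flat_exp 0 (1 * x ord0 i + - a i) * flat_exp 0 (- 1 * x ord0 i + b i)).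

Lemma smooth_bump a b : smooth (bump a b).
Proof.
move=> k; apply: Ck_prod => i; apply: Ck_mul; exact: Ck_flat_exp_coord.
Qed.

Lemma flat_exp0_gt0 (t : R) : 0 < t -> 0 < flat_exp 0 t.
Proof. by move=> t0; rewrite /flat_exp t0 expr0 mul1r expR_gt0. Qed.

Lemma flat_exp0_le0 (t : R) : t <= 0 -> flat_exp 0 t = 0.
Proof. by move=> t0; rewrite /flat_exp ltNge t0. Qed.

Lemma flat_exp0_le1 (t : R) : flat_exp 0 t <= 1.
Proof.
rewrite /flat_exp; case: ifPn => // t0; rewrite expr0 mul1r -expR0 ler_expR.
by rewrite oppr_le0 invr_ge0 ltW.
Qed.

Lemma bump_ge0 a b x : 0 <= bump a b x.
Proof. by apply: prodr_ge0 => i _; rewrite mulr_ge0 ?flat_exp_ge0. Qed.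

Lemma bump_le1 a b x : bump a b x <= 1.
Proof.
apply: prodr_ile1 => i _.
by rewrite mulr_ge0 ?flat_exp_ge0//= mulr_ile1 ?flat_exp_ge0 ?flat_exp0_le1.
Qed.

Lemma bump_gt0 a b x : obox a b x -> 0 < bump a b x.
Proof.
move=> H; apply: prodr_gt0 => i _; have /andP[h1 h2] := H i.
by rewrite mulr_gt0// flat_exp0_gt0; lra.
Qed.

Lemma bump_eq0 a b x : ~ obox a b x -> bump a b x = 0.
Proof.
move=> /existsNP[i /negP]; rewrite negb_and -!leNgt => H.
rewrite /bump (bigD1 i)//=; apply/eqP; rewrite mulf_eq0; apply/orP; left.
case/orP: H => H; first by rewrite (@flat_exp0_le0 (1 * _ + _)) ?mul0r//; lra.
by rewrite (@flat_exp0_le0 (- 1 * _ + _)) ?mulr0//; lra.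
Qed.

(** With [b] the bump of the box, [1 - (1 - b)^m] has the support of [b], takes its
    values in the unit interval, and tends to 1 wherever [b > 0]: a smooth
    approximation of the indicator that needs no division by [b]. *)
Definition box_approx (a b : 'I_N -> R) (m : nat) (x : 'rV[R]_N) : R :=
  1 + - 1 * (1 + - 1 * bump a b x) ^+ m.

Lemma smooth_box_approx a b m : smooth (box_approx a b m).
Proof.
move=> k; apply: Ck_add; first exact: Ck_cst.
apply: Ck_mul; first exact: Ck_cst.
apply: Ck_exp; apply: Ck_add; first exact: Ck_cst.
by apply: Ck_mul; [exact: Ck_cst|exact: smooth_bump].
Qed.

Lemma box_approx_itv a b m x : 0 <= box_approx a b m x <= 1.
Proof.
have := bump_ge0 a b x; have := bump_le1 a b x => h1 h0.
have u0 : 0 <= (1 - bump a b x) ^+ m by rewrite exprn_ge0// subr_ge0.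
have u1 : (1 - bump a b x) ^+ m <= 1 by rewrite exprn_ile1 ?subr_ge0// gerBl.
by rewrite /box_approx !mulN1r; lra.
Qed.

Lemma box_approx_eq0 a b m x : ~ obox a b x -> box_approx a b m x = 0.
Proof.
by move=> /bump_eq0 bx; rewrite /box_approx bx mulr0 addr0 expr1n mulr1 subrr.
Qed.

Lemma cvg_box_approx a b x : box_approx a b m x @[m --> \oo] --> (\1_(obox a b) x : R).
Proof.
rewrite indicE /=; have [xB|xB] := pselect (obox a b x); last first.
  rewrite memNset//; under eq_fun do rewrite box_approx_eq0//; exact: cvg_cst.
rewrite mem_set//= -[X in _ --> X]addr0; apply: cvgD; first exact: cvg_cst.
rewrite -[X in _ --> X](mulr0 (- 1)); apply: cvgMr.
apply: cvg_expr; rewrite mulN1r ger0_norm ?subr_ge0 ?bump_le1//.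
by rewrite gtrBl bump_gt0.
Qed.

Lemma box_approx_test (Omega : set 'rV[R]_N) a b m :
  cbox a b `<=` Omega -> test_function Omega (box_approx a b m).
Proof.
move=> abO; have K := @cbox_compact R N a b.
have C : closed (cbox a b) by apply: compact_closed K; exact: norm_hausdorff.
have cl : closure [set x | box_approx a b m x != 0] `<=` cbox a b.
  rewrite [X in _ `<=` X]((closure_id _).1 C); apply: closureS => x /=.
  have [xB _ i|xB] := pselect (obox a b x); last by rewrite box_approx_eq0// eqxx.
  by have /andP[/ltW -> /ltW ->] := xB i.
split; [exact: smooth_box_approx| |exact: subset_trans cl abO].
by apply: subclosed_compact K cl; exact: closed_closure.
Qed.

End Ck_theory.

(** * The fundamental lemma of the calculus of variations *)
Section real_integrals.
Context {R : realType} d (T : measurableType d) (mu : {measure set T -> \bar R}).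
Implicit Types f g h : T -> R.

(** Integrable real functions on the whole space; functions given on a subset are
    extended by 0, which avoids tracking domains under translation. *)
Definition L1 f : Prop := mu.-integrable setT (EFin \o f).

Lemma L1_measurable f : L1 f -> measurable_fun setT f.
Proof. by move=> /(measurable_int mu)/measurable_EFinP. Qed.

Lemma L1_le f g : measurable_fun setT f -> (forall x, `|f x| <= `|g x|) -> L1 g -> L1 f.
Proof.
move=> mf fg; apply: le_integrable => //; first exact/measurable_EFinP.
by move=> x _ /=; rewrite lee_fin.
Qed.

Lemma L1D f g : L1 f -> L1 g -> L1 (fun x => f x + g x).
Proof. by move=> f1 g1; have := integrableD measurableT f1 g1. Qed.

Lemma L1B f g : L1 f -> L1 g -> L1 (fun x => f x - g x).
Proof. by move=> f1 g1; have := integrableB measurableT f1 g1. Qed.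

Lemma L1Z f (c : R) : L1 f -> L1 (fun x => c * f x).
Proof. by move=> f1; have := integrableZl measurableT c f1. Qed.

Lemma L1_norm f : L1 f -> L1 (fun x => `|f x|).
Proof. by move=> f1; have := integrable_norm f1. Qed.

Lemma L1_mul_bounded f h (C : R) : L1 f -> measurable_fun setT h -> (forall x, `|h x| <= C) ->
  L1 (fun x => f x * h x).
Proof.
move=> f1 mh hC.
apply: (@L1_le _ (fun x => C * f x)).
- by apply: measurable_funM => //; exact: L1_measurable.
- move=> x; rewrite mulrC !normrM ler_pM//.
  by rewrite (le_trans (hC x))// ler_norm.
- exact: L1Z.
Qed.

Lemma Rintegral_dominated_cvg (f_ : nat -> T -> R) f g :
  (forall n, measurable_fun setT (f_ n)) -> (forall x, f_ n x @[n --> \oo] --> f x) ->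
  L1 g -> (forall n x, `|f_ n x| <= g x) ->
  \int[mu]_x f_ n x @[n --> \oo] --> \int[mu]_x f x.
Proof.
move=> mf_ f_f g1 fg.
have mf : measurable_fun setT f by exact: (measurable_fun_cvg mf_).
have ff x : setT x -> (EFin \o f_ ^~ x) n @[n --> \oo] --> (f x)%:E.
  by move=> _; apply/cvg_EFin; [exact: nearW|exact: f_f].
have [f1 _] := @dominated_convergence _ _ _ mu setT measurableT
  (fun n => EFin \o f_ n) (EFin \o f) (EFin \o g)
  (fun n => (measurable_EFinP _ _).2 (mf_ n)) ((measurable_EFinP _ _).2 mf)
  (aeW _ ff) g1 (aeW _ (fun x n _ => fg n x : (`|(EFin \o f_ n) x| <= (EFin \o g) x)%E)).
rewrite /Rintegral => H; apply: fine_cvg.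
by rewrite fineK//; exact: integrable_fin_num.
Qed.

Lemma ae_Rintegral f g : measurable_fun setT f -> measurable_fun setT g ->
  {ae mu, forall x, f x = g x} -> \int[mu]_x f x = \int[mu]_x g x.
Proof.
move=> mf mg fg; congr fine; apply: ae_eq_integral => //.
- exact/measurable_EFinP.
- exact/measurable_EFinP.
- by apply: filterS fg => x fgx _ /=; rewrite fgx.
Qed.

Lemma L1_indic (K : set T) : measurable K -> (mu K < +oo)%E -> L1 (\1_K : T -> R).
Proof.
move=> mK Koo; apply/integrableP; split; first by apply/measurable_EFinP; exact: measurable_indic.
rewrite (eq_integral (fun x => (\1_K x)%:E)); last first.
  by move=> x _ /=; rewrite ger0_norm.
by rewrite integral_indic// setIT.
Qed.

Lemma Rintegral_indic (K : set T) : measurable K -> \int[mu]_x (\1_K x : R) = fine (mu K).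
Proof. by move=> mK; rewrite /Rintegral integral_indic// setIT. Qed.

End real_integrals.

Section fundamental.
Context {R : realType} {N : nat}.
Local Notation dx := (lebesgue_rV R N).
Implicit Types (f : 'rV[R]_N -> R) (O Omega : set 'rV[R]_N).

Lemma normr_indic_le1 T (A : set T) (x : T) : `|(\1_A x : R)| <= 1.
Proof. by rewrite indicE ger0_norm// lern1 leq_b1. Qed.

(** The sets on which the integral of [f] vanishes form a lambda-system that
    contains the boxes, hence all Borel sets. *)
Lemma ae_eq0_of_boxes f : L1 dx f ->
  (forall a b, \int[dx]_x (f x * \1_(obox a b) x) = 0) ->
  {ae dx, forall x, f x = 0}.
Proof.
move=> f1 fbox.
have mf := L1_measurable f1.
pose H := [set E : set 'rV[R]_N | measurable E /\ \int[dx]_x (f x * \1_E x) = 0].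
have f1E E : measurable E -> L1 dx (fun x => f x * \1_E x).
  by move=> mE; apply: (L1_mul_bounded f1 (C := 1)) => // x; exact: normr_indic_le1.
have Hlim (F : nat -> set 'rV[R]_N) : nondecreasing_seq F -> (forall i, H (F i)) ->
    H (\bigcup_i F i).
  move=> ndF HF; have mU : measurable (\bigcup_i F i).
    by apply: bigcupT_measurable => i; have [] := HF i.
  split => //.
  have : \int[dx]_x (f x * \1_(F i) x) @[i --> \oo] --> \int[dx]_x (f x * \1_(\bigcup_i F i) x).
    apply: (@Rintegral_dominated_cvg _ _ _ _ (fun i x => f x * \1_(F i) x) _ (fun x => `|f x|)).
    - by move=> n; apply: measurable_funM => //; apply: measurable_indic; have [] := HF n.
    - move=> x; apply: cvgMr.
      have [[k _ Fkx]|nF] := pselect ((\bigcup_i F i) x).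
        rewrite [X in _ --> X](_ : _ = 1); last by rewrite indicE mem_set//; exists k.
        apply: cvg_near_cst; near=> n; rewrite indicE mem_set//.
        have /subsetPset FF : (F k <= F n)%O by apply: ndF; near: n; exact: nbhs_infty_ge.
        exact: FF.
      rewrite [X in _ --> X](_ : _ = 0); last by rewrite indicE memNset.
      apply: cvg_near_cst; near=> n; rewrite indicE memNset// => Fn; apply: nF.
      by exists n.
    - exact: L1_norm.
    - move=> n x; rewrite normrM -[leRHS]mulr1 ler_pM//; exact: normr_indic_le1.
  under eq_fun do rewrite (HF _).2.
  by move=> h; rewrite -(cvg_lim (@Rhausdorff R) h) lim_cst.
have HT : H setT.
  rewrite -bigcup_obox; apply: Hlim.
    move=> i j ij; apply/subsetPset => x Hx k; have /andP[h1 h2] := Hx k.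
    have ijR : (i%:R : R) <= j%:R by rewrite ler_nat.
    by apply/andP; split; lra.
  by move=> i; split; [exact: measurable_obox|exact: fbox].
have LH : lambda_system setT H.
  split => //.
  move=> A B BA [mA iA] [mB iB]; split; first exact: measurableD.
  rewrite (_ : (fun x => _) = (fun x => f x * \1_A x - f x * \1_B x)).
    by rewrite RintegralB ?iA ?iB ?subr0//; exact: f1E.
  apply/funext => x; rewrite -mulrBr; congr (_ * _).
  rewrite !indicE in_setD; case: (boolP (x \in B)) => xB.
    by rewrite (mem_set (BA _ (set_mem xB)))/= subrr.
  by rewrite andbT subr0.
have IG : setI_closed (@oboxes R N).
  by move=> _ _ [a [b ->]] [a' [b' ->]]; rewrite obox_setI; do 2 eexists.
have HA A : measurable A -> \int[dx]_x (f x * \1_A x) = 0.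
  have GH : @oboxes R N `<=` H.
    by move=> _ [a [b ->]]; split; [exact: measurable_obox|exact: fbox].
  have HH := lambda_system_subset IG LH GH (fun _ _ => @subsetT _ _).
  by rewrite rV_measurableE => /HH[].
have := @integral_ae_eq _ _ _ dx setT measurableT (cst 0) (EFin \o f) f1
  (@measurable_cst _ _ _ _ _ _).
move=> /(_ _)[].
  move=> E _ mE; rewrite integral0.
  have := HA _ mE.
  rewrite (_ : (fun x => f x * \1_E x) = f \_ E); last first.
    by rewrite patch_indic.
  rewrite -Rintegral_mkcond /Rintegral => h.
  have fin : (\int[dx]_(x in E) (f x)%:E)%E \is a fin_num.
    by apply: integrable_fin_num => //; apply: integrableS f1.
  by rewrite -(fineK fin) h.
move=> A [mA A0 sub]; exists A; split => // x /= fx; apply: sub => /= h; apply: fx.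
by have := h I; case.
Unshelve. all: by end_near. Qed.

(** Box cut-offs are test functions, so that the integral of [f] vanishes on every
    box whose closure lies in [O]; countably many such boxes cover [O]. *)
Lemma fundamental_lemma O f : open O -> L1 dx f ->
  (forall psi, test_function O psi -> \int[dx]_x (f x * psi x) = 0) ->
  {ae dx, forall x, O x -> f x = 0}.
Proof.
move=> oO f1 H.
have mf := L1_measurable f1.
have box0 a b : cbox a b `<=` O -> \int[dx]_x (f x * \1_(obox a b) x) = 0.
  move=> abO.
  have : \int[dx]_x (f x * box_approx a b m x) @[m --> \oo] --> \int[dx]_x (f x * \1_(obox a b) x).
    apply: (@Rintegral_dominated_cvg _ _ _ _ (fun m x => f x * box_approx a b m x) _ (fun x => `|f x|)).
    - move=> n; apply: measurable_funM => //; apply: continuous_measurable_rV.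
      exact: Ck_continuous (@smooth_box_approx R N a b n 0).
    - by move=> x; apply: cvgMr; exact: cvg_box_approx.
    - exact: L1_norm.
    - move=> n x; rewrite normrM -[leRHS]mulr1 ler_pM//.
      by have /andP[h0 h1] := box_approx_itv a b n x; rewrite ger0_norm.
  under eq_fun do rewrite (H _ (box_approx_test _ abO)).
  by move=> h; rewrite -(cvg_lim (@Rhausdorff R) h) lim_cst.
have [P [OE PO]] := open_bigcup_obox oO.
pose Q (q : {ffun 'I_N -> rat * rat}) :=
  obox (fun i => ratr (q i).1 : R) (fun i => ratr (q i).2 : R).
have aeQ q : P q -> {ae dx, forall x, Q q x -> f x = 0}.
  move=> Pq.
  have : {ae dx, forall x, f x * \1_(Q q) x = 0}.
    apply: ae_eq0_of_boxes.
      apply: (L1_mul_bounded f1 (C := 1)); first by apply: measurable_indic; exact: measurable_obox.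
      by move=> x; exact: normr_indic_le1.
    move=> a b.
    rewrite (_ : (fun x => _) = (fun x => f x * \1_(Q q `&` obox a b) x)); last first.
      by apply/funext => x; rewrite -mulrA; congr (_ * _); rewrite indicI.
    rewrite obox_setI; apply: box0 => x Hx; apply: (PO _ Pq) => i.
    by have := Hx i; rewrite ge_max le_min => /andP[/andP[-> _] /andP[-> _]].
  by apply: filterS => x + Qx; rewrite indicE mem_set// mulr1.
have : {ae dx, forall x, forall q, P q -> Q q x -> f x = 0}.
  pose Z (n : nat) (x : 'rV[R]_N) :=
    if unpickle n is Some q then P q -> Q q x -> f x = 0 else True.
  have aeZ n : {ae dx, forall x, Z n x}.
    rewrite /Z; case: unpickle => [q|]; last exact: aeW.
    have [Pq|nPq] := pselect (P q); last exact: aeW.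
    by apply: filterS (aeQ _ Pq) => x h _.
  apply: filterS (ae_foralln aeZ) => x Zx q.
  by have := Zx (pickle q); rewrite /Z pickleK.
by apply: filterS => x Hx; rewrite OE => -[q Pq Qx]; exact: Hx Pq Qx.
Qed.

End fundamental.

(** * Test functions *)
Section test_functions.
Context {R : realType} {N : nat}.
Local Notation dx := (lebesgue_rV R N).
Implicit Types (f g phi : 'rV[R]_N -> R) (O Omega K : set 'rV[R]_N) (i : 'I_N).

Lemma closed_measurable_rV K : closed K -> measurable K.
Proof. by move=> /closed_openC/open_measurable_rV/measurableC; rewrite setCK. Qed.

Lemma bounded_lebesgue_rV_lty K : measurable K -> bounded_set K -> (dx K < +oo)%E.
Proof.
move=> mK [M [_ KM]].
pose C := `|M| + 1.
apply: le_lt_trans (@lebesgue_rV_obox_lty R N (fun=> - (C + 1)) (fun=> C + 1)).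
apply: le_measure; rewrite ?inE//; first exact: measurable_obox.
move=> x /KM xM i; have := xM C; rewrite /C.
move=> /(_ _)/(le_trans (coord_le_norm x i)); rewrite ler_norml => H.
have /andP[h1 h2] : - (`|M| + 1) <= x ord0 i <= `|M| + 1.
  by apply: H; rewrite (le_lt_trans (ler_norm M))// ltrDl.
by apply/andP; split; lra.
Qed.

Lemma compact_support_bounded g K : continuous g -> compact K ->
  (forall x, ~ K x -> g x = 0) -> exists2 C, 0 <= C & forall x, `|g x| <= C.
Proof.
move=> cg cK g0.
have /compact_bounded[M [_ MP]] : compact (g @` K).
  by apply: continuous_compact => //; exact: continuous_subspaceT.
exists (`|M| + 1) => [|x]; first by rewrite addr_ge0.
have [Kx|nKx] := pselect (K x); last by rewrite g0// normr0 addr_ge0.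
apply: MP; last by exists x.
by rewrite (le_lt_trans (ler_norm M))// ltrDl.
Qed.

Lemma finite_support_L1 g K (C : R) : measurable_fun setT g -> measurable K ->
  (dx K < +oo)%E -> (forall x, ~ K x -> g x = 0) -> (forall x, `|g x| <= C) -> L1 dx g.
Proof.
move=> mg mK Koo g0 gC.
have H : L1 dx (fun x => C * \1_K x).
  by apply: L1Z; exact: L1_indic.
apply: (L1_le mg _ H) => x.
have [Kx|nKx] := pselect (K x); last by rewrite g0// normr0.
by rewrite indicE mem_set// mulr1 (le_trans (gC x))// ler_norm.
Qed.

Lemma partial_eq0 phi i K : closed K -> (forall x, ~ K x -> phi x = 0) ->
  forall x, ~ K x -> partial i phi x = 0.
Proof.
move=> cK p0 x nKx.
have H : is_derive x (basis_vec i) (cst 0 : 'rV[R]_N -> R) 0 by exact: is_derive_cst.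
have nK : \forall y \near x, (cst 0 : 'rV[R]_N -> R) y = phi y.
  have : nbhs x (~` K) by apply: open_nbhs_nbhs; split => //; exact: closed_openC.
  by apply: filterS => y /p0 ->.
by rewrite /partial; have [_ ->] := near_eq_is_derive nK H.
Qed.

Lemma test_smooth O phi : test_function O phi -> smooth phi.
Proof. by case. Qed.

Definition supp phi : set 'rV[R]_N := closure [set x | phi x != 0].

Lemma supp_out phi x : ~ supp phi x -> phi x = 0.
Proof.
by move=> nx; apply: contrapT => /eqP px; apply: nx; exact: subset_closure.
Qed.

Lemma test_partial_smooth O phi i : test_function O phi -> smooth (partial i phi).
Proof. by move=> [sp _ _] k; have [_ /(_ i)[]] := sp k.+1. Qed.

Lemma test_bounded O phi : test_function O phi -> exists2 C, 0 <= C & forall x, `|phi x| <= C.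
Proof.
move=> [sp cp _]; apply: (compact_support_bounded _ cp); last exact: supp_out.
exact: Ck_continuous (sp 0).
Qed.

Lemma test_partial_bounded O phi i : test_function O phi ->
  exists2 C, 0 <= C & forall x, `|partial i phi x| <= C.
Proof.
move=> tp; have [sp cp _] := tp.
apply: (compact_support_bounded _ cp).
  exact: Ck_continuous (test_partial_smooth i tp 0).
by apply: partial_eq0; [exact: closed_closure|exact: supp_out].
Qed.

Lemma smooth_measurable phi : smooth phi -> measurable_fun setT phi.
Proof. by move=> sp; apply: continuous_measurable_rV; exact: Ck_continuous (sp 0). Qed.

Lemma supp_measurable phi : measurable (supp phi).
Proof. by apply: closed_measurable_rV; exact: closed_closure. Qed.

Lemma supp_lty O phi : test_function O phi -> (dx (supp phi) < +oo)%E.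
Proof.
move=> [_ cp _]; apply: bounded_lebesgue_rV_lty; first exact: supp_measurable.
exact: compact_bounded.
Qed.

Lemma test_L1 O phi : test_function O phi -> L1 dx phi.
Proof.
move=> tp; have [C _ pC] := test_bounded tp.
apply: (finite_support_L1 _ (@supp_measurable phi) (supp_lty tp) _ pC).
  exact: smooth_measurable (test_smooth tp).
exact: supp_out.
Qed.

Lemma test_partial_L1 O phi i : test_function O phi -> L1 dx (partial i phi).
Proof.
move=> tp; have [C _ pC] := test_partial_bounded i tp.
apply: (finite_support_L1 _ (@supp_measurable phi) (supp_lty tp) _ pC).
  exact: smooth_measurable (test_partial_smooth i tp).
by apply: partial_eq0; [exact: closed_closure|exact: supp_out].
Qed.

Lemma test_function_translate O Omega phi z : test_function O phi -> (forall x, O x -> Omega (x - z)) ->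
  test_function Omega (fun x => phi (x + z)).
Proof.
move=> [sp cp pO] OO.
pose K := (fun x => x - z) @` supp phi.
have cK : compact K.
  apply: continuous_compact cp; apply: continuous_subspaceT => x.
  exact: (cvgD cvg_id (cvg_cst (- z))).
have C : closed K by apply: compact_closed cK; exact: norm_hausdorff.
have cl : closure [set x | phi (x + z) != 0] `<=` K.
  rewrite [X in _ `<=` X]((closure_id _).1 C); apply: closureS => x /= px.
  by exists (x + z); [exact: subset_closure|rewrite addrK].
split.
- by move=> k; exact: Ck_translate.
- by apply: subclosed_compact cK cl; exact: closed_closure.
- by apply: subset_trans cl _ => _ [x px <-]; apply: OO; exact: pO.
Qed.

End test_functions.

(** * Averages along segments *)
Section lines.
Context {R : realType} {N : nat}.
Implicit Types (phi : 'rV[R]_N -> R) (i : 'I_N).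
Local Notation leb := (@lebesgue_measure R).

(** The indicator inside the integral, rather than integration over the segment,
    lets Fubini be applied on full product spaces. *)
Definition seg_avg i (V : 'rV[R]_N -> R) (h : R) (x : 'rV[R]_N) : R :=
  \int[leb]_t (\1_`[0, 1]%classic t * V (x + (t * h) *: basis_vec i)).

Lemma is_derive_on_line phi i x (h t : R) : (forall y, derivable phi y (basis_vec i)) ->
  is_derive t (1 : R) (fun t => phi (x + (t * h) *: basis_vec i))
    (h * partial i phi (x + (t * h) *: basis_vec i)).
Proof.
move=> dphi.
pose G (s : R) := phi (s *: basis_vec i + x).
have dG s : is_derive s (1 : R) G (partial i phi (s *: basis_vec i + x)).
  have E : (fun k : R => k^-1 *: ((G \o shift s) (k *: 1) - G s)) =
    (fun k => k^-1 *: ((phi \o shift (s *: basis_vec i + x)) (k *: basis_vec i)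
      - phi (s *: basis_vec i + x))).
    apply/funext => k; rewrite /G /=; congr (_ *: (phi _ - _)).
    by rewrite addrA -scalerDl /GRing.scale/= mulr1.
  apply: DeriveDef; first by rewrite /derivable E; exact: dphi.
  by rewrite /derive E.
have dl : is_derive t (1 : R) (fun t : R => t * h) h.
  rewrite (_ : (fun t : R => t * h) = h \*: id); last by apply/funext => s; rewrite /= mulrC.
  apply: (is_derive_eq (is_deriveZ h (is_derive_id t (1 : R)))).
  by rewrite /GRing.scale/= mulr1.
rewrite (_ : (fun t => _) = G \o (fun t => t * h)); last first.
  by apply/funext => s; rewrite /G /= addrC.
have H := @is_derive1_comp R G (fun t => t * h) t _ _ (dG (t * h)) dl.
by rewrite mulrC addrC; exact: H.
Qed.

(** The smooth case of the difference identity; [diff_identity] extends it to weak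
    derivatives. *)
Lemma ftc_line phi i x (h : R) : smooth phi ->
  phi (x + h *: basis_vec i) - phi x = h * seg_avg i (partial i phi) h x.
Proof.
move=> sp.
have dphi y : derivable phi y (basis_vec i) by have [_ /(_ i)[]] := sp 1.
have cp : continuous (partial i phi) by have [_ /(_ i)[_ []]] := sp 1.
have cl : continuous (fun t : R => x + (t * h) *: basis_vec i).
  move=> t; apply: cvgD; first exact: cvg_cst.
  by apply: cvgZl; apply: cvgMl; exact: cvg_id.
have cF : continuous (fun t : R => phi (x + (t * h) *: basis_vec i)).
  by move=> t; apply: (continuous_comp (cl t)); exact: (Ck_continuous (sp 0)).
have cdF : continuous (fun t : R => h * partial i phi (x + (t * h) *: basis_vec i)).
  by move=> t; apply: cvgMr; apply: (continuous_comp (cl t)); exact: cp.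
have H1 : derivable_oo_LRcontinuous (fun t : R => phi (x + (t * h) *: basis_vec i)) 0 1.
  split.
  + by move=> t _; have [] := is_derive_on_line x h t dphi.
  + by apply: cvg_at_right_filter; exact: cF.
  + by apply: cvg_at_left_filter; exact: cF.
have H2 : {in `]0, 1[, (fun t : R => phi (x + (t * h) *: basis_vec i))^`()%classic =1
     (fun t : R => h * partial i phi (x + (t * h) *: basis_vec i))}.
  by move=> t _; rewrite derive1E; have [_ ->] := is_derive_on_line x h t dphi.
have := continuous_FTC2 ltr01 (continuous_subspaceT cdF) H1 H2.
move=> /(congr1 fine); rewrite mul1r mul0r scale0r addr0 /= => E.
rewrite -E.
rewrite -[LHS]/(\int[leb]_(t in `[0, 1]) (h * partial i phi (x + (t * h) *: basis_vec i))).
rewrite RintegralZl//; last first.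
  apply: continuous_compact_integrable; first exact: segment_compact.
  apply: continuous_subspaceT => t.
  by apply: (continuous_comp (cl t)); exact: cp.
congr (_ * _); rewrite Rintegral_mkcond; apply: eq_Rintegral => t _.
by rewrite patch_indic mulrC.
Qed.

End lines.

Section Rfubini.
Context {R : realType} d1 d2 (T1 : measurableType d1) (T2 : measurableType d2).
Variables (m1 : {sigma_finite_measure set T1 -> \bar R})
  (m2 : {sigma_finite_measure set T2 -> \bar R}).
Variable g : T1 * T2 -> R.
Hypothesis g1 : L1 (m1 \x m2)%E g.

(** A function integrable on the product has finite partial integrals almost
    everywhere; this is where the real-valued and the extended integrals agree. *)
Lemma Rfubini_ae : {ae m2, forall y,
  (\int[m1]_x (g (x, y))%:E)%E = (\int[m1]_x g (x, y))%:E}.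
Proof.
have := ae_integrable2 g1; apply: filterS => y gy.
by rewrite /Rintegral fineK//; exact: integrable_fin_num.
Qed.

Lemma Rfubini_L1 : L1 m2 (fun y => \int[m1]_x g (x, y)).
Proof.
have mg := measurable_int _ g1.
have mG := measurable_fubini_G g1.
have mG' : measurable_fun setT (fun y => \int[m1]_x g (x, y)).
  by apply: measurableT_comp => //; exact: mG.
apply/integrableP; split; first exact/measurable_EFinP.
apply: le_lt_trans ((integrable21ltyP m1 m2 mg).1 g1).
apply: ae_ge0_le_integral => //.
- by apply: measurableT_comp => //; exact/measurable_EFinP.
- by move=> y _; exact: integral_ge0.
- apply: (@measurable_fun_fubini_tonelli_G _ _ _ _ _ m1 (fun z => `|(g z)%:E|%E)) => //.
  exact: measurableT_comp.
- have := Rfubini_ae; apply: filterS => y gy _.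
  rewrite [leLHS](_ : _ = `|\int[m1]_x (g (x, y))%:E|)%E; last by rewrite gy.
  have mp : measurable_fun setT (fun x : T1 => (x, y)) by exact: measurable_fun_pair.
  by apply: le_abse_integral => //; exact: (measurableT_comp mg mp).
Qed.

Lemma Rfubini2 : \int[m2]_y \int[m1]_x g (x, y) = fine (\int[m1 \x m2]_z (g z)%:E)%E.
Proof.
rewrite -(integral21_prod_meas1 g1) /Rintegral; congr fine.
apply: ae_eq_integral => //.
- by apply/measurable_EFinP; exact: L1_measurable Rfubini_L1.
- exact: measurable_fubini_G g1.
- by have := Rfubini_ae; apply: filterS => y gy _; rewrite -gy.
Qed.

Lemma Rfubini_ae1 : {ae m1, forall x,
  (\int[m2]_y (g (x, y))%:E)%E = (\int[m2]_y g (x, y))%:E}.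
Proof.
have := ae_integrable1 g1; apply: filterS => y gy.
by rewrite /Rintegral fineK//; exact: integrable_fin_num.
Qed.

Lemma Rfubini_L1' : L1 m1 (fun x => \int[m2]_y g (x, y)).
Proof.
have mg := measurable_int _ g1.
have mG := measurable_fubini_F g1.
have mG' : measurable_fun setT (fun x => \int[m2]_y g (x, y)).
  by apply: measurableT_comp => //; exact: mG.
apply/integrableP; split; first exact/measurable_EFinP.
apply: le_lt_trans ((integrable12ltyP m1 m2 mg).1 g1).
apply: ae_ge0_le_integral => //.
- by apply: measurableT_comp => //; exact/measurable_EFinP.
- by move=> y _; exact: integral_ge0.
- apply: (@measurable_fun_fubini_tonelli_F _ _ _ _ _ m2 (fun z => `|(g z)%:E|%E)) => //.
  exact: measurableT_comp.
- have := Rfubini_ae1; apply: filterS => y gy _.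
  rewrite [leLHS](_ : _ = `|\int[m2]_x (g (y, x))%:E|)%E; last by rewrite gy.
  have mp : measurable_fun setT (fun x : T2 => (y, x)) by exact: measurable_fun_pair.
  by apply: le_abse_integral => //; exact: (measurableT_comp mg mp).
Qed.

Lemma Rfubini1 : \int[m1]_x \int[m2]_y g (x, y) = fine (\int[m1 \x m2]_z (g z)%:E)%E.
Proof.
rewrite -(integral12_prod_meas1 g1) /Rintegral; congr fine.
apply: ae_eq_integral => //.
- by apply/measurable_EFinP; exact: L1_measurable Rfubini_L1'.
- exact: measurable_fubini_F g1.
- by have := Rfubini_ae1; apply: filterS => y gy _; rewrite -gy.
Qed.

Lemma Rfubini : \int[m1]_x \int[m2]_y g (x, y) = \int[m2]_y \int[m1]_x g (x, y).
Proof. by rewrite Rfubini1 Rfubini2. Qed.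

End Rfubini.

Section seg_fubini.
Context {R : realType} {N : nat}.
Local Notation dx := (lebesgue_rV R N).
Local Notation leb := (@lebesgue_measure R).
Implicit Types (V psi : 'rV[R]_N -> R) (i : 'I_N) (h : R).

Local Notation ind01 t := (\1_(`[0, 1]%classic : set R) t : R).

Lemma measurable_seg i h : measurable_fun setT
  (fun z : measurableTypeR R * 'rV[R]_N => z.2 + (z.1 * h) *: basis_vec i).
Proof.
apply: measurable_fun_rV => j; under eq_fun do rewrite !mxE.
apply: measurable_funD; first exact: (measurableT_comp (measurable_coord j) measurable_snd).
apply: measurable_funM => //.
by apply: measurable_funM => //; exact: measurable_fst.
Qed.

Lemma lebesgue_unit_segment : leb (`[0, 1]%classic : set R) = 1%E.
Proof. by rewrite lebesgue_measure_itv/= lte_fin ltr01 sube0. Qed.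

Lemma L1_ind01 : L1 leb (fun t => ind01 t).
Proof.
by apply: L1_indic; [exact: measurable_itv|apply: (le_lt_trans (_ : _ <= 1)%E);
  rewrite ?ltry// -lebesgue_unit_segment].
Qed.

Lemma int_ind01 : \int[leb]_t ind01 t = 1.
Proof. exact: etrans (Rintegral_indic leb (measurable_itv _)) (congr1 fine lebesgue_unit_segment). Qed.

Lemma L1_translate V z : L1 dx V -> L1 dx (fun x => V (x + z)).
Proof. by move=> V1; exact: (integrable_translate z V1). Qed.

Lemma seg_integrand_L1 i h V psi (C : R) : L1 dx V -> measurable_fun setT psi ->
  (forall x, `|psi x| <= C) ->
  L1 (leb \x dx)%E (fun z => ind01 z.1 * V (z.2 + (z.1 * h) *: basis_vec i) * psi z.2).
Proof.
move=> V1 mpsi psiC.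
have mV := L1_measurable V1.
have mg : measurable_fun setT
    (fun z : measurableTypeR R * 'rV[R]_N =>
      ind01 z.1 * V (z.2 + (z.1 * h) *: basis_vec i) * psi z.2).
  apply: measurable_funM; last exact: (measurableT_comp mpsi measurable_snd).
  apply: measurable_funM; last exact: (measurableT_comp mV (measurable_seg i h)).
  exact: (measurableT_comp (measurable_indic _) measurable_fst).
apply/integrable12ltyP; first exact/measurable_EFinP.
have C0 : 0 <= C by exact: le_trans (psiC 0).
pose S := (\int[dx]_x `|V x|%:E)%E.
have Soo : (S < +oo)%E by case/integrableP : V1.
apply: (@le_lt_trans _ _ (\int[leb]_t ((ind01 t)%:E * (C%:E * S)))%E).
  apply: ge0_le_integral => //.
  - by move=> t _; exact: integral_ge0.
  - apply: (@measurable_fun_fubini_tonelli_F _ _ _ _ _ dx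
      (fun z => `|(ind01 z.1 * V (z.2 + (z.1 * h) *: basis_vec i) * psi z.2)%:E|%E)) => //.
    by apply: measurableT_comp => //; exact/measurable_EFinP.
  - apply: emeasurable_funM => //; apply/measurable_EFinP; exact: measurable_indic.
  move=> t _; rewrite /S.
  rewrite -(ge0_integral_translate ((t * h) *: basis_vec i) (f := fun x => `|V x|%:E))//; last first.
    by apply/measurable_EFinP; exact: measurableT_comp.
  have mVt0 : measurable_fun setT (fun x : 'rV[R]_N => V (x + (t * h) *: basis_vec i)).
    exact: (measurableT_comp mV (measurable_translate _)).
  have mVt : measurable_fun setT (fun x : 'rV[R]_N => `|V (x + (t * h) *: basis_vec i)|%:E).
    by apply/measurable_EFinP; exact: measurableT_comp.
  have mVt1 : measurable_fun setT
      (fun x : 'rV[R]_N => (ind01 t * V (x + (t * h) *: basis_vec i) * psi x)%:E).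
    apply/measurable_EFinP; apply: measurable_funM => //.
    exact: measurable_funM.
  rewrite muleA -EFinM -(ge0_integralZl_EFin dx measurableT _ mVt)//; last by rewrite mulr_ge0.
  apply: ge0_le_integral => //.
  - exact: measurableT_comp mVt1.
  - exact: measurable_funeM.
  - move=> x _; rewrite /= -!EFinM lee_fin !normrM ger0_norm// -!mulrA.
    by rewrite ler_wpM2l// mulrC ler_wpM2r.
rewrite ge0_integralZr//; last 2 first.
- by apply/measurable_EFinP; exact: measurable_indic.
- by rewrite mule_ge0// integral_ge0.
rewrite integral_indic//= setIT lebesgue_measure_itv/= lte_fin ltr01 sube0 mul1e.
by rewrite lte_mul_pinfty.
Qed.

Lemma seg_integrand1_L1 i h V : L1 dx V ->
  L1 (leb \x dx)%E (fun z => ind01 z.1 * V (z.2 + (z.1 * h) *: basis_vec i) * cst 1 z.2).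
Proof. by move=> V1; apply: (@seg_integrand_L1 _ _ _ _ 1) => // x; rewrite normr1. Qed.

Lemma seg_avg_ae i h V : L1 dx V -> {ae dx, forall x,
  L1 leb (fun t => ind01 t * V (x + (t * h) *: basis_vec i))}.
Proof.
move=> V1; have := ae_integrable2 (seg_integrand1_L1 i h V1); apply: filterS => x.
apply: eq_integrable => // t _ /=; congr EFin; exact: mulr1.
Qed.

Lemma seg_avg_L1 i h V : L1 dx V -> L1 dx (seg_avg i V h).
Proof.
move=> V1; have := Rfubini_L1 (seg_integrand1_L1 i h V1).
rewrite (_ : (fun y => _) = seg_avg i V h)//.
by apply/funext => x; apply: eq_Rintegral => t _ /=; rewrite mulr1.
Qed.

Lemma seg_inner_integralE i h V psi (C : R) : L1 dx V -> measurable_fun setT psi ->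
  (forall x, `|psi x| <= C) ->
  (fun t => \int[dx]_x (ind01 t * V (x + (t * h) *: basis_vec i) * psi x)) =
  (fun t => ind01 t * \int[dx]_x (V (x + (t * h) *: basis_vec i) * psi x)).
Proof.
move=> V1 mpsi psiC; apply/funext => t.
rewrite -RintegralZl//; last first.
  by apply: (L1_mul_bounded _ mpsi psiC); exact: L1_translate.
by apply: eq_Rintegral => x _; rewrite mulrA.
Qed.

Lemma seg_inner_integral_L1 i h V psi (C : R) : L1 dx V -> measurable_fun setT psi ->
  (forall x, `|psi x| <= C) ->
  L1 leb (fun t => ind01 t * \int[dx]_x (V (x + (t * h) *: basis_vec i) * psi x)).
Proof.
move=> V1 mpsi psiC; have := Rfubini_L1' (seg_integrand_L1 i h V1 mpsi psiC).
by rewrite /= (seg_inner_integralE i h V1 mpsi psiC).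
Qed.

(** Averaging along segments is self-adjoint up to reversing the segment: after
    Fubini, the translation can be moved to [psi] for each fixed [t]. *)
Lemma seg_swap i h V psi (C : R) : L1 dx V -> measurable_fun setT psi ->
  (forall x, `|psi x| <= C) ->
  \int[dx]_x (seg_avg i V h x * psi x) =
  \int[leb]_t (ind01 t * \int[dx]_x (V (x + (t * h) *: basis_vec i) * psi x)).
Proof.
move=> V1 mpsi psiC; have g1 := seg_integrand_L1 i h V1 mpsi psiC.
have := Rfubini g1; rewrite /= (seg_inner_integralE i h V1 mpsi psiC) => ->.
apply: ae_Rintegral.
- by apply: measurable_funM => //; exact: L1_measurable (seg_avg_L1 i h V1).
- exact: L1_measurable (Rfubini_L1 g1).
- have := seg_avg_ae i h V1; apply: filterS => x Vx.
  by rewrite /seg_avg -RintegralZr.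
Qed.

Lemma int_ind01_cst (c : R) : \int[leb]_t (ind01 t * c) = c.
Proof. by rewrite RintegralZr//; [rewrite int_ind01 mul1r|exact: L1_ind01]. Qed.

(** The finite average of [|V|] bounds that of [V] only almost everywhere, hence
    the minimum of the two as an intermediate integrand. *)
Lemma seg_avg_norm i h V : L1 dx V ->
  \int[dx]_x `|seg_avg i V h x| <= \int[dx]_x `|V x|.
Proof.
move=> V1; have aV1 := L1_norm V1.
have E : \int[dx]_x (seg_avg i (fun x => `|V x|) h x * cst 1 x) = \int[dx]_x `|V x|.
  rewrite (@seg_swap i h _ (cst 1) 1 aV1)//; last first.
    by move=> x; rewrite normr1.
  rewrite -[RHS]int_ind01_cst; apply: eq_Rintegral => t _; congr (_ * _).
  rewrite -(Rintegral_translate ((t * h) *: basis_vec i) aV1).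
  by apply: eq_Rintegral => x _; rewrite mulr1.
rewrite -E.
have E2 : \int[dx]_x (seg_avg i (fun x => `|V x|) h x * cst 1 x) =
    \int[dx]_x (seg_avg i (fun x => `|V x|) h x).
  by apply: eq_Rintegral => x _; rewrite mulr1.
rewrite E2.
have a1 := seg_avg_L1 i h V1; have a2 := seg_avg_L1 i h aV1.
have -> : \int[dx]_x `|seg_avg i V h x| =
  \int[dx]_x Num.min `|seg_avg i V h x| (seg_avg i (fun x => `|V x|) h x).
  apply: ae_Rintegral.
  - exact: L1_measurable (L1_norm a1).
  - by apply: measurable_minr; [exact: L1_measurable (L1_norm a1)|exact: L1_measurable a2].
  - have := seg_avg_ae i h V1; apply: filterS => x Vx.
    apply/esym/min_idPl; apply: (le_trans (le_normr_Rintegral measurableT Vx)).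
    rewrite le_eqVlt; apply/orP; left; apply/eqP; apply: eq_Rintegral => t _.
    by rewrite normrM ger0_norm.
apply: le_Rintegral => //.
- apply: (L1_le _ _ (L1_norm a1)).
    by apply: measurable_minr; [exact: L1_measurable (L1_norm a1)|exact: L1_measurable a2].
  move=> x; rewrite normr_id ger0_norm; last first.
    rewrite le_min normr_ge0/=; apply: Rintegral_ge0 => t _; by rewrite mulr_ge0.
  by rewrite ge_min lexx.
- by move=> x _; rewrite ge_min lexx orbT.
Qed.

End seg_fubini.

(** * Difference quotients of weakly differentiable functions *)
Section difference.
Context {R : realType} {N : nat}.
Local Notation dx := (lebesgue_rV R N).
Local Notation leb := (@lebesgue_measure R).
Local Notation ind01 t := (\1_(`[0, 1]%classic : set R) t : R).
Implicit Types (f V psi phi : 'rV[R]_N -> R) (i : 'I_N) (h : R) (Omega : set 'rV[R]_N).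

(** The weak partial derivative for functions on the whole space: with [f] and [V]
    extended by 0 outside [Omega], both sides can be translated freely. *)
Definition weak_partial Omega f V i : Prop := forall phi, test_function Omega phi ->
  \int[dx]_x (f x * partial i phi x) = - \int[dx]_x (V x * phi x).

(** Points at distance more than [delta] from the complement of [Omega], stated
    with balls so as to be open. *)
Definition inset Omega (delta : R) : set 'rV[R]_N :=
  [set x | exists2 r, delta < r & ball x r `<=` Omega].

Lemma open_inset Omega delta : open (inset Omega delta).
Proof.
rewrite openE => x [r dr xr]; rewrite /interior -nbhs_ballE.
exists ((r - delta) / 2) => /=; first by rewrite divr_gt0// subr_gt0.
move=> y xy; exists ((r + delta) / 2); first lra.
move=> z yz; apply: xr; have := ball_triangle xy yz.
by rewrite (_ : (r - delta) / 2 + (r + delta) / 2 = r)//; lra.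
Qed.

Lemma basis_ball x i (s r : R) : `|s| < r -> ball x r (x + s *: basis_vec i).
Proof.
move=> sr; have r0 : 0 < r by exact: le_lt_trans (normr_ge0 s) sr.
split => // k j; rewrite (ord1 k) /ball/= !mxE opprD addrA subrr add0r normrN.
case: (_ && _); last by rewrite mulr0 normr0.
by rewrite mulr1.
Qed.

Lemma inset_translate Omega delta x i s : `|s| <= delta -> inset Omega delta x ->
  Omega (x + s *: basis_vec i).
Proof. by move=> sd [r dr xr]; apply/xr/basis_ball; exact: le_lt_trans sd dr. Qed.

Lemma test_function_inset_translate Omega delta psi i s : `|s| <= delta ->
  test_function (inset Omega delta) psi ->
  test_function Omega (fun x => psi (x + s *: basis_vec i)).
Proof.
move=> sd tp; apply: (test_function_translate tp) => x Ox.
by rewrite -scaleNr; apply: inset_translate Ox; rewrite normrN.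
Qed.

(** The average of the partial derivative along a segment of length 1 is a
    difference of translates of [phi], whose integral vanishes; averaging does
    not change the integral. *)
Lemma int_partial0 Omega phi i : test_function Omega phi -> \int[dx]_x partial i phi x = 0.
Proof.
move=> tp; have p1 := test_partial_L1 i tp; have phi1 := test_L1 tp.
have E : \int[dx]_x (seg_avg i (partial i phi) 1 x * cst 1 x) = \int[dx]_x partial i phi x.
  rewrite (@seg_swap _ _ i 1 _ (cst 1) 1 p1)//; last by move=> x; rewrite normr1.
  rewrite -[RHS]int_ind01_cst; apply: eq_Rintegral => t _; congr (_ * _).
  rewrite -(Rintegral_translate ((t * 1) *: basis_vec i) p1).
  by apply: eq_Rintegral => x _; exact: mulr1.
rewrite -E.
transitivity (\int[dx]_x (phi (x + 1 *: basis_vec i) - phi x)).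
  apply: eq_Rintegral => x _; rewrite (ftc_line i x 1 (test_smooth tp)).
  by rewrite mul1r mulr1.
rewrite RintegralB//; last exact: L1_translate.
by rewrite Rintegral_translate ?subrr.
Qed.

(** Discrete integration by parts. *)
Lemma int_shift_diff f psi i h (Cp : R) : L1 dx f -> measurable_fun setT psi ->
  (forall x, `|psi x| <= Cp) ->
  \int[dx]_x ((f (x + h *: basis_vec i) - f x) * psi x) =
  \int[dx]_x (f x * (psi (x + (- h) *: basis_vec i) - psi x)).
Proof.
move=> f1 mp pC.
have fh1 := L1_translate (h *: basis_vec i) f1.
have I1 : L1 dx (fun x => f (x + h *: basis_vec i) * psi x) by exact: L1_mul_bounded mp pC.
have I2 : L1 dx (fun x => f x * psi x) by exact: L1_mul_bounded mp pC.
have I3 : L1 dx (fun x => f x * psi (x + (- h) *: basis_vec i)).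
  apply: (L1_mul_bounded (C := Cp) f1) => //.
  exact: (measurableT_comp mp (measurable_translate _)).
transitivity (\int[dx]_x (f (x + h *: basis_vec i) * psi x) - \int[dx]_x (f x * psi x)).
  by rewrite -RintegralB//; apply: eq_Rintegral => x _; rewrite mulrBl.
transitivity (\int[dx]_x (f x * psi (x + (- h) *: basis_vec i)) -
    \int[dx]_x (f x * psi x)); last first.
  by rewrite -RintegralB//; apply: eq_Rintegral => x _; rewrite mulrBr.
congr (_ - _); rewrite -(Rintegral_translate (h *: basis_vec i) I3).
by apply: eq_Rintegral => x _; rewrite scaleNr addrK.
Qed.

(** Against a test function [psi], both sides equal, up to sign, the integral of
    [f] times a difference of [psi]: for the left side this is discrete
    integration by parts; for the right side, [ftc_line] writes the difference of
    [psi] as an average of partial derivatives of translated test functions, to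
    which the definition of [V] applies. *)
Lemma diff_identity Omega f V i (C delta h : R) :
  L1 dx f -> (forall x, `|f x| <= C) -> L1 dx V -> weak_partial Omega f V i ->
  `|h| <= delta -> {ae dx, forall x, inset Omega delta x ->
    f (x + h *: basis_vec i) - f x = h * seg_avg i V h x}.
Proof.
move=> f1 fC V1 fV hd.
have mf := L1_measurable f1.
have a1 := seg_avg_L1 i h V1.
have fh1 := L1_translate (h *: basis_vec i) f1.
have g1 : L1 dx (fun x => f (x + h *: basis_vec i) - f x - h * seg_avg i V h x).
  by apply: L1B; [exact: L1B|exact: L1Z].
have := @fundamental_lemma R N (inset Omega delta) _ (@open_inset Omega delta) g1.
move=> H; have {H} : {ae dx, forall x, inset Omega delta x ->
    f (x + h *: basis_vec i) - f x - h * seg_avg i V h x = 0}.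
  apply: H => psi tp.
  have tp' : test_function Omega psi.
    have := @test_function_inset_translate Omega delta psi i 0; rewrite scale0r normr0.
    under eq_fun do rewrite addr0.
    by apply => //; exact: le_trans hd.
  have sp := test_smooth tp.
  have [Cp _ pC] := test_bounded tp.
  have mp := smooth_measurable sp.
  have p1 := test_L1 tp; have dp1 := test_partial_L1 i tp.
  have E1 : \int[dx]_x ((f (x + h *: basis_vec i) - f x) * psi x) =
      \int[dx]_x (f x * (psi (x + (- h) *: basis_vec i) - psi x)).
    exact: int_shift_diff mp pC.
  have E2 : \int[dx]_x (f x * (psi (x + (- h) *: basis_vec i) - psi x)) =
      - h * \int[leb]_t (ind01 t * \int[dx]_x (partial i psi (x + (t * - h) *: basis_vec i) * f x)).
    rewrite -(seg_swap i (- h) dp1 mf fC) -RintegralZl//; last first.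
      by apply: L1_mul_bounded mf fC; exact: seg_avg_L1.
    by apply: eq_Rintegral => x _; rewrite (ftc_line i x (- h) sp) mulrCA (mulrC (f x)).
  have E3 : \int[leb]_t (ind01 t * \int[dx]_x (partial i psi (x + (t * - h) *: basis_vec i) * f x)) =
      - \int[leb]_t (ind01 t * \int[dx]_x (V (x + (t * h) *: basis_vec i) * psi x)).
    rewrite -[RHS]mulN1r -RintegralZl//; last exact: seg_inner_integral_L1 mp pC.
    apply: eq_Rintegral => t _; rewrite mulrCA mulN1r.
    have [t01|nt01] := pselect (`[0, 1]%classic t); last by rewrite indicE memNset// !mul0r.
    congr (_ * _).
    have th : `|t * - h| <= delta.
      move: t01; rewrite /= in_itv/= => /andP[t0 t1].
      by rewrite normrM normrN (le_trans _ hd)// ger0_norm// ler_piMl.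
    have := fV _ (test_function_inset_translate i th tp).
    rewrite partial_translate => E.
    transitivity (\int[dx]_x (f x * partial i psi (x + (t * - h) *: basis_vec i))).
      by apply: eq_Rintegral => x _; rewrite mulrC.
    rewrite E; congr (- _).
    have I3 : L1 dx (fun x => V x * psi (x + (t * - h) *: basis_vec i)).
      apply: (L1_mul_bounded (C := Cp) V1) => //.
      exact: (measurableT_comp mp (measurable_translate _)).
    rewrite -(Rintegral_translate ((t * h) *: basis_vec i) I3).
    by apply: eq_Rintegral => x _; rewrite mulrN scaleNr addrK.
  transitivity (\int[dx]_x ((f (x + h *: basis_vec i) - f x) * psi x)
     - \int[dx]_x ((h * seg_avg i V h x) * psi x)).
    rewrite -RintegralB//.
    - by apply: eq_Rintegral => x _; rewrite mulrBl.
    - by apply: L1_mul_bounded mp pC; exact: L1B.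
    - by apply: L1_mul_bounded mp pC; exact: L1Z.
  rewrite E1 E2 E3 mulrNN.
  transitivity (h * \int[leb]_t (ind01 t * \int[dx]_x (V (x + (t * h) *: basis_vec i) * psi x))
    - h * \int[dx]_x (seg_avg i V h x * psi x)).
    congr (_ - _); rewrite -RintegralZl//; last exact: L1_mul_bounded mp pC.
    by apply: eq_Rintegral => x _; rewrite mulrA.
  by rewrite (seg_swap i h V1 mp pC) subrr.
by apply: filterS => x H /H /eqP; rewrite subr_eq0 => /eqP.
Qed.

End difference.

(** * The Leibniz rule *)
Section product_rule.
Context {R : realType} {N : nat}.
Local Notation dx := (lebesgue_rV R N).
Local Notation leb := (@lebesgue_measure R).
Local Notation ind01 t := (\1_(`[0, 1]%classic : set R) t : R).
Implicit Types (f V psi phi : 'rV[R]_N -> R) (i : 'I_N) (h : R) (Omega : set 'rV[R]_N).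

(** The support is compact, so that it stays at positive distance from the
    complement of [Omega]. *)
Lemma supp_sub_inset Omega phi : open Omega -> test_function Omega phi ->
  exists2 delta, 0 < delta & supp phi `<=` inset Omega delta.
Proof.
move=> oO [_ cp pO].
have H : \forall d \near (0 : R)^'+, forall x, supp phi x -> inset Omega d x.
  apply: (compact_near_coveringP (supp phi)).1 cp _ _ _ _ _ => x Kx.
  have : nbhs x Omega by apply: open_nbhs_nbhs; split => //; exact: pO.
  rewrite -nbhs_ballE => -[r /= r0 xr].
  exists (ball x (r / 4), [set d : R | d < r / 4]).
    split => /=; first by apply: nbhsx_ballx; rewrite divr_gt0.
    by apply: nbhs_right_lt; rewrite divr_gt0.
  move=> [y d] [/= xy dr]; exists (r / 2); first lra.
  move=> z yz; apply: xr; have := ball_triangle xy yz.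
  by apply: le_ball; lra.
have : \forall d \near (0 : R)^'+, 0 < d /\ forall x, supp phi x -> inset Omega d x.
  by near=> d; split; [near: d; exact: nbhs_right_gt|near: d].
by move=> /filter_ex[d [d0 dP]]; exists d.
Unshelve. all: by end_near. Qed.

(** For a function with an integrable weak derivative, translation is Lipschitz
    into [L^1]: integrate the absolute value of [diff_identity]. *)
Lemma shift_estimate Omega f V i (C delta s : R) (K : set 'rV[R]_N) :
  L1 dx f -> (forall x, `|f x| <= C) -> L1 dx V -> weak_partial Omega f V i ->
  `|s| <= delta -> measurable K -> K `<=` inset Omega delta ->
  \int[dx]_x (\1_K x * `|f (x + s *: basis_vec i) - f x|) <= `|s| * \int[dx]_x `|V x|.
Proof.
move=> f1 fC V1 fV sd mK KO.
have a1 := L1_norm (seg_avg_L1 i s V1).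
have sa1 : L1 dx (fun x => `|s| * `|seg_avg i V s x|) by exact: L1Z.
have mi : measurable_fun setT (\1_K : 'rV[R]_N -> R) by exact: measurable_indic.
have sak : L1 dx (fun x => (`|s| * `|seg_avg i V s x|) * \1_K x).
  by apply: (L1_mul_bounded (C := 1) sa1) => // x; exact: normr_indic_le1.
apply: le_trans (_ : _ <= `|s| * \int[dx]_x `|seg_avg i V s x|) _; last first.
  by rewrite ler_wpM2l// seg_avg_norm.
rewrite -RintegralZl//.
have -> : \int[dx]_x (\1_K x * `|f (x + s *: basis_vec i) - f x|) =
  \int[dx]_x ((`|s| * `|seg_avg i V s x|) * \1_K x).
  apply: ae_Rintegral.
  - apply: measurable_funM => //; apply: measurableT_comp => //.
    exact: L1_measurable (L1B (L1_translate _ f1) f1).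
  - exact: L1_measurable sak.
  - have := diff_identity f1 fC V1 fV sd; apply: filterS => x H.
    have [Kx|nKx] := pselect (K x); last by rewrite indicE memNset// mul0r mulr0.
    by rewrite indicE mem_set// mul1r mulr1 (H (KO _ Kx)) normrM.
apply: le_Rintegral => // x _; by rewrite ler_piMr ?mulr_ge0.
Qed.

Lemma measurable_superlevel V (M : R) : measurable_fun setT V -> measurable [set x | M < V x].
Proof.
move=> mV; rewrite (_ : mkset _ = V @^-1` `]M, +oo[%classic); last first.
  by apply/seteqP; split => x /=; rewrite in_itv/= andbT.
by rewrite -[X in measurable X]setTI; apply: mV => //; exact: measurable_itv.
Qed.

Lemma truncation V (eps : R) : L1 dx V -> 0 < eps -> exists2 M : R, 0 <= M &
  \int[dx]_x (`|V x| * \1_[set x | M < `|V x|] x) <= eps.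
Proof.
move=> V1 e0; have mV := L1_measurable (L1_norm V1).
have mS (M : R) : measurable [set x | M < `|V x|] by exact: measurable_superlevel.
have : \int[dx]_x (`|V x| * \1_[set x | n%:R < `|V x|] x) @[n --> \oo] -->
    \int[dx]_x (cst 0 x : R).
  apply: (@Rintegral_dominated_cvg _ _ _ _ (fun n x => `|V x| * \1_[set x | n%:R < `|V x|] x) _ (fun x => `|V x|)).
  - by move=> n; apply: measurable_funM => //; exact: measurable_indic.
  - move=> x; apply: cvg_near_cst; near=> n.
    rewrite indicE memNset ?mulr0//= => /ltW; rewrite leNgt => /negP; apply.
    near: n; exact: nbhs_infty_gtr.
  - exact: L1_norm.
  - move=> n x; rewrite normrM normr_id -[leRHS]mulr1 ler_pM//; exact: normr_indic_le1.
have -> : \int[dx]_x (cst 0 x : R) = 0 by rewrite /Rintegral integral0.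
move=> /cvgrPdist_le/(_ _ e0)/filter_ex[n]; rewrite sub0r normrN => H.
by exists n%:R => //; apply: le_trans H; exact: ler_norm.
Unshelve. all: by end_near. Qed.

(** Bounded functions [B] that are small in [L^1] are small against the fixed
    integrable weight [|V|]: split the weight at the height [M] of
    [truncation]. *)
Lemma uniform_integrability V (eps C : R) : L1 dx V -> 0 < eps -> 0 <= C ->
  exists2 M : R, 0 <= M & forall B, L1 dx B -> (forall x, 0 <= B x <= C) ->
    \int[dx]_x (`|V x| * B x) <= M * \int[dx]_x B x + eps.
Proof.
move=> V1 e0 C0.
have e1 : 0 < eps / (C + 1) by rewrite divr_gt0// ltr_wpDl.
have [M M0 HM] := truncation V1 e1.
exists M => // B B1 BC; have mB := L1_measurable B1.
have aV1 := L1_norm V1; have mV := L1_measurable aV1.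
have VB1 : L1 dx (fun x => `|V x| * B x).
  by apply: (L1_mul_bounded (C := C) aV1 mB) => x; have /andP[h1 h2] := BC x; rewrite ger0_norm.
have mS : measurable [set x | M < `|V x|] by exact: measurable_superlevel.
have T1 : L1 dx (fun x => `|V x| * \1_[set x | M < `|V x|] x).
  apply: (L1_mul_bounded (C := 1) aV1); first exact: measurable_indic.
  by move=> x; exact: normr_indic_le1.
have CT1 := L1Z C T1; have MB1 := L1Z M B1.
apply: le_trans (_ : _ <= M * \int[dx]_x B x + C * (eps / (C + 1))) _; last first.
  rewrite lerD2l mulrCA ler_piMr ?(ltW e0)//.
  by rewrite ler_pdivrMr ?mul1r ?lerDl// ltr_wpDl.
apply: le_trans (_ : _ <= M * \int[dx]_x B x +
   C * \int[dx]_x (`|V x| * \1_[set x | M < `|V x|] x)) _; last first.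
  by rewrite lerD2l ler_wpM2l.
rewrite -!RintegralZl// -RintegralD//.
apply: le_Rintegral => //; first exact: L1D.
move=> x _; have /andP[h1 h2] := BC x.
have [h|h] := ltP M `|V x|.
  rewrite indicE mem_set// mulr1 -[leLHS]add0r lerD ?mulr_ge0//.
  by rewrite mulrC ler_wpM2r.
rewrite indicE memNset ?mulr0 ?addr0 ?ler_wpM2r//=.
by rewrite ltNge h.
Qed.

Lemma avg_close (T : R -> R) (c e : R) : L1 leb (fun t => ind01 t * T t) ->
  (forall t, 0 <= t <= 1 -> `|T t - c| <= e) -> `|\int[leb]_t (ind01 t * T t) - c| <= e.
Proof.
move=> T1 Tc; have Ic (a : R) : L1 leb (fun t => ind01 t * a).
  by apply: eq_integrable (L1Z a L1_ind01) => // t _ /=; rewrite mulrC.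
rewrite -{1}(int_ind01_cst c) -RintegralB//; last exact: Ic.
apply: le_trans (le_normr_Rintegral measurableT (L1B T1 (Ic c))) _.
rewrite -[leRHS](int_ind01_cst e); apply: le_Rintegral => //.
- exact: L1_norm (L1B T1 (Ic c)).
- exact: Ic.
move=> t _; rewrite -mulrBr normrM ger0_norm//.
have [t01|nt01] := pselect (`[0, 1]%classic t); last by rewrite indicE memNset// !mul0r.
by rewrite ler_wpM2l// Tc//; move: t01; rewrite /= in_itv.
Qed.

Lemma seg_avg_bound V i h x (D : R) : measurable_fun setT V -> (forall x, `|V x| <= D) ->
  `|seg_avg i V h x| <= D.
Proof.
move=> mV VD; have D0 : 0 <= D by exact: le_trans (VD 0).
have m0 : measurable_fun setT
    (fun t : measurableTypeR R => ind01 t * V (x + (t * h) *: basis_vec i)).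
  apply: measurable_funM; first exact: measurable_indic.
  have ms : measurable_fun setT (fun t : measurableTypeR R => x + (t * h) *: basis_vec i).
    apply: measurable_fun_rV => j; under eq_fun do rewrite !mxE.
    by apply: measurable_funD => //; apply: measurable_funM => //; apply: measurable_funM.
  exact: (measurableT_comp mV ms).
have I1 : L1 leb (fun t => ind01 t * V (x + (t * h) *: basis_vec i)).
  apply: (L1_le m0 _ (L1Z D L1_ind01)) => t; rewrite !normrM mulrC ler_wpM2r//.
  by rewrite (le_trans (VD _))// ler_norm.
have := @avg_close (fun t => V (x + (t * h) *: basis_vec i)) 0 D I1.
by rewrite subr0; apply => t _; rewrite subr0.
Qed.

Lemma test_lipschitz Omega phi i : test_function Omega phi ->
  exists2 D, 0 <= D & forall x r, `|phi (x + r *: basis_vec i) - phi x| <= D * `|r|.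
Proof.
move=> tp; have [D D0 HD] := test_partial_bounded i tp; exists D => // x r.
rewrite (ftc_line i x r (test_smooth tp)) normrM mulrC ler_wpM2r//.
exact: seg_avg_bound (smooth_measurable (test_partial_smooth i tp)) HD.
Qed.

(** The error is at most [|V|] times
      |f (x + s e) - f x| |phi x| + C |phi (x + r e) - phi x|.
    The second summand is of order [r] because [phi] is Lipschitz; the first is
    small in [L^1] by [shift_estimate] and bounded, so that
    [uniform_integrability] applies. *)
Lemma translation_continuity Omega f Vf V phi i (C delta eps : R) :
  L1 dx f -> (forall x, `|f x| <= C) -> L1 dx Vf -> weak_partial Omega f Vf i ->
  L1 dx V -> test_function Omega phi -> 0 < delta -> supp phi `<=` inset Omega delta ->
  0 < eps -> exists2 eta, 0 < eta & forall s r, `|s| <= eta -> `|r| <= eta ->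
   `|\int[dx]_x (V x * (f (x + s *: basis_vec i) * phi (x + r *: basis_vec i)))
     - \int[dx]_x (V x * (f x * phi x))| <= eps.
Proof.
move=> f1 fC Vf1 fVf V1 tp d0 pd e0.
have C0 : 0 <= C by exact: le_trans (fC 0).
have [Cp Cp0 pC] := test_bounded tp.
have [D D0 pD] := test_lipschitz i tp.
have sp := test_smooth tp; have mp := smooth_measurable sp; have mf := L1_measurable f1.
have e1 : 0 < eps / (2 * (Cp + 1)) by rewrite divr_gt0// mulr_gt0// ltr_wpDl.
have C20 : 0 <= 2 * C by rewrite mulr_ge0.
have [M M0 HM] := uniform_integrability V1 e1 C20.
pose nV := \int[dx]_x `|V x|; pose nVf := \int[dx]_x `|Vf x|.
have nV0 : 0 <= nV by exact: Rintegral_ge0.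
have nVf0 : 0 <= nVf by exact: Rintegral_ge0.
pose Q := Cp * M * nVf + C * D * nV + 1.
have Q0 : 0 < Q by rewrite ltr_wpDl// addr_ge0// !mulr_ge0.
exists (Num.min delta (eps / (2 * Q))).
  by rewrite lt_min d0/= divr_gt0// mulr_gt0.
move=> s r; rewrite !le_min => /andP[sd sQ] /andP[_ rQ].
have mfs : measurable_fun setT (fun x : 'rV[R]_N => f (x + s *: basis_vec i)).
  exact: (measurableT_comp mf (measurable_translate _)).
have mps : measurable_fun setT (fun x : 'rV[R]_N => phi (x + r *: basis_vec i)).
  exact: (measurableT_comp mp (measurable_translate _)).
have I1 : L1 dx (fun x => V x * (f (x + s *: basis_vec i) * phi (x + r *: basis_vec i))).
  apply: (L1_mul_bounded (C := C * Cp) V1); first exact: measurable_funM.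
  by move=> x; rewrite normrM ler_pM.
have I2 : L1 dx (fun x => V x * (f x * phi x)).
  apply: (L1_mul_bounded (C := C * Cp) V1); first exact: measurable_funM.
  by move=> x; rewrite normrM ler_pM.
rewrite -RintegralB//.
apply: le_trans (le_normr_Rintegral measurableT (L1B I1 I2)) _.
pose B (x : 'rV[R]_N) := \1_(supp phi) x * `|f (x + s *: basis_vec i) - f x|.
have mB : measurable_fun setT B.
  apply: measurable_funM; first by apply: measurable_indic; exact: supp_measurable.
  by apply: measurableT_comp => //; exact: measurable_funB.
have BC x : 0 <= B x <= 2 * C.
  rewrite /B mulr_ge0//=; apply: le_trans (_ : _ <= 1 * (`|f (x + s *: basis_vec i)| + `|f x|)) _.
    by rewrite ler_pM// ?ler_normB// indicE lern1 leq_b1.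
  by rewrite mul1r mulr_natl mulr2n lerD.
have B1 : L1 dx B.
  apply: (L1_le mB _ (L1_norm (L1B (L1_translate (s *: basis_vec i) f1) f1))) => x.
  by rewrite normr_id /B normrM normr_id ler_piMl// normr_indic_le1.
have VB1 : L1 dx (fun x => `|V x| * B x).
  apply: (L1_mul_bounded (C := 2 * C) (L1_norm V1) mB) => x.
  by have /andP[h1 h2] := BC x; rewrite ger0_norm.
have intB : \int[dx]_x B x <= `|s| * nVf.
  by apply: shift_estimate fVf sd _ pd => //; exact: supp_measurable.
apply: le_trans (_ : _ <= \int[dx]_x (Cp * (`|V x| * B x) + C * D * `|r| * `|V x|)) _.
  apply: le_Rintegral => //.
  - exact: L1_norm (L1B I1 I2).
  - by apply: L1D; apply: L1Z => //; exact: L1_norm.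
  move=> x _; rewrite -mulrBr normrM.
  rewrite (_ : Cp * _ + _ = `|V x| * (Cp * B x + C * D * `|r|)); last by ring.
  apply: ler_wpM2l => //.
  rewrite (_ : f _ * _ - _ = (f (x + s *: basis_vec i) - f x) * phi x +
     f (x + s *: basis_vec i) * (phi (x + r *: basis_vec i) - phi x)); last by ring.
  apply: le_trans (ler_normD _ _) _; rewrite !normrM lerD//; last first.
    by rewrite -mulrA ler_pM.
  rewrite /B; have [Kx|nKx] := pselect (supp phi x).
    by rewrite indicE mem_set// mul1r mulrC ler_wpM2r.
  by rewrite (supp_out nKx) normr0 mulr0 mulr_ge0// mulr_ge0.
rewrite RintegralD//; [|exact: L1Z|by apply: L1Z; exact: L1_norm].
rewrite !RintegralZl//; last exact: L1_norm.
have := HM _ B1 BC => HB.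
apply: le_trans (_ : _ <= Cp * (M * (`|s| * nVf) + eps / (2 * (Cp + 1))) + C * D * `|r| * nV) _.
  rewrite lerD2r ler_wpM2l//; apply: le_trans HB _.
  by rewrite lerD2r ler_wpM2l.
apply: le_trans (_ : _ <= Cp * (M * ((eps / (2 * Q)) * nVf) + eps / (2 * (Cp + 1)))
    + C * D * (eps / (2 * Q)) * nV) _.
  apply: lerD; last by rewrite ler_wpM2r// ler_wpM2l// mulr_ge0.
  by rewrite ler_wpM2l// lerD2r ler_wpM2l// ler_wpM2r.
have H1 : Cp * (eps / (2 * (Cp + 1))) <= eps / 2.
  rewrite mulrA ler_pdivrMr ?mulr_gt0 ?ltr_wpDl//; nra.
have H2 : Cp * (M * ((eps / (2 * Q)) * nVf)) + C * D * (eps / (2 * Q)) * nV <= eps / 2.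
  rewrite (_ : _ + _ = (Cp * M * nVf + C * D * nV) * eps / (2 * Q)); last by ring.
  rewrite ler_pdivrMr ?mulr_gt0// /Q; nra.
rewrite mulrDr; lra.
Qed.

Lemma seg_avg_cvg phi i x : smooth phi ->
  seg_avg i (partial i phi) n.+1%:R^-1 x @[n --> \oo] --> partial i phi x.
Proof.
move=> sp.
have dphi : derivable phi x (basis_vec i) by have [_ /(_ i)[]] := sp 1.
have E n : seg_avg i (partial i phi) n.+1%:R^-1 x =
    (fun h : R => h^-1 *: ((phi \o shift x) (h *: basis_vec i) - phi x)) n.+1%:R^-1.
  by rewrite /= (addrC _ x) (ftc_line i x _ sp) /GRing.scale/= mulrA mulVf ?mul1r.
under eq_fun do rewrite E.
have H0 : (n.+1%:R^-1 : R) @[n --> \oo] --> (0 : R)^'.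
  move=> A /= HA.
  have H : \forall n \near \oo, (n.+1%:R^-1 : R) != 0 -> A n.+1%:R^-1 := @cvg_harmonic R _ HA.
  have {H} : \forall n \near \oo, A n.+1%:R^-1.
    by apply: filterS H => n; apply; rewrite invr_eq0 pnatr_eq0.
  by [].
pose q (h : R) := h^-1 *: ((phi \o shift x) (h *: basis_vec i) - phi x).
have H1 : q h @[h --> 0^'] --> partial i phi x by exact: dphi.
exact: (@cvg_comp _ _ _ (fun n : nat => n.+1%:R^-1 : R) q _ _ _ H0 H1).
Qed.

(** With [k = - h], discrete integration by parts moves the difference onto
    [f1 f2], and
      (f1 f2)(x + k e) - (f1 f2) x
        = f1 x (f2 (x + k e) - f2 x) + f2 (x + k e) (f1 (x + k e) - f1 x).
    By [diff_identity] each term becomes an average of [V1] or [V2] along the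
    segment; after moving the translations onto the other factors,
    [translation_continuity] gives the limit as [h] tends to 0. *)
Lemma product_rule Omega f1 V1 f2 V2 i (C1 C2 : R) : open Omega ->
  L1 dx f1 -> (forall x, `|f1 x| <= C1) -> L1 dx V1 -> weak_partial Omega f1 V1 i ->
  L1 dx f2 -> (forall x, `|f2 x| <= C2) -> L1 dx V2 -> weak_partial Omega f2 V2 i ->
  weak_partial Omega (fun x => f1 x * f2 x) (fun x => f1 x * V2 x + f2 x * V1 x) i.
Proof.
move=> oO f11 fC1 V11 fV1 f21 fC2 V21 fV2 phi tp.
have sp := test_smooth tp; have mp := smooth_measurable sp.
have mf1 := L1_measurable f11; have mf2 := L1_measurable f21.
have [Cp Cp0 pC] := test_bounded tp.
have [D D0 pD] := test_partial_bounded i tp.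
have [delta d0 pd] := supp_sub_inset oO tp.
have F1 : L1 dx (fun x => f1 x * f2 x) by exact: L1_mul_bounded mf2 fC2.
have p11 := test_partial_L1 i tp.
have p1C x : `|f1 x * phi x| <= C1 * Cp by rewrite normrM ler_pM.
have p2C x : `|f2 x * phi x| <= C2 * Cp by rewrite normrM ler_pM.
have mp1 : measurable_fun setT (fun x => f1 x * phi x) by exact: measurable_funM.
have mp2 : measurable_fun setT (fun x => f2 x * phi x) by exact: measurable_funM.
pose c := \int[dx]_x (V2 x * (f1 x * phi x)) + \int[dx]_x (V1 x * (f2 x * phi x)).
have -> : \int[dx]_x ((f1 x * V2 x + f2 x * V1 x) * phi x) = c.
  rewrite /c -RintegralD//; [|exact: L1_mul_bounded p1C|exact: L1_mul_bounded p2C].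
  by apply: eq_Rintegral => x _; ring.
have L : \int[dx]_x (f1 x * f2 x * seg_avg i (partial i phi) n.+1%:R^-1 x) @[n --> \oo] -->
    \int[dx]_x (f1 x * f2 x * partial i phi x).
  have [D' D'0 pL] := test_lipschitz i tp.
  apply: (@Rintegral_dominated_cvg _ _ _ _ (fun n x => f1 x * f2 x * seg_avg i (partial i phi) n.+1%:R^-1 x) _
     (fun x => D' * `|f1 x * f2 x|)).
  - move=> n; apply: measurable_funM; first exact: L1_measurable F1.
    exact: L1_measurable (seg_avg_L1 i _ p11).
  - by move=> x; apply: cvgMr; exact: seg_avg_cvg.
  - by apply: L1Z; exact: L1_norm.
  - move=> n x; rewrite normrM mulrC ler_wpM2r//.
    have n0 : (0 : R) < n.+1%:R^-1 by rewrite invr_gt0 ltr0n.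
    have := pL x n.+1%:R^-1; rewrite (ftc_line i x _ sp) normrM mulrC (gtr0_norm n0).
    by rewrite ler_pM2r.
suff : \int[dx]_x (f1 x * f2 x * seg_avg i (partial i phi) n.+1%:R^-1 x) @[n --> \oo] --> - c.
  by move=> L'; rewrite -(cvg_lim (@Rhausdorff R) L) -(cvg_lim (@Rhausdorff R) L').
(* both sides of the limit split into the [V2] and the [V1] contributions *)
apply/cvgrPdist_le => eps e0.
have e20 : 0 < eps / 2 by rewrite divr_gt0.
have [eta1 eta10 H1] := translation_continuity f11 fC1 V11 fV1 V21 tp d0 pd e20.
have [eta2 eta20 H2] := translation_continuity f21 fC2 V21 fV2 V11 tp d0 pd e20.
have small e : 0 < e -> \forall n \near \oo, (n.+1%:R^-1 : R) <= e.
  by move=> e0'; have := near_infty_natSinv_lt (PosNum e0'); apply: filterS => n /ltW.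
near=> n.
have [hd h1 h2] : [/\ (n.+1%:R^-1 : R) <= delta, (n.+1%:R^-1 : R) <= eta1
    & (n.+1%:R^-1 : R) <= eta2].
  by split; near: n; exact: small.
pose h : R := n.+1%:R^-1; pose k := - h.
have h0 : 0 < h by rewrite invr_gt0 ltr0n.
have kh : `|k| = h by rewrite normrN gtr0_norm.
pose T1 (t : R) := \int[dx]_x (V2 (x + (t * k) *: basis_vec i) * (f1 x * phi x)).
pose T2 (t : R) := \int[dx]_x (V1 (x + (t * k) *: basis_vec i) *
  (f2 (x + k *: basis_vec i) * phi x)).
have mf2k : measurable_fun setT (fun x : 'rV[R]_N => f2 (x + k *: basis_vec i)).
  exact: (measurableT_comp mf2 (measurable_translate _)).
have mp2k : measurable_fun setT (fun x : 'rV[R]_N => f2 (x + k *: basis_vec i) * phi x).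
  exact: measurable_funM.
have p2kC x : `|f2 (x + k *: basis_vec i) * phi x| <= C2 * Cp by rewrite normrM ler_pM.
have a2 := seg_avg_L1 i k V21; have a1 := seg_avg_L1 i k V11.
have S1 : L1 dx (fun x => seg_avg i V2 k x * (f1 x * phi x)) by exact: L1_mul_bounded p1C.
have S2 : L1 dx (fun x => seg_avg i V1 k x * (f2 (x + k *: basis_vec i) * phi x)).
  exact: L1_mul_bounded p2kC.
have E1 : h * \int[dx]_x (f1 x * f2 x * seg_avg i (partial i phi) h x) =
    k * (\int[leb]_t (ind01 t * T1 t) + \int[leb]_t (ind01 t * T2 t)).
  rewrite -RintegralZl//; last first.
    apply: (L1_le _ _ (L1Z D (L1_norm F1))).
      apply: measurable_funM; first exact: L1_measurable F1.
      exact: L1_measurable (seg_avg_L1 i _ p11).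
    move=> x; rewrite normrM [leRHS]normrM normr_id mulrC ler_wpM2r//.
    rewrite (le_trans _ (ler_norm D))//.
    exact: seg_avg_bound (smooth_measurable (test_partial_smooth i tp)) pD.
  transitivity (\int[dx]_x (f1 x * f2 x * (phi (x + (- k) *: basis_vec i) - phi x))).
    by apply: eq_Rintegral => x _; rewrite (ftc_line i x _ sp) opprK mulrCA.
  rewrite -(int_shift_diff i k F1 mp pC) -(seg_swap i k V21 mp1 p1C) -(seg_swap i k V11 mp2k p2kC).
  rewrite -RintegralD// -RintegralZl//; last exact: L1D.
  apply: ae_Rintegral.
  - apply: measurable_funM => //; apply: measurable_funB; last exact: L1_measurable F1.
    exact: L1_measurable (L1_translate (k *: basis_vec i) F1).
  - by apply: measurable_funM => //; exact: L1_measurable (L1D S1 S2).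
  - have kd : `|k| <= delta by rewrite kh.
    have := diff_identity f11 fC1 V11 fV1 kd; have := diff_identity f21 fC2 V21 fV2 kd.
    apply: filterS2 => x G2 G1.
    have [Kx|nKx] := pselect (supp phi x); last by rewrite (supp_out nKx); ring.
    have {}G2 := G2 (pd _ Kx); have {}G1 := G1 (pd _ Kx).
    rewrite (_ : _ * _ - _ = f1 x * (f2 (x + k *: basis_vec i) - f2 x) +
      f2 (x + k *: basis_vec i) * (f1 (x + k *: basis_vec i) - f1 x)); last by ring.
    by rewrite G1 G2; ring.
have -> : \int[dx]_x (f1 x * f2 x * seg_avg i (partial i phi) n.+1%:R^-1 x) =
   - (\int[leb]_t (ind01 t * T1 t) + \int[leb]_t (ind01 t * T2 t)).
  apply: (mulfI (lt0r_neq0 h0)); rewrite -/h E1 /k; ring.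
rewrite opprK /c addrC opprD addrACA (splitr eps).
apply: le_trans (ler_normD _ _) _; apply: lerD.
- apply: avg_close; first exact: seg_inner_integral_L1 p1C.
  move=> t /andP[t0 t1].
  have I3 : L1 dx (fun x => V2 x *
      (f1 (x + (- (t * k)) *: basis_vec i) * phi (x + (- (t * k)) *: basis_vec i))).
    apply: (L1_mul_bounded (C := C1 * Cp) V21).
      exact: (measurableT_comp mp1 (measurable_translate _)).
    by move=> x; rewrite normrM ler_pM.
  have tk : `|- (t * k)| <= eta1.
    by rewrite normrN normrM kh (le_trans _ h1)// ger0_norm// ler_piMl// ltW.
  have := H1 _ _ tk tk; rewrite -(Rintegral_translate ((t * k) *: basis_vec i) I3).
  rewrite (_ : \int[dx]_x _ = T1 t)//; apply: eq_Rintegral => x _.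
  by rewrite scaleNr addrK.
- apply: avg_close; first exact: seg_inner_integral_L1 p2kC.
  move=> t /andP[t0 t1].
  have I3 : L1 dx (fun x => V1 x *
      (f2 (x + (k - t * k) *: basis_vec i) * phi (x + (- (t * k)) *: basis_vec i))).
    apply: (L1_mul_bounded (C := C2 * Cp) V11).
      apply: measurable_funM.
        exact: (measurableT_comp mf2 (measurable_translate _)).
      exact: (measurableT_comp mp (measurable_translate _)).
    by move=> x; rewrite normrM ler_pM.
  have tk : `|- (t * k)| <= eta2.
    by rewrite normrN normrM kh (le_trans _ h2)// ger0_norm// ler_piMl// ltW.
  have tk' : `|k - t * k| <= eta2.
    rewrite (_ : k - t * k = (1 - t) * k); last by ring.
    by rewrite normrM kh (le_trans _ h2)// ger0_norm ?subr_ge0// ler_piMl ?(ltW h0)// gerBl.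
  have := H2 _ _ tk' tk; rewrite -(Rintegral_translate ((t * k) *: basis_vec i) I3).
  rewrite (_ : \int[dx]_x _ = T2 t)//; apply: eq_Rintegral => x _.
  rewrite scaleNr addrK -addrA -scalerDl (_ : t * k + (k - t * k) = k)//; last by ring.
Unshelve. all: by end_near. Qed.

End product_rule.

(** * Sobolev functions on an open set of finite measure *)
Section sobolev.
Context {R : realType} {N : nat}.
Local Notation dx := (lebesgue_rV R N).
Implicit Types (u w phi : 'rV[R]_N -> R) (Du Dw : 'rV[R]_N -> 'rV[R]_N) (i : 'I_N).
Variable Omega : set 'rV[R]_N.
Hypothesis oO : open Omega.
Hypothesis Ofin : (dx Omega < +oo)%E.

Let mO : measurable Omega. Proof. exact: open_measurable_rV. Qed.

Definition bounded_on u : Prop := exists C : R, forall x, Omega x -> `|u x| <= C.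

Lemma bounded_onW u : bounded_on u -> [bounded u x | x in Omega].
Proof.
move=> [C uC]; exists C; split; first exact: num_real.
by move=> M CM x Ox; exact: le_trans (uC x Ox) (ltW CM).
Qed.

Lemma bounded_integrable u : measurable_fun Omega u -> bounded_on u ->
  dx.-integrable Omega (EFin \o u).
Proof.
by move=> mu bu; apply: measurable_bounded_integrable => //; exact: bounded_onW.
Qed.

Lemma test_out phi x : test_function Omega phi -> ~ Omega x -> phi x = 0.
Proof.
by move=> [_ _ pO] nOx; apply: supp_out => /pO.
Qed.

Lemma partial_out phi i x : test_function Omega phi -> ~ Omega x -> partial i phi x = 0.
Proof.
move=> [_ _ pO] nOx; apply: (@partial_eq0 _ _ _ _ (supp phi)).
- exact: closed_closure.
- exact: supp_out.
- by move=> /pO.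
Qed.

Lemma int_restrict u phi : (forall x, ~ Omega x -> phi x = 0) ->
  \int[dx]_(x in Omega) (u x * phi x) = \int[dx]_x ((u \_ Omega) x * phi x).
Proof.
move=> p0; rewrite Rintegral_mkcond; apply: eq_Rintegral => x _.
rewrite !patchE; case: ifPn => // /negP nO.
by rewrite mul0r.
Qed.

(** The bridge between integrals over [Omega] and integrals over the whole
    space. *)
Lemma weak_gradient_partialP u Du : weak_gradient Omega u Du <->
  forall i, weak_partial Omega (u \_ Omega) ((fun x => Du x ord0 i) \_ Omega) i.
Proof.
split => [H i phi tp|H phi tp i].
  rewrite -int_restrict; last by move=> x; exact: partial_out.
  rewrite -int_restrict; last by move=> x; exact: test_out.
  exact: H.
have := H i phi tp.
rewrite -int_restrict; last by move=> x; exact: partial_out.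
by rewrite -int_restrict//; move=> x; exact: test_out.
Qed.

Lemma restrict_L1 u : dx.-integrable Omega (EFin \o u) -> L1 dx (u \_ Omega).
Proof.
move=> /(integrable_mkcond _ mO).1; apply: eq_integrable => // x _.
by rewrite /= restrict_EFin.
Qed.

Lemma restrict_bnd u (C : R) : 0 <= C -> (forall x, Omega x -> `|u x| <= C) ->
  forall x, `|(u \_ Omega) x| <= C.
Proof.
move=> C0 uC x; rewrite patchE; case: ifPn => [/set_mem/uC//|_].
by rewrite normr0.
Qed.

Lemma weak_gradient_mul u Du w Dw :
  measurable_fun Omega u -> bounded_on u ->
  (forall i, dx.-integrable Omega (EFin \o (fun x => Du x ord0 i))) ->
  measurable_fun Omega w -> bounded_on w ->
  (forall i, dx.-integrable Omega (EFin \o (fun x => Dw x ord0 i))) ->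
  weak_gradient Omega u Du -> weak_gradient Omega w Dw ->
  weak_gradient Omega (fun x => u x * w x) (fun x => u x *: Dw x + w x *: Du x).
Proof.
move=> mu bu iDu mw bw iDw /weak_gradient_partialP Hu /weak_gradient_partialP Hw; apply/weak_gradient_partialP => i.
have u1 := restrict_L1 (bounded_integrable mu bu).
have w1 := restrict_L1 (bounded_integrable mw bw).
have Du1 := restrict_L1 (iDu i); have Dw1 := restrict_L1 (iDw i).
have [Cu uC] := bu; have [Cw wC] := bw.
have C0 (C : R) : 0 <= `|C| by [].
have uC' x : Omega x -> `|u x| <= `|Cu| by move=> /uC h; rewrite (le_trans h)// ler_norm.
have wC' x : Omega x -> `|w x| <= `|Cw| by move=> /wC h; rewrite (le_trans h)// ler_norm.
have := product_rule oO u1 (restrict_bnd (C0 _) uC') Du1 (Hu i)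
   w1 (restrict_bnd (C0 _) wC') Dw1 (Hw i).
congr (weak_partial Omega _ _ i); apply/funext => x; rewrite !patchE; case: ifPn => // _.
- by rewrite mul0r.
- by rewrite !mxE.
- by rewrite !mul0r addr0.
Qed.

(** A test function has zero integral of its partial derivatives. *)
Lemma weak_gradient_cst (c : R) : weak_gradient Omega (cst c) (cst 0).
Proof.
move=> phi tp i.
have -> : \int[dx]_(x in Omega) (cst c x * partial i phi x) = c * \int[dx]_x partial i phi x.
  rewrite -RintegralZl//; last exact: test_partial_L1 tp.
  rewrite Rintegral_mkcond; apply: eq_Rintegral => x _; rewrite patchE; case: ifPn => //.
  by move=> /negP; rewrite inE => nO; rewrite (partial_out _ tp nO) mulr0.
rewrite (int_partial0 i tp) mulr0; apply/esym/eqP; rewrite oppr_eq0; apply/eqP.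
under eq_Rintegral do rewrite mxE mul0r.
by rewrite Rintegral_cst// mul0r.
Qed.

Lemma weak_gradient_affine u Du (c s : R) :
  dx.-integrable Omega (EFin \o u) ->
  (forall i, dx.-integrable Omega (EFin \o (fun x => Du x ord0 i))) ->
  weak_gradient Omega u Du ->
  weak_gradient Omega (fun x => c + s * u x) (fun x => s *: Du x).
Proof.
move=> iu iDu Hu phi tp i.
have sp := test_smooth tp.
have mp : measurable_fun Omega phi by apply: measurable_funTS; exact: smooth_measurable.
have mdp : measurable_fun Omega (partial i phi).
  by apply: measurable_funTS; apply: smooth_measurable; exact: test_partial_smooth tp.
have bp : [bounded phi x | x in Omega].
  by apply: bounded_onW; have [C _ pC] := test_bounded tp; exists C.
have bdp : [bounded partial i phi x | x in Omega].
  by apply: bounded_onW; have [C _ pC] := test_partial_bounded i tp; exists C.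
have I1 : dx.-integrable Omega (EFin \o (fun x => u x * partial i phi x)).
  exact: (integrableMl mO iu mdp bdp).
have I2 : dx.-integrable Omega (EFin \o (fun x => Du x ord0 i * phi x)).
  exact: (integrableMl mO (iDu i) mp bp).
have I3 : dx.-integrable Omega (EFin \o (fun x => cst c x * partial i phi x)).
  have ic : dx.-integrable Omega (EFin \o cst c).
    by apply: bounded_integrable => //; exists `|c|.
  exact: (integrableMl mO ic mdp bdp).
have I4 : dx.-integrable Omega (EFin \o (fun x => s * (u x * partial i phi x))).
  exact: (integrableZl mO s I1).
transitivity (\int[dx]_(x in Omega) (cst c x * partial i phi x) +
    s * \int[dx]_(x in Omega) (u x * partial i phi x)).
  by rewrite -RintegralZl// -RintegralD//; apply: eq_Rintegral => x _ /=; ring.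
rewrite (weak_gradient_cst c tp i) (Hu _ tp i) [X in - X + _](_ : _ = 0); last first.
  under eq_Rintegral do rewrite mxE mul0r.
  by rewrite Rintegral_cst// mul0r.
rewrite oppr0 add0r mulrN; congr (- _); rewrite -RintegralZl//.
by apply: eq_Rintegral => x _; rewrite mxE mulrA.
Qed.

(** On a set of finite measure, [|u| <= 1 + |u|^p]. *)
Lemma Lp_integrable p u : 1 <= p -> Lp Omega p u -> dx.-integrable Omega (EFin \o u).
Proof.
move=> p1 [mu iu].
have i1 : dx.-integrable Omega (EFin \o (fun x => 1 + `|u x| `^ p)).
  have c1 : dx.-integrable Omega (EFin \o (cst (1 : R))).
    by apply: bounded_integrable => //; exists 1 => x _; rewrite normr1.
  exact: (integrableD mO c1 iu).
apply: (le_integrable mO _ _ i1); first exact/measurable_EFinP.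
move=> x _ /=; rewrite lee_fin [leRHS]ger0_norm ?addr_ge0// ?powR_ge0//.
have [u1|u1] := leP `|u x| 1; first by rewrite (le_trans u1)// lerDl powR_ge0.
apply: (le_trans (_ : _ <= `|u x| `^ p)); last by rewrite lerDr.
by rewrite -[leLHS]powRr1// ler_powR// ltW.
Qed.

Lemma measurable_powR_norm p u : measurable_fun Omega u ->
  measurable_fun Omega (fun x => `|u x| `^ p).
Proof.
move=> mu; apply: (measurableT_comp (measurable_powR p)).
exact: measurableT_comp.
Qed.

Lemma bounded_Lp p u : 0 <= p -> measurable_fun Omega u -> bounded_on u -> Lp Omega p u.
Proof.
move=> p0 mu [C uC]; split => //; apply: bounded_integrable; first exact: measurable_powR_norm.
exists (`|C| `^ p) => x Ox; rewrite ger0_norm ?powR_ge0//.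
by apply: ge0_ler_powR; rewrite ?nnegrE// (le_trans (uC x Ox))// ler_norm.
Qed.

Lemma bounded_mul_Lp p h u : 0 <= p -> measurable_fun Omega h -> bounded_on h ->
  Lp Omega p u -> Lp Omega p (fun x => h x * u x).
Proof.
move=> p0 mh [C hC] [mu iu]; have mhu : measurable_fun Omega (fun x => h x * u x).
  exact: measurable_funM.
split => //.
have iC := integrableZl mO (`|C| `^ p) iu.
apply: (le_integrable mO _ _ iC).
  by apply/measurable_EFinP; exact: measurable_powR_norm.
move=> x Ox; rewrite /= lee_fin [leLHS]ger0_norm ?powR_ge0// [leRHS]ger0_norm ?mulr_ge0 ?powR_ge0//.
rewrite normrM powRM// ler_wpM2r ?powR_ge0//.
by apply: ge0_ler_powR; rewrite ?nnegrE// (le_trans (hC x Ox))// ler_norm.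
Qed.

(** Induction on [n] with the Leibniz rule for [w * w^n]; for [n = 0] the factor
    [n%:R] makes the value of [w^(n.-1)] immaterial. *)
Lemma W1p_pow p w Dw n : 1 <= p -> W1p Omega p w Dw -> bounded_on w ->
  W1p Omega p (fun x => w x ^+ n) (fun x => (n%:R * w x ^+ n.-1) *: Dw x).
Proof.
move=> p1 [Lw LDw Hw] bw.
have p0 : 0 <= p by rewrite (le_trans _ p1).
have mw : measurable_fun Omega w by case: Lw.
have bwn m : bounded_on (fun x => w x ^+ m).
  have [C wC] := bw; exists (C ^+ m) => x Ox; rewrite normrX.
  by rewrite lerXn2r ?nnegrE ?(le_trans _ (wC x Ox)) ?wC.
have mwn m : measurable_fun Omega (fun x => w x ^+ m) by exact: measurable_funX.
have bnw m : bounded_on (fun x => m%:R * w x ^+ m.-1).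
  have [C wC] := bwn m.-1; exists (m%:R * C) => x Ox; rewrite normrM normr_nat.
  by rewrite ler_wpM2l// wC.
have LD m i : Lp Omega p (fun x => ((m%:R * w x ^+ m.-1) *: Dw x) ord0 i).
  rewrite (_ : (fun x => _) = fun x => (m%:R * w x ^+ m.-1) * Dw x ord0 i); last first.
    by apply/funext => x; rewrite mxE.
  by apply: bounded_mul_Lp => //; exact: measurable_funM.
split => //; first exact: bounded_Lp.
elim: n => [|n IH].
  have := weak_gradient_cst 1.
  rewrite (_ : (fun x => w x ^+ 0) = cst 1); last by apply/funext => x; rewrite expr0.
  rewrite (_ : (fun x => _ *: _) = cst 0)//.
  by apply/funext => x; rewrite mul0r scale0r.
have ID m i := Lp_integrable p1 (LD m i).
have IDw i := Lp_integrable p1 (LDw i).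
have := weak_gradient_mul mw bw IDw (mwn n) (bwn n) (ID n) Hw IH.
rewrite (_ : (fun x => w x * w x ^+ n) = (fun x => w x ^+ n.+1)); last first.
  by apply/funext => x; rewrite exprS.
congr weak_gradient; apply/funext => x; rewrite scalerA -scalerDl; congr (_ *: _).
rewrite mulrCA -natr1 mulrDl mul1r /=; congr (_ + _).
by case: n {IH} => [|n]; rewrite ?mul0r// -exprS.
Qed.

Lemma W1p_affine p u Du (c s : R) : 1 <= p -> W1p Omega p u Du -> bounded_on u ->
  W1p Omega p (fun x => c + s * u x) (fun x => s *: Du x).
Proof.
move=> p1 [Lu LDu Hu] [C uC]; have p0 : 0 <= p by rewrite (le_trans _ p1).
have mu : measurable_fun Omega u by case: Lu.
split.
- apply: bounded_Lp => //; first by apply: measurable_funD => //; exact: measurable_funM.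
  exists (`|c| + `|s| * C) => x Ox; rewrite (le_trans (ler_normD _ _))// lerD2l normrM.
  by rewrite ler_wpM2l// uC.
- move=> i; rewrite (_ : (fun x => _) = fun x => cst s x * Du x ord0 i); last first.
    by apply/funext => x; rewrite mxE.
  by apply: bounded_mul_Lp => //; exists `|s|.
- apply: weak_gradient_affine => //; first exact: Lp_integrable p1 Lu.
  by move=> i; exact: Lp_integrable p1 (LDu i).
Qed.

Lemma ae_int_eq u w : measurable_fun Omega u -> measurable_fun Omega w ->
  {ae dx, forall x, Omega x -> u x = w x} ->
  \int[dx]_(x in Omega) u x = \int[dx]_(x in Omega) w x.
Proof.
move=> mu mw uw; congr fine; apply: ae_eq_integral => //.
- exact/measurable_EFinP.
- exact/measurable_EFinP.
- by apply: filterS uw => x H Ox; rewrite /= H.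
Qed.

(** Membership in the Sobolev space only depends on the class modulo null sets;
    this replaces a solution by a representative that is bounded everywhere. *)
Lemma W1p_ae p u w Du : 1 <= p -> W1p Omega p u Du -> measurable_fun Omega w ->
  bounded_on w -> {ae dx, forall x, Omega x -> u x = w x} -> W1p Omega p w Du.
Proof.
move=> p1 [Lu LDu Hu] mw bw uw; split => //.
  by apply: bounded_Lp => //; rewrite (le_trans _ p1).
move=> phi tp i; rewrite -(Hu phi tp i).
have mdp : measurable_fun Omega (partial i phi).
  by apply: measurable_funTS; apply: smooth_measurable; exact: test_partial_smooth tp.
apply: ae_int_eq.
- exact: measurable_funM.
- by apply: measurable_funM => //; case: Lu.
- by apply: filterS uw => x H Ox; rewrite H.
Qed.

Lemma W1p_cst p (c : R) : 0 <= p -> W1p Omega p (cst c) (cst 0).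
Proof.
move=> p0; split; last exact: weak_gradient_cst.
- by apply: bounded_Lp => //; exists `|c|.
- move=> i; rewrite (_ : (fun x => _) = cst 0); last by apply/funext => x; rewrite mxE.
  by apply: bounded_Lp => //; exists 0 => x _; rewrite normr0.
Qed.

End sobolev.

(** * Comparison with constants *)
Section powers.
Context {R : realType}.
Implicit Types (a b c d s t p : R).

Lemma powR_norm_mul p s : 0 < s -> `|s| `^ (p - 2) * s = s `^ (p - 1).
Proof.
move=> s0; rewrite gtr0_norm// -[X in _ * X](powRr1 (ltW s0)) -powRD.
  by congr (_ `^ _); lra.
by apply/implyP => _; rewrite gt_eqF.
Qed.

(** The left side minus the self-interaction term of an equation: a constant [c]
    solves it exactly when this quantity equals the power of the other unknown.
    For [a < 0 < p - 1] it is increasing in [s]. *)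
Definition net_power p a s : R := s `^ (p - 1) - s `^ a.

Lemma powR_neg_le a s t : a < 0 -> 0 < s -> s <= t -> t `^ a <= s `^ a.
Proof.
move=> a0 s0 st; have t0 : 0 < t by exact: lt_le_trans st.
rewrite -(opprK a) powRN [leRHS]powRN lef_pV2 ?posrE ?powR_gt0//.
apply: ge0_ler_powR; rewrite ?nnegrE ?oppr_ge0; by [exact: ltW|].
Qed.

Lemma net_power_lt p a s t : 1 < p -> a < 0 -> 0 < s -> s < t -> net_power p a s < net_power p a t.
Proof.
move=> p1 a0 s0 st; rewrite /net_power.
have t0 : 0 < t by exact: lt_trans st.
have H1 : s `^ (p - 1) < t `^ (p - 1).
  by apply: gt0_ltr_powR; rewrite ?nnegrE ?subr_gt0// ltW.
have H2 := powR_neg_le a0 s0 (ltW st).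
lra.
Qed.

Lemma net_power_le p a s t : 1 < p -> a < 0 -> 0 < s -> s <= t -> net_power p a s <= net_power p a t.
Proof.
move=> p1 a0 s0; rewrite le_eqVlt => /orP[/eqP->//|st].
exact/ltW/net_power_lt.
Qed.

Lemma powR_mul_expR c t a : 0 < c -> (c * expR t) `^ a = c `^ a * expR (t * a).
Proof. by move=> c0; rewrite powRM ?expR_ge0 ?(ltW c0)// expRM. Qed.

(** Scaling [s] up multiplies the leading power by the full factor and decreases
    the negative power, so that the difference grows at least as fast as the
    leading power. *)
Lemma net_power_scale_up p a c t : 1 < p -> a < 0 -> 0 < c -> 0 <= t ->
  expR (t * (p - 1)) * net_power p a c <= net_power p a (c * expR t).
Proof.
move=> p1 a0 c0 t0; rewrite /net_power !powR_mul_expR//.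
have H : expR (t * a) <= expR (t * (p - 1)) by rewrite ler_expR; nra.
have := powR_gt0 a c0 => ca; nra.
Qed.

Lemma net_power_scale_down p a c t : 1 < p -> a < 0 -> 0 < c -> 0 <= t ->
  net_power p a (c * expR (- t)) <= expR (- t * (p - 1)) * net_power p a c.
Proof.
move=> p1 a0 c0 t0; rewrite /net_power !powR_mul_expR//.
have H : expR (- t * (p - 1)) <= expR (- t * a) by rewrite ler_expR; nra.
have := powR_gt0 a c0 => ca; nra.
Qed.

End powers.

Section comparison.
Context {R : realType} {N : nat}.
Local Notation dx := (lebesgue_rV R N).
Implicit Types (u v w g f phi : 'rV[R]_N -> R) (Du Dw : 'rV[R]_N -> 'rV[R]_N) (i : 'I_N).
Variable Omega : set 'rV[R]_N.
Hypothesis oO : open Omega.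
Hypothesis Ofin : (dx Omega < +oo)%E.

Let mO : measurable Omega. Proof. exact: open_measurable_rV. Qed.

(** Where [w >= K'] the integrand is at least [delta K'^n], and elsewhere it is at
    least [- C K^n]. The integrals being nonpositive, the measure of
    [w >= K'] is at most a constant times [(K / K')^n] for every [n]. *)
Lemma ae_lt_of_power_tests w g (K K' delta C M : R) :
  measurable_fun Omega w -> measurable_fun Omega g ->
  (forall x, Omega x -> 0 <= w x <= M) -> (forall x, Omega x -> `|g x| <= C) ->
  0 <= K -> K < K' -> 0 < delta ->
  (forall x, Omega x -> K <= w x -> 0 <= g x) ->
  (forall x, Omega x -> K' <= w x -> delta <= g x) ->
  (forall n, \int[dx]_(x in Omega) (g x * w x ^+ n) <= 0) ->
  {ae dx, forall x, Omega x -> w x < K'}.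
Proof.
move=> mw mg wM gC K0 KK' d0 g0 gd Hn.
have K'0 : 0 < K' by exact: le_lt_trans KK'.
pose A := Omega `&` w @^-1` `[K', +oo[%classic.
have mA : measurable A by apply: mw => //; exact: measurable_itv.
have Aoo : (dx A < +oo)%E.
  by apply: le_lt_trans Ofin; apply: le_measure; rewrite ?inE//; apply: subIsetl.
have AE x : Omega x -> \1_A x = (if K' <= w x then 1 else 0 : R).
  move=> Ox; rewrite indicE; case: ifPn => [h|/negP h].
    by rewrite mem_set//; split => //=; rewrite in_itv/= andbT.
  by rewrite memNset// => -[_]; rewrite /= in_itv/= andbT.
pose m := fine (dx A); pose mu := fine (dx Omega).
have mu0 : 0 <= mu by exact: fine_ge0.
have m0 : 0 <= m by exact: fine_ge0.
have key n : m <= (C * mu / delta) * (K / K') ^+ n.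
  have mI : measurable_fun Omega (\1_A : 'rV[R]_N -> R).
    by apply: measurable_funTS; exact: measurable_indic.
  have iA : dx.-integrable Omega (EFin \o (fun x => delta * K' ^+ n * \1_A x)).
    apply: bounded_integrable => //; first exact: measurable_funM.
    have dK0 : 0 <= delta * K' ^+ n by apply: mulr_ge0; [exact: ltW|rewrite exprn_ge0// ltW].
    exists (delta * K' ^+ n) => x Ox; rewrite normrM (ger0_norm dK0).
    by rewrite ler_piMr// normr_indic_le1.
  have ic : dx.-integrable Omega (EFin \o cst (C * K ^+ n)).
    by apply: bounded_integrable => //; exists `|C * K ^+ n|.
  have ig : dx.-integrable Omega (EFin \o (fun x => g x * w x ^+ n)).
    apply: bounded_integrable => //.
      by apply: measurable_funM => //; exact: measurable_funX.
    exists (C * M ^+ n) => x Ox; have /andP[w0 wM'] := wM x Ox.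
    rewrite normrM ler_pM// ?gC// ger0_norm ?exprn_ge0//.
    by rewrite lerXn2r ?nnegrE// (le_trans w0).
  have : \int[dx]_(x in Omega) (delta * K' ^+ n * \1_A x - cst (C * K ^+ n) x) <= 0.
    apply: le_trans (Hn n); apply: le_Rintegral => //; first exact: (integrableB mO iA ic).
    move=> x Ox; have /andP[w0 wM'] := wM x Ox; have := gC x Ox; rewrite ler_norml => /andP[gC1 _].
    have C0 : 0 <= C by exact: le_trans (gC x Ox).
    have Kn0 : 0 <= K ^+ n by rewrite exprn_ge0.
    have wn0 : 0 <= w x ^+ n by rewrite exprn_ge0.
    rewrite (AE x Ox) /=; have [h1|h1] := leP K' (w x).
      rewrite mulr1; have := gd x Ox h1 => h2.
      have : K' ^+ n <= w x ^+ n by rewrite lerXn2r ?nnegrE// ltW.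
      have K'n : 0 <= K' ^+ n by rewrite exprn_ge0 ?ltW.
      nra.
    rewrite mulr0 sub0r; have [h2|h2] := leP K (w x).
      have := g0 x Ox h2; nra.
    have : w x ^+ n <= K ^+ n by rewrite lerXn2r ?nnegrE// ltW.
    nra.
  rewrite RintegralB// RintegralZl//; last first.
    by apply: bounded_integrable => //; exists 1 => x _; exact: normr_indic_le1.
  rewrite Rintegral_cst// (_ : \int[dx]_(x in Omega) \1_A x = m); last first.
    rewrite /Rintegral integral_indic// /m; congr (fine (dx _)).
    by apply/setIidPl; apply: subIsetl.
  rewrite -/mu subr_le0 => H.
  rewrite expr_div_n mulrACA -invfM ler_pdivlMr ?mulr_gt0 ?exprn_gt0//.
  by rewrite mulrC (le_trans H)// mulrAC.
have ml : m <= 0.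
  have L : (C * mu / delta) * (K / K') ^+ n @[n --> \oo] --> (C * mu / delta) * 0.
    apply: cvgMr; apply: cvg_expr; rewrite ger0_norm; last by rewrite divr_ge0// ltW.
    by rewrite ltr_pdivrMr// mul1r.
  rewrite -(mulr0 (C * mu / delta)) -(cvg_lim (@Rhausdorff R) L).
  apply: limr_ge; first by apply/cvg_ex; eexists; exact: L.
  exact: nearW.
have A0 : dx A = 0%E.
  have /fineK <- : dx A \is a fin_num by rewrite ge0_fin_numE.
  by rewrite -/m; congr EFin; apply/le_anti; rewrite ml m0.
exists A; split => // x /= /not_implyP[Ox /negP]; rewrite -leNgt => h.
by split => //=; rewrite in_itv/= andbT.
Qed.

Lemma ae_le_lim w (K e : R) : (forall n, {ae dx, forall x, Omega x -> w x < K + e / n.+2%:R}) ->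
  {ae dx, forall x, Omega x -> w x <= K}.
Proof.
move=> H.
have := ae_foralln H.
apply: filterS => x Hx Ox.
have L : K + e / n.+2%:R @[n --> \oo] --> K.
  rewrite -[X in _ --> X]addr0; apply: cvgD; first exact: cvg_cst.
  rewrite -[X in _ --> X](mulr0 e); apply: cvgMr.
  have := @cvg_harmonic R; rewrite -(@cvg_shiftS R).
  exact.
rewrite -(cvg_lim (@Rhausdorff R) L).
apply: limr_ge; first by apply/cvg_ex; eexists; exact: L.
by apply: nearW => n; exact/ltW/Hx.
Qed.

Lemma dotvZr (x y : 'rV[R]_N) (a : R) : dotv x (a *: y) = a * dotv x y.
Proof.
by rewrite /dotv mulr_sumr; apply: eq_bigr => i _; rewrite mxE mulrCA.
Qed.

Lemma dotv_ge0 (x : 'rV[R]_N) : 0 <= dotv x x.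
Proof. by apply: sumr_ge0 => i _; rewrite -expr2 sqr_ge0. Qed.

(** Test the equation with [phi = s (c + s u)^n]. Its gradient is
    [n (c + s u)^(n-1)] times that of [u], because [s * s = 1], and the
    gradient term is nonnegative. The sign [s = 1] serves for upper bounds and
    [s = - 1] for lower bounds. *)
Lemma power_test_inequality p u f uc fc (c s : R) : 1 < p -> neumann_solution Omega p f u ->
  measurable_fun Omega uc -> bounded_on Omega uc -> (forall x, Omega x -> 0 < uc x) ->
  {ae dx, forall x, Omega x -> u x = uc x} ->
  measurable_fun Omega fc -> bounded_on Omega fc ->
  {ae dx, forall x, Omega x -> f x = fc x} ->
  s * s = 1 -> (forall x, Omega x -> 0 <= c + s * uc x) ->
  forall n, \int[dx]_(x in Omega) ((s * (uc x `^ (p - 1) - fc x)) * (c + s * uc x) ^+ n) <= 0.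
Proof.
move=> p1 [Du [uW Hsol]] muc buc uc0 uuc mfc bfc ffc ss w0 n.
have p1' := ltW p1; have p0 : 0 <= p by rewrite (le_trans _ p1').
have ucW := W1p_ae oO Ofin p1' uW muc buc uuc.
pose w x := c + s * uc x.
have mw : measurable_fun Omega w.
  by apply: measurable_funD => //; exact: measurable_funM.
have bw : bounded_on Omega w.
  have [C HC] := buc; exists (`|c| + `|s| * C) => x Ox.
  by rewrite (le_trans (ler_normD _ _))// lerD2l normrM ler_wpM2l// HC.
have wW : W1p Omega p w (fun x => s *: Du x) := W1p_affine oO Ofin c s p1' ucW buc.
have wnW := W1p_pow oO Ofin n p1' wW bw.
have bwn : bounded_on Omega (fun x => w x ^+ n).
  have [C wC] := bw; exists (C ^+ n) => x Ox; rewrite normrX.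
  by rewrite lerXn2r ?nnegrE ?(le_trans _ (wC x Ox)) ?wC.
have mwn : measurable_fun Omega (fun x => w x ^+ n) by exact: measurable_funX.
have phiW := W1p_affine oO Ofin 0 s p1' wnW bwn.
pose phi x := 0 + s * w x ^+ n.
have mphi : measurable_fun Omega phi.
  by apply: measurable_funD => //; exact: measurable_funM.
have mf : measurable_fun Omega f.
  have [i1 _] := Hsol _ _ (W1p_cst oO Ofin 1 p0).
  have /measurable_EFinP := measurable_int _ i1.
  by apply: eq_measurable_fun => x _ /=; rewrite mulr1.
have mu : measurable_fun Omega u by case: uW => -[].
have [_ E] := Hsol _ _ phiW.
have G0 : 0 <= \int[dx]_(x in Omega) (enorm (Du x) `^ (p - 2) *
    dotv (Du x) (s *: ((n%:R * w x ^+ n.-1) *: (s *: Du x)))).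
  apply: Rintegral_ge0 => x Ox; rewrite !dotvZr.
  rewrite (_ : s * _ = (s * s) * (n%:R * w x ^+ n.-1 * dotv (Du x) (Du x))); last by ring.
  rewrite ss mul1r mulr_ge0 ?powR_ge0// mulr_ge0 ?dotv_ge0// mulr_ge0// exprn_ge0//.
  exact: w0.
have E1 : \int[dx]_(x in Omega) (`|u x| `^ (p - 2) * u x * phi x) =
    \int[dx]_(x in Omega) (uc x `^ (p - 1) * phi x).
  apply: ae_int_eq => //.
  - apply: measurable_funM => //; apply: measurable_funM => //.
    exact: measurable_powR_norm.
  - apply: measurable_funM => //.
    exact: (measurableT_comp (measurable_powR (p - 1)) muc).
  - apply: filterS uuc => x H Ox; rewrite (H Ox); congr (_ * _).
    exact/powR_norm_mul/uc0.
have E2 : \int[dx]_(x in Omega) (f x * phi x) = \int[dx]_(x in Omega) (fc x * phi x).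
  apply: ae_int_eq => //; [exact: measurable_funM|exact: measurable_funM|].
  by apply: filterS ffc => x H Ox; rewrite (H Ox).
have bphi : bounded_on Omega phi.
  have [C HC] := bwn; exists (`|s| * C) => x Ox.
  by rewrite /phi add0r normrM ler_wpM2l// HC.
have mup : measurable_fun Omega (fun x => uc x `^ (p - 1)).
  exact: (measurableT_comp (measurable_powR (p - 1)) muc).
have bmul g h : bounded_on Omega g -> bounded_on Omega h -> bounded_on Omega (fun x => g x * h x).
  move=> [C1 H1] [C2 H2]; exists (C1 * C2) => x Ox; rewrite normrM ler_pM ?H1 ?H2//.
have bup : bounded_on Omega (fun x => uc x `^ (p - 1)).
  have [C HC] := buc; exists (`|C| `^ (p - 1)) => x Ox; rewrite ger0_norm ?powR_ge0//.
  apply: ge0_ler_powR; rewrite ?nnegrE ?subr_ge0// ?(ltW (uc0 x Ox))//.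
  by rewrite (le_trans (ler_norm _))// (le_trans (HC x Ox))// ler_norm.
have I1 : dx.-integrable Omega (EFin \o (fun x => uc x `^ (p - 1) * phi x)).
  by apply: bounded_integrable => //; [exact: measurable_funM|exact: bmul].
have I2 : dx.-integrable Omega (EFin \o (fun x => fc x * phi x)).
  by apply: bounded_integrable => //; [exact: measurable_funM|exact: bmul].
move: E; rewrite /p_form E1 E2 => E.
have -> : \int[dx]_(x in Omega) ((s * (uc x `^ (p - 1) - fc x)) * (c + s * uc x) ^+ n) =
    \int[dx]_(x in Omega) (uc x `^ (p - 1) * phi x) - \int[dx]_(x in Omega) (fc x * phi x).
  rewrite -RintegralB//; apply: eq_Rintegral => x _; rewrite /phi /w; ring.
lra.
Qed.

End comparison.

Section clip.
Context {R : realType}.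
Implicit Types (lo hi s : R).

Definition clip lo hi s : R := Num.max lo (Num.min hi s).

Lemma clip_itv lo hi s : lo <= hi -> lo <= clip lo hi s <= hi.
Proof. by move=> lh; rewrite /clip le_max lexx /= ge_max lh /= ge_min lexx. Qed.

Lemma clip_id lo hi s : lo <= s <= hi -> clip lo hi s = s.
Proof.
by move=> /andP[h1 h2]; rewrite /clip (min_idPr h2) (max_idPr h1).
Qed.

Lemma measurable_clip d (T : measurableType d) (D : set T) lo hi (f : T -> R) :
  measurable_fun D f -> measurable_fun D (fun x => clip lo hi (f x)).
Proof.
by move=> mf; apply: measurable_maxr => //; exact: measurable_minr.
Qed.

End clip.

Section comparison_step.
Context {R : realType} {N : nat}.
Local Notation dx := (lebesgue_rV R N).
Variable Omega : set 'rV[R]_N.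
Hypothesis oO : open Omega.
Hypothesis Ofin : (dx Omega < +oo)%E.

(** The bound on [v] controls [v^b], and [net_power_scale_up] and
    [net_power_scale_down] show that [c e^t] and [c e^-t], with
    [t = - b tau / (p - 1)], are a super- and a subsolution for the extreme
    values of [v^b]. Beyond these levels the reaction term has a sign, and the
    power tests apply to [u] and to [M' - u]. *)
Lemma comparison_step (p a b c d tau m M : R) (u v f : 'rV[R]_N -> R) :
  1 < p -> a < 0 -> b < 0 -> 0 < c -> 0 < d -> net_power p a c = d `^ b ->
  0 <= tau -> 0 < m -> (forall x, f x = u x `^ a + v x `^ b) ->
  neumann_solution Omega p f u -> measurable_fun Omega v ->
  {ae dx, forall x, Omega x -> m <= u x <= M} ->
  {ae dx, forall x, Omega x -> d * expR (- tau) <= v x <= d * expR tau} ->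
  {ae dx, forall x, Omega x ->
    c * expR (- (- b * tau / (p - 1))) <= u x <= c * expR (- b * tau / (p - 1))}.
Proof.
move=> p1 a0 b0 c0 d0 cd tau0 m0 fE sol mv uM vd.
set t := - b * tau / (p - 1).
have p10 : 0 < p - 1 by rewrite subr_gt0.
have t0 : 0 <= t by rewrite divr_ge0 ?(ltW p10)// mulr_ge0// oppr_ge0 ltW.
have tE : t * (p - 1) = - b * tau by rewrite /t divfK// gt_eqF.
pose M' := Num.max M (Num.max m c).
have mM' : m <= M' by rewrite !le_max lexx orbT.
have cM' : c <= M' by rewrite !le_max lexx !orbT.
have mu : measurable_fun Omega u by case: sol => Du [[[]]].
(* representatives that satisfy the bounds everywhere *)
pose uc x := clip m M' (u x).
pose vc x := clip (d * expR (- tau)) (d * expR tau) (v x).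
have dl0 : 0 < d * expR (- tau) by rewrite mulr_gt0// expR_gt0.
have dlh : d * expR (- tau) <= d * expR tau.
  by rewrite ler_pM2l// ler_expR; lra.
have ucI x : m <= uc x <= M' by exact: clip_itv.
have vcI x : d * expR (- tau) <= vc x <= d * expR tau by exact: clip_itv.
have uc0 x : 0 < uc x by have /andP[h _] := ucI x; exact: lt_le_trans h.
have vc0 x : 0 < vc x by have /andP[h _] := vcI x; exact: lt_le_trans h.
have muc : measurable_fun Omega uc by exact: measurable_clip.
have mvc : measurable_fun Omega vc by exact: measurable_clip.
have uuc : {ae dx, forall x, Omega x -> u x = uc x}.
  apply: filterS uM => x H Ox; rewrite /uc clip_id//.
  by have /andP[-> h] := H Ox; rewrite le_max h.
have vvc : {ae dx, forall x, Omega x -> v x = vc x}.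
  by apply: filterS vd => x H Ox; rewrite /vc clip_id// H.
pose fc x := uc x `^ a + vc x `^ b.
have ffc : {ae dx, forall x, Omega x -> f x = fc x}.
  by apply: filterS2 uuc vvc => x H1 H2 Ox; rewrite fE (H1 Ox) (H2 Ox).
have mua : measurable_fun Omega (fun x => uc x `^ a).
  exact: (measurableT_comp (measurable_powR a) muc).
have mvb : measurable_fun Omega (fun x => vc x `^ b).
  exact: (measurableT_comp (measurable_powR b) mvc).
have mup : measurable_fun Omega (fun x => uc x `^ (p - 1)).
  exact: (measurableT_comp (measurable_powR (p - 1)) muc).
have mfc : measurable_fun Omega fc by exact: measurable_funD.
have uaB x : 0 <= uc x `^ a <= m `^ a.
  by rewrite powR_ge0 /=; apply: powR_neg_le => //; have /andP[] := ucI x.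
have vbB x : d `^ b * expR (tau * b) <= vc x `^ b <= d `^ b * expR (- tau * b).
  rewrite -!powR_mul_expR//; have /andP[h1 h2] := vcI x.
  by rewrite !powR_neg_le.
have upB x : 0 <= uc x `^ (p - 1) <= M' `^ (p - 1).
  rewrite powR_ge0 /=; have /andP[_ h] := ucI x.
  by apply: ge0_ler_powR; rewrite ?nnegrE ?(ltW p10) ?(ltW (uc0 x))// (le_trans (ltW (uc0 x))).
have vb0 x : 0 <= vc x `^ b by rewrite powR_ge0.
pose Cb := M' `^ (p - 1) + m `^ a + d `^ b * expR (- tau * b).
have bfc : bounded_on Omega fc.
  exists Cb => x _; have := upB x; have := uaB x; have := vbB x; have := vb0 x.
  by rewrite /Cb /fc => ? /andP[? ?] /andP[? ?] /andP[? ?]; rewrite ger0_norm; lra.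
have buc : bounded_on Omega uc.
  by exists M' => x _; rewrite gtr0_norm//; have /andP[] := ucI x.
have FC x (s : R) : s * s = 1 -> `|s * (uc x `^ (p - 1) - fc x)| <= Cb.
  move=> ss; have s1 : `|s| = 1.
    by apply/eqP; rewrite -(@eqrXn2 _ 2)// real_normK ?num_real// expr1n expr2 ss.
  rewrite normrM s1 mul1r ler_norml.
  have := upB x; have := uaB x; have := vbB x; have := vb0 x.
  by rewrite /Cb /fc => ? /andP[? ?] /andP[? ?] /andP[? ?]; apply/andP; split; lra.
have mg (s : R) : measurable_fun Omega (fun x => s * (uc x `^ (p - 1) - fc x)).
  by apply: measurable_funM => //; exact: measurable_funB.
have FE x : uc x `^ (p - 1) - fc x = net_power p a (uc x) - vc x `^ b.
  by rewrite /fc /net_power; ring.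
(* [K + K / (n + 2)] decreases to [K]; the strict gap gives a positive [delta] *)
have up : {ae dx, forall x, Omega x -> uc x <= c * expR t}.
  set K := c * expR t; have K0 : 0 < K by rewrite mulr_gt0// expR_gt0.
  have FK : d `^ b * expR (- tau * b) <= net_power p a K.
    apply: le_trans (net_power_scale_up p1 a0 c0 t0).
    by rewrite tE cd mulrC (_ : - tau * b = - b * tau)//; ring.
  apply: (@ae_le_lim _ _ _ uc K K) => n.
  have KK' : K < K + K / n.+2%:R by rewrite ltrDl divr_gt0.
  have E x : 0 + 1 * uc x = uc x by rewrite add0r mul1r.
  have w0 x : Omega x -> 0 <= 0 + 1 * uc x by rewrite E ltW.
  have H := power_test_inequality oO Ofin p1 sol muc buc (fun x _ => uc0 x) uuc mfc bfc ffc
    (mulr1 1) w0.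
  apply: (@ae_lt_of_power_tests _ _ _ oO Ofin uc _ K (K + K / n.+2%:R)
    (net_power p a (K + K / n.+2%:R) - net_power p a K) Cb M' muc (mg 1)) => //.
  - by move=> x _; rewrite ltW//=; have /andP[] := ucI x.
  - by move=> x _; exact: FC (mulr1 1).
  - exact: ltW.
  - by rewrite subr_gt0; exact: net_power_lt.
  - move=> x _ Kx; rewrite mul1r FE subr_ge0; have /andP[_ h] := vbB x.
    by apply: (le_trans h); apply: (le_trans FK); exact: net_power_le.
  - move=> x _ Kx; rewrite mul1r FE; have /andP[_ h] := vbB x.
    have := net_power_le p1 a0 (lt_trans K0 KK') Kx; lra.
  - move=> n'; have := H n'; congr (_ <= _); apply: eq_Rintegral => x _; by rewrite E.
(* the levels [k - k / (n + 2)] stay positive, so that [net_power] is monotone *)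
have low : {ae dx, forall x, Omega x -> c * expR (- t) <= uc x}.
  set k := c * expR (- t); have k0 : 0 < k by rewrite mulr_gt0// expR_gt0.
  have kc : k <= c by rewrite ler_piMr ?(ltW c0)// -expR0 ler_expR; lra.
  have Fk : net_power p a k <= d `^ b * expR (tau * b).
    apply: (le_trans (net_power_scale_down p1 a0 c0 t0)).
    by rewrite mulNr tE cd mulrC (_ : - (- b * tau) = tau * b)//; ring.
  suff : {ae dx, forall x, Omega x -> M' + -1 * uc x <= M' - k}.
    by apply: filterS => x H Ox; have := H Ox; lra.
  apply: (@ae_le_lim _ _ _ _ (M' - k) k) => n.
  have n20 : (0 : R) < n.+2%:R^-1 by rewrite invr_gt0.
  have n21 : (n.+2%:R^-1 : R) < 1 by rewrite invf_lt1// ltr1n.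
  have k'0 : 0 < k - k / n.+2%:R by rewrite subr_gt0 gtr_pMr.
  have kk' : k - k / n.+2%:R < k by rewrite gtrBl mulr_gt0.
  have ss : (-1 : R) * -1 = 1 by rewrite mulrNN mulr1.
  have w0 x : Omega x -> 0 <= M' + -1 * uc x.
    by move=> _; have /andP[h1 h2] := ucI x; lra.
  have H := power_test_inequality oO Ofin p1 sol muc buc (fun x _ => uc0 x) uuc mfc bfc ffc ss w0.
  apply: (@ae_lt_of_power_tests _ _ _ oO Ofin (fun x => M' + -1 * uc x) _ (M' - k) (M' - k + k / n.+2%:R)
    (net_power p a k - net_power p a (k - k / n.+2%:R)) Cb M' _ (mg (-1))) => //.
  - by apply: measurable_funD => //; exact: measurable_funM.
  - by move=> x _; have /andP[h1 h2] := ucI x; have h3 := uc0 x; apply/andP; split; lra.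
  - by move=> x _; exact: FC ss.
  - by rewrite subr_ge0 (le_trans kc).
  - by rewrite ltrDl mulr_gt0.
  - by rewrite subr_gt0; exact: net_power_lt.
  - move=> x _ Kx; have xk : uc x <= k by lra.
    rewrite FE; have /andP[h _] := vbB x; have := net_power_le p1 a0 (uc0 x) xk; lra.
  - move=> x _ Kx; have xk : uc x <= k - k / n.+2%:R.
      by move: Kx; move: (k / n.+2%:R) => q Kx; lra.
    rewrite FE; have /andP[h _] := vbB x; have := net_power_le p1 a0 (uc0 x) xk; lra.
apply: filterS3 uuc up low => x H1 H2 H3 Ox.
by rewrite (H1 Ox) (H2 Ox) (H3 Ox).
Qed.

End comparison_step.

(** * Constant solutions *)
Section constants.
Context {R : realType}.
Implicit Types (a b c d s t p : R).

Lemma powR_le_exp s a b : 1 <= s -> a <= b -> s `^ a <= s `^ b.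
Proof. by move=> s1 ab; rewrite ler_powR. Qed.

Lemma powR_ge1 s a : 1 <= s -> 0 <= a -> 1 <= s `^ a.
Proof. by move=> s1 a0; rewrite -(powRr0 s) powR_le_exp. Qed.

Lemma powR_continuous_at a s : 0 < s -> {for s, continuous (fun x : R => x `^ a)}.
Proof.
move=> s0; apply/differentiable_continuous/derivable1_diffP.
by have [] := is_derive1_powR a s0.
Qed.

Lemma net_power_continuous p a s : 0 < s -> {for s, continuous (net_power p a)}.
Proof.
by move=> s0; apply: cvgB; exact: powR_continuous_at.
Qed.

Lemma net_power1 p a : net_power p a 1 = 0 :> R.
Proof. by rewrite /net_power !powR1 subrr. Qed.

(** At [X = (y + 1)^(1 / (p - 1))] the leading power is [y + 1], and the negative
    power is at most 1. *)
Lemma net_power_surj p a (y : R) : 1 < p -> a < 0 -> 0 <= y ->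
  exists2 d, 1 <= d & net_power p a d = y.
Proof.
move=> p1 a0 y0; have p10 : 0 < p - 1 by rewrite subr_gt0.
pose X := (y + 1) `^ (p - 1)^-1.
have X1 : 1 <= X.
  by apply: powR_ge1; [rewrite lerDr|rewrite invr_ge0 ltW].
have XE : X `^ (p - 1) = y + 1.
  rewrite /X -powRrM mulVf ?powRr1//; first lra.
  by rewrite gt_eqF.
have Xa : X `^ a <= 1 by rewrite -(powRr0 X) powR_le_exp// ltW.
have cF : {within `[1, X], continuous (net_power p a)}.
  apply: continuous_in_subspaceT => x /set_mem; rewrite /= in_itv/= => /andP[x1 _].
  by apply: net_power_continuous; exact: lt_le_trans x1.
have := @IVT R (net_power p a) 1 X y X1 cF.
have FX : y <= net_power p a X by rewrite /net_power XE; lra.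
rewrite net_power1 ge_min y0 /= le_max FX orbT => /(_ isT)[d].
by rewrite in_itv/= => /andP[d1 _] dE; exists d.
Qed.

Lemma net_power_lt_inv p a s t : 1 < p -> a < 0 -> 0 < t -> net_power p a s < net_power p a t -> s < t.
Proof.
move=> p1 a0 t0 H; rewrite ltNge; apply/negP => /(net_power_le p1 a0 t0).
by rewrite leNgt H.
Qed.

(** [D c] is the solution [d] of the second equation. It is continuous because
    [net_power] is strictly increasing. The second equation also gives
    [D C <= (2 C^A)^(1 / (p2 - 1))] with [A] the positive part of [a2]; with [B]
    the positive part of [b1], the term [(D C)^b1] is at most a multiple of
    [C^th], where [th = A B / (p2 - 1) < p1 - 1]. The number [C] is chosen so
    that [C^(p1 - 1) = L C^th] absorbs both terms on the right. *)
Lemma constant_solution p1 p2 a1 a2 b1 b2 : 1 < p1 -> 1 < p2 -> a1 < 0 -> b2 < 0 ->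
  b1 < p1 - 1 -> a2 < p2 - 1 ->
  exists c d, [/\ 1 <= c, 1 <= d, net_power p1 a1 c = d `^ b1 & net_power p2 b2 d = c `^ a2].
Proof.
move=> hp1 hp2 ha1 hb2 hb1 ha2.
have p20 : 0 < p2 - 1 by rewrite subr_gt0.
have /choice[D HD] : forall c : R, exists d, 1 <= d /\ net_power p2 b2 d = c `^ a2.
  by move=> c; have [d d1 dE] := net_power_surj hp2 hb2 (powR_ge0 c a2); exists d.
have D0 c : 0 < D c by have [h _] := HD c; exact: lt_le_trans h.
have cD c : 0 < c -> {for c, continuous D}.
  move=> c0; apply/cvgrPdist_lt => e e0.
  pose e' := Num.min e (D c / 2).
  have e'0 : 0 < e' by rewrite lt_min e0/= divr_gt0.
  have e'e : e' <= e by rewrite ge_min lexx.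
  have e'D : 0 < D c - e'.
    have : e' <= D c / 2 by rewrite ge_min lexx orbT.
    by have := D0 c; lra.
  have H1 : net_power p2 b2 (D c - e') < c `^ a2.
    by rewrite -(HD c).2; apply: net_power_lt => //; rewrite gtrBl.
  have H2 : c `^ a2 < net_power p2 b2 (D c + e').
    by rewrite -(HD c).2; apply: net_power_lt => //; rewrite ltrDl.
  have C := @powR_continuous_at a2 c c0.
  near=> x.
  have K1 : net_power p2 b2 (D c - e') < net_power p2 b2 (D x).
    rewrite (HD x).2; near: x; exact: (cvgr_gt _ C).
  have K2 : net_power p2 b2 (D x) < net_power p2 b2 (D c + e').
    rewrite (HD x).2; near: x; exact: (cvgr_lt _ C).
  have L1 := net_power_lt_inv hp2 hb2 (D0 x) K1.
  have L2 := net_power_lt_inv hp2 hb2 (addr_gt0 (D0 c) e'0) K2.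
  by rewrite ltr_norml; apply/andP; split; lra.
pose A := Num.max a2 0; pose B := Num.max b1 0.
pose th := A * (B / (p2 - 1)).
have A0 : 0 <= A by rewrite le_max lexx orbT.
have B0 : 0 <= B by rewrite le_max lexx orbT.
have Ap : A < p2 - 1 by rewrite gt_max ha2.
have Bp : B < p1 - 1 by rewrite gt_max hb1 subr_gt0.
have thB : th <= B.
  rewrite /th mulrCA ler_piMr// ler_pdivrMr// mul1r; exact: ltW.
have thp : 0 < p1 - 1 - th by lra.
have th0 : 0 <= th by rewrite mulr_ge0// divr_ge0// ltW.
pose L := 1 + 2 `^ (B / (p2 - 1)) : R.
have L1 : 1 <= L by rewrite lerDl powR_ge0.
pose C := L `^ (p1 - 1 - th)^-1.
have C1 : 1 <= C.
  by apply: powR_ge1 => //; rewrite invr_ge0 ltW.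
have C0 : 0 < C by exact: lt_le_trans C1.
have CE : C `^ (p1 - 1) = L * C `^ th.
  rewrite -{1}(subrK th (p1 - 1)) powRD; last by apply/implyP => _; rewrite gt_eqF.
  by rewrite {1}/C -powRrM mulVf ?powRr1// ?gt_eqF// (le_trans _ L1).
have CA1 : 1 <= C `^ A by exact: powR_ge1.
have Cth1 : 1 <= C `^ th by exact: powR_ge1.
have DC : D C `^ b1 <= 2 `^ (B / (p2 - 1)) * C `^ th.
  have [d1 dE] := HD C.
  apply: (le_trans (_ : _ <= D C `^ B)); first by rewrite powR_le_exp// le_max lexx.
  have : D C `^ (p2 - 1) <= 2 * C `^ A.
    have : D C `^ (p2 - 1) = C `^ a2 + D C `^ b2 by rewrite -dE /net_power subrK.
    have h1 : C `^ a2 <= C `^ A by rewrite powR_le_exp// le_max lexx.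
    have h2 : D C `^ b2 <= 1 by rewrite -(powRr0 (D C)) powR_le_exp// ltW.
    lra.
  have e0 : 0 <= B / (p2 - 1) by rewrite divr_ge0// ltW.
  move=> h; have := ge0_ler_powR e0 _ _ h.
  rewrite !nnegrE powR_ge0 mulr_ge0 ?powR_ge0// => /(_ isT isT).
  have E1 : (D C `^ (p2 - 1)) `^ (B / (p2 - 1)) = D C `^ B.
    by rewrite -powRrM mulrC divfK// gt_eqF.
  have E2 : (2 * C `^ A) `^ (B / (p2 - 1)) = 2 `^ (B / (p2 - 1)) * C `^ th.
    by rewrite (powRM _ (ler0n R 2) (powR_ge0 _ _)) -(powRrM C A).
  by rewrite E1 E2.
pose H c := net_power p1 a1 c - D c `^ b1.
have cH : {within `[1, C], continuous H}.
  apply: continuous_in_subspaceT => x /set_mem; rewrite /= in_itv/= => /andP[x1 _].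
  have x0 : 0 < x by exact: lt_le_trans x1.
  apply: cvgB; first exact: net_power_continuous.
  exact: (@continuous_comp _ _ _ D (fun y : R => y `^ b1) x (cD x x0)
    (@powR_continuous_at b1 (D x) (D0 x))).
have H1 : H 1 <= 0 by rewrite /H net_power1 sub0r oppr_le0 powR_ge0.
have HC : 0 <= H C.
  rewrite /H /net_power CE /L mulrDl mul1r.
  have : C `^ a1 <= 1 by rewrite -(powRr0 C) powR_le_exp// ltW.
  lra.
have := @IVT R H 1 C 0 C1 cH.
rewrite ge_min H1 /= le_max HC orbT => /(_ isT)[c].
rewrite in_itv/= => /andP[c1 _] /eqP; rewrite subr_eq0 => /eqP cE.
by exists c, (D c); have [d1 dE] := HD c.
Unshelve. all: by end_near. Qed.

End constants.

Section constant_functions.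
Context {R : realType} {N : nat}.
Local Notation dx := (lebesgue_rV R N).
Variable Omega : set 'rV[R]_N.
Hypothesis oO : open Omega.
Hypothesis Ofin : (dx Omega < +oo)%E.

Lemma enorm0 : enorm (0 : 'rV[R]_N) = 0.
Proof.
by rewrite /enorm /dotv big1 ?sqrtr0// => i _; rewrite mxE mul0r.
Qed.

(** The gradient term vanishes and the zero-order terms agree pointwise. *)
Lemma neumann_cst p (c K : R) : 1 < p -> 0 < c -> c `^ (p - 1) = K ->
  neumann_solution Omega p (fun=> K) (cst c).
Proof.
move=> p1 c0 cK; have mO := open_measurable_rV oO.
have p0 : 0 <= p by rewrite (le_trans _ (ltW p1)).
exists (cst 0); split; first exact: W1p_cst.
move=> phi Dphi [Lphi _ _].
have iphi := Lp_integrable oO Ofin (ltW p1) Lphi.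
split; first exact: (integrableZl mO K iphi).
rewrite /p_form [X in X + _](_ : _ = 0) ?add0r; last first.
  under eq_Rintegral.
    move=> x _; rewrite (_ : dotv _ _ = 0) ?mulr0; last first.
      by rewrite /dotv big1// => i _; rewrite mxE mul0r.
    over.
  by rewrite Rintegral_cst// mul0r.
apply: eq_Rintegral => x _; congr (_ * _).
by rewrite (powR_norm_mul _ c0) cK.
Qed.

Lemma int_C1holder_plus_cst (tau c : R) : 0 < c ->
  int_C1holder_plus Omega tau (cst c : 'rV[R]_N -> R).
Proof.
move=> c0; split => //; exists (cst 0); split.
  split; [exact/continuous_subspaceT/cst_continuous|exact/continuous_subspaceT/cst_continuous|].
  by move=> x _ i; rewrite mxE; exact: is_derive_cst.
by exists 0 => x y _ _; rewrite subr0 enorm0 mul0r.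
Qed.

End constant_functions.

Section supnorms.
Context {R : realType} {N : nat}.
Variable Omega : set 'rV[R]_N.
Hypothesis bO : bounded_set Omega.

Lemma closure_compact : compact (closure Omega).
Proof.
have [M [_ KM]] := bO.
have H : Omega `<=` cbox (fun=> - (`|M| + 1)) (fun=> `|M| + 1).
  move=> x /KM xM i; have := xM (`|M| + 1).
  move=> /(_ _)/(le_trans (coord_le_norm x i)); rewrite ler_norml; apply.
  by rewrite (le_lt_trans (ler_norm M))// ltrDl.
have K := @cbox_compact R N (fun=> - (`|M| + 1)) (fun=> `|M| + 1).
have C := compact_closed (@norm_hausdorff _ _) K.
apply: subclosed_compact K _; first exact: closed_closure.
by rewrite [X in _ `<=` X]((closure_id _).1 C); exact: closureS.
Qed.

Lemma le_supnorm (w : 'rV[R]_N -> R) x : {within closure Omega, continuous w} ->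
  Omega x -> `|w x| <= supnorm Omega w.
Proof.
move=> cw Ox; apply: sup_upper_bound; last by exists x.
split; first by exists `|w x|, x.
have /compact_bounded[M [_ HM]] := continuous_compact cw closure_compact.
exists (`|M| + 1) => _ [y Oy <-]; apply: HM; last by exists y => //; exact: subset_closure.
by rewrite (le_lt_trans (ler_norm M))// ltrDl.
Qed.

Lemma supnorm_ge0 (w : 'rV[R]_N -> R) : {within closure Omega, continuous w} ->
  Omega !=set0 -> 0 <= supnorm Omega w.
Proof. by move=> cw [x Ox]; exact: le_trans (normr_ge0 _) (le_supnorm cw Ox). Qed.

End supnorms.

(** * Uniqueness in the rectangle and the theorem *)
Section uniqueness.
Context {R : realType} {N : nat}.
Local Notation dx := (lebesgue_rV R N).
Variable Omega : set 'rV[R]_N.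
Hypothesis oO : open Omega.
Hypothesis Ofin : (dx Omega < +oo)%E.

(** Alternating [comparison_step] between the two equations multiplies the
    logarithmic width of the interval that contains [v] by [q < 1]. *)
Lemma bounded_solution_constant (p1 p2 a1 a2 b1 b2 c d m M : R) (u v : 'rV[R]_N -> R) :
  1 < p1 -> 1 < p2 -> a1 < 0 -> b1 < 0 -> a2 < 0 -> b2 < 0 ->
  a2 * b1 < (p1 - 1) * (p2 - 1) -> 1 <= c -> 1 <= d ->
  net_power p1 a1 c = d `^ b1 -> net_power p2 b2 d = c `^ a2 -> 0 < m ->
  neumann_solution Omega p1 (fun x => u x `^ a1 + v x `^ b1) u ->
  neumann_solution Omega p2 (fun x => u x `^ a2 + v x `^ b2) v ->
  {ae dx, forall x, Omega x -> m <= u x <= M} ->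
  {ae dx, forall x, Omega x -> m <= v x <= M} ->
  ae_equal_on Omega u (cst c) /\ ae_equal_on Omega v (cst d).
Proof.
move=> hp1 hp2 ha1 hb1 ha2 hb2 hab c1 d1 cE dE m0 solu solv uM vM.
have c0 : 0 < c by exact: lt_le_trans c1.
have d0 : 0 < d by exact: lt_le_trans d1.
have p10 : 0 < p1 - 1 by rewrite subr_gt0.
have p20 : 0 < p2 - 1 by rewrite subr_gt0.
have mu : measurable_fun Omega u by case: solu => Du [[[]]].
have mv : measurable_fun Omega v by case: solv => Dv [[[]]].
pose P tau := {ae dx, forall x, Omega x -> d * expR (- tau) <= v x <= d * expR tau}.
pose Q s := {ae dx, forall x, Omega x -> c * expR (- s) <= u x <= c * expR s}.
have stepQ tau : 0 <= tau -> P tau -> Q (- b1 * tau / (p1 - 1)).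
  by move=> t0 Pt; exact: (comparison_step oO Ofin hp1 ha1 hb1 c0 d0 cE t0 m0 _ solu mv uM Pt).
have stepP s : 0 <= s -> Q s -> P (- a2 * s / (p2 - 1)).
  move=> s0 Qs; apply: (comparison_step oO Ofin hp2 hb2 ha2 d0 c0 dE s0 m0 _ solv mu vM Qs).
  by move=> x; rewrite addrC.
pose q := a2 * b1 / ((p1 - 1) * (p2 - 1)).
have ab0 : 0 < a2 * b1 by rewrite nmulr_rgt0.
have q0 : 0 <= q by rewrite divr_ge0 ?(ltW ab0)// ltW// mulr_gt0.
have q1 : q < 1 by rewrite ltr_pdivrMr ?mul1r// mulr_gt0.
have step tau : 0 <= tau -> P tau -> P (q * tau).
  move=> t0 Pt; have s0 : 0 <= - b1 * tau / (p1 - 1).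
    by rewrite divr_ge0 ?(ltW p10)// mulr_ge0// oppr_ge0; exact: ltW.
  have := stepP _ s0 (stepQ _ t0 Pt).
  rewrite (_ : - a2 * (- b1 * tau / (p1 - 1)) / (p2 - 1) = q * tau)//.
  by rewrite /q invfM; ring.
(* any interval with positive endpoints lies between [d e^-tau0] and [d e^tau0] *)
pose tau0 := d / m + `|M|.
have tau00 : 0 <= tau0 by rewrite addr_ge0// divr_ge0 ?(ltW d0) ?(ltW m0).
have P0 : P tau0.
  apply: filterS vM => x H Ox; have /andP[h1 h2] := H Ox.
  have e1 := expR_ge1Dx tau0.
  have M0 := normr_ge0 M.
  have dm0 : 0 <= d / m by rewrite divr_ge0 ?(ltW d0) ?(ltW m0).
  have e2 : d / m <= expR tau0 by apply: le_trans e1; rewrite /tau0; lra.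
  have e3 : `|M| <= expR tau0 by apply: le_trans e1; rewrite /tau0; lra.
  apply/andP; split.
    apply: le_trans h1; rewrite expRN ler_pdivrMr ?expR_gt0//.
    by rewrite mulrC -ler_pdivrMr.
  apply: (le_trans h2); apply: (le_trans (ler_norm M)); apply: (le_trans e3).
  by rewrite ler_peMl// expR_ge0.
have Pn n : P (q ^+ n * tau0).
  elim: n => [|n IH]; first by rewrite expr0 mul1r.
  by rewrite exprS -mulrA; apply: step => //; rewrite mulr_ge0// exprn_ge0.
have Pd : P 0.
  have := ae_foralln Pn.
  apply: filterS => x H Ox; rewrite oppr0 expR0 mulr1.
  have L0 : q ^+ n * tau0 @[n --> \oo] --> (0 : R).
    rewrite -(mul0r tau0); apply: cvgMl; apply: cvg_expr.
    by rewrite ger0_norm.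
  have LE (s : R) : d * expR (s * (q ^+ n * tau0)) @[n --> \oo] --> d.
    rewrite -[X in _ --> X]mulr1; apply: cvgMr; rewrite -expR0 -(mulr0 s).
    apply: (@continuous_cvg _ _ _ _ _ _ expR); first exact: continuous_expR.
    exact: cvgMr.
  have L1 := LE 1; have L2 := LE (- 1).
  apply/andP; split.
    rewrite -(cvg_lim (@Rhausdorff R) L2); apply: limr_le.
      by apply/cvg_ex; eexists; exact: L2.
    by apply: nearW => n; rewrite mulN1r; have /andP[] := H n Ox.
  rewrite -(cvg_lim (@Rhausdorff R) L1); apply: limr_ge.
    by apply/cvg_ex; eexists; exact: L1.
  by apply: nearW => n; rewrite mul1r; have /andP[] := H n Ox.
have := stepQ 0 (lexx 0) Pd; rewrite mulr0 mul0r => Qc; split.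
  apply: filterS Qc => x H Ox; have := H Ox.
  by rewrite oppr0 expR0 mulr1 => /le_anti.
apply: filterS Pd => x H Ox; have := H Ox.
by rewrite oppr0 expR0 mulr1 => /le_anti.
Qed.

End uniqueness.

Section barriers.
Context {R : realType} {N : nat}.
Variable Omega : set 'rV[R]_N.
Hypothesis bO : bounded_set Omega.
Hypothesis nO : Omega !=set0.

(** Each sup norm is one of the nonnegative summands in the bound. *)
Lemma Lambda_bound_halves (p L : R) (phi y : 'rV[R]_N -> R) :
  {within closure Omega, continuous phi} -> {within closure Omega, continuous y} ->
  Lambda_bound Omega p phi y < L ->
  forall x, Omega x -> `|phi x| < L / 2 /\ `|y x| < L / 2.
Proof.
move=> cphi cy; rewrite /Lambda_bound => H x Ox.
have h1 := le_supnorm bO cphi Ox; have h2 := le_supnorm bO cy Ox.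
have h3 := supnorm_ge0 bO cphi nO; have h4 := supnorm_ge0 bO cy nO.
have := powR_ge0 (3 `^ (p - 1) - 2 `^ (p - 1)) (- (p - 1)^-1 : R).
set X := _ `^ _ in H *; move=> X0; split; lra.
Qed.

Lemma barrier_bounds (p L : R) (phi y : 'rV[R]_N -> R) :
  {within closure Omega, continuous phi} -> {within closure Omega, continuous y} ->
  (forall x, closure Omega x -> 0 < phi x) -> 2 <= L -> Lambda_bound Omega p phi y < L ->
  forall x, Omega x -> [/\ 2^-1 <= sub_fun L phi x, sub_fun L phi x <= 1,
      L <= super_fun L y x & super_fun L y x <= 2 * L ^+ 2].
Proof.
move=> cphi cy phi0 L2 HL x Ox; have p0 := phi0 x (subset_closure Ox).
have [] := Lambda_bound_halves cphi cy HL Ox.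
rewrite (gtr0_norm p0) ltr_norml => p1 /andP[y1 y2].
have L0 : 0 < L by lra.
rewrite /sub_fun /super_fun; split.
- by rewrite mulrC ler_pdivlMr//; lra.
- by rewrite mulrC ler_pdivrMr//; lra.
- nra.
- nra.
Qed.

End barriers.

Theorem theorem4p2 (R : realType) (N : nat) (Omega : set 'rV[R]_N)
    (p1 p2 a1 a2 b1 b2 lam1 lam2 : R)
    (phi1 phi2 y1 y2 : 'rV[R]_N -> R)
    (hN : (2 <= N)%N)
    (hOmega : smooth_bounded_domain Omega)
    (hp1 : 1 < p1 < N%:R) (hp2 : 1 < p2 < N%:R)
    (ha1 : -1 < a1 < 0) (hb2 : -1 < b2 < 0)
    (hb1 : -1 < b1 < p1 - 1) (ha2 : -1 < a2 < p2 - 1)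
    (hlam1 : 0 < lam1) (hlam1_first : first_neumann_eigenvalue Omega p1 lam1)
    (hlam2 : 0 < lam2) (hlam2_first : first_neumann_eigenvalue Omega p2 lam2)
    (hphi1 : neumann_eigenfunction Omega p1 lam1 phi1)
    (hphi1_pos : int_C1_plus Omega phi1)
    (hphi2 : neumann_eigenfunction Omega p2 lam2 phi2)
    (hphi2_pos : int_C1_plus Omega phi2)
    (hy1 : dirichlet_solution Omega p1 (fun=> 1) y1)
    (hy1_reg : exists2 tau : R, 0 < tau < 1 & C1holder_closure Omega tau y1)
    (hy2 : dirichlet_solution Omega p2 (fun=> 1) y2)
    (hy2_reg : exists2 tau : R, 0 < tau < 1 & C1holder_closure Omega tau y2) :
  exists2 Lambda0 : R, 0 < Lambda0 &
  forall Lambda : R, Lambda0 <= Lambda ->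
    Num.max (Lambda_bound Omega p1 phi1 y1)
            (Lambda_bound Omega p2 phi2 y2) < Lambda ->
  exists u v : 'rV[R]_N -> R,
    [/\ system_solution Omega p1 p2 a1 a2 b1 b2 u v,
        (exists2 tau : R, 0 < tau < 1 &
           int_C1holder_plus Omega tau u /\ int_C1holder_plus Omega tau v),
        in_rectangle Omega Lambda phi1 phi2 y1 y2 u v
      & let g1 := Num.max (- a1) (- b1) in
        let g2 := Num.max (- a2) (- b2) in
        -1 < a2 < 0 -> -1 < b1 < 0 ->
        Num.max (- g1 * a1 / (p1 - 1)) (- g2 * b1 / (p2 - 1)) < p1 - 1 ->
        Num.max (- g1 * a2 / (p1 - 1)) (- g2 * b2 / (p2 - 1)) < p2 - 1 ->
        forall u' v' : 'rV[R]_N -> R,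
          system_solution Omega p1 p2 a1 a2 b1 b2 u' v' ->
          in_rectangle Omega Lambda phi1 phi2 y1 y2 u' v' ->
          ae_equal_on Omega u' u /\ ae_equal_on Omega v' v].
Proof.
have [oO nO _ bO _] := hOmega.
have Ofin := bounded_lebesgue_rV_lty (open_measurable_rV oO) bO.
have /andP[p11 _] := hp1; have /andP[p21 _] := hp2.
have /andP[_ a10] := ha1; have /andP[_ b20] := hb2.
have /andP[_ b1p] := hb1; have /andP[_ a2p] := ha2.
have [c [d [c1 d1 cE dE]]] := constant_solution p11 p21 a10 b20 b1p a2p.
have c0 : 0 < c by exact: lt_le_trans c1.
have d0 : 0 < d by exact: lt_le_trans d1.
have [[G1 [cphi1 _ _]] phi1_gt0] := hphi1_pos.
have [[G2 [cphi2 _ _]] phi2_gt0] := hphi2_pos.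
have [_ _ [_ [[cy1 _ _] _]]] := hy1_reg.
have [_ _ [_ [[cy2 _ _] _]]] := hy2_reg.
exists (c + d + 2); first by rewrite !addr_gt0.
move=> L LL; rewrite gt_max => /andP[B1 B2].
have L2 : 2 <= L by lra.
have bar1 := barrier_bounds bO nO cphi1 cy1 phi1_gt0 L2 B1.
have bar2 := barrier_bounds bO nO cphi2 cy2 phi2_gt0 L2 B2.
exists (cst c), (cst d); split.
- split; first by apply: aeW => x _.
  + apply: (@neumann_cst R N Omega oO Ofin p1 c (c `^ a1 + d `^ b1)) => //.
    by rewrite -cE /net_power; ring.
  + apply: (@neumann_cst R N Omega oO Ofin p2 d (c `^ a2 + d `^ b2)) => //.
    by rewrite -dE /net_power; ring.
- exists 2^-1; first by apply/andP; split; lra.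
  by split; exact: int_C1holder_plus_cst.
- split; apply: aeW => x Ox.
  + by have [_ h1 h2 _] := bar1 x Ox; apply/andP; split => /=; lra.
  + by have [_ h1 h2 _] := bar2 x Ox; apply/andP; split => /=; lra.
- move=> g1 g2 /andP[_ a20] /andP[_ b10]; rewrite gt_max => /andP[_ Hq] _.
  move=> u v [_ solu solv] [ru rv].
  have p10 : 0 < p1 - 1 by rewrite subr_gt0.
  have p20 : 0 < p2 - 1 by rewrite subr_gt0.
  have hab : a2 * b1 < (p1 - 1) * (p2 - 1).
    move: Hq; rewrite ltr_pdivrMr//; apply: le_lt_trans.
    have : - a2 <= g2 by rewrite le_max lexx.
    nra.
  apply: (bounded_solution_constant oO Ofin p11 p21 a10 b10 a20 b20 hab c1 d1 cE dE
    (m := 2^-1) (M := 2 * L ^+ 2) _ solu solv) => //.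
  + apply: filterS ru => x H Ox; have [h1 _ _ h2] := bar1 x Ox.
    by have /andP[h3 h4] := H Ox; rewrite (le_trans h1)//= (le_trans h4).
  + apply: filterS rv => x H Ox; have [h1 _ _ h2] := bar2 x Ox.
    by have /andP[h3 h4] := H Ox; rewrite (le_trans h1)//= (le_trans h4).
Qed.
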